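(* Let $K\subset\mathbb R^n$ be a full-dimensional compact convex body with barycenter $0$, $\operatorname{int}(K)\cap\mathbb Z^n=\{0\}$ and $\operatorname{vol}(K)=(n+1)^n/n!$, let $\varphi$ be a BB13 potential of $K$, and let $v\in\mathbb R^n\setminus E$. Suppose that the toric monomial rays $u_{k,t}$ associated with $v$ converge, along a fixed subsequence of $k$'s, to a subsequential toric limit ray of the form $\psi_t(x)=\varphi(x-tc)+nt$ for a vector $c\in\mathbb R^n$ and all $x\in\mathbb R^n$, $t\ge0$. Put $\ell(y)=n-\langle c,y\rangle$, and let $K=\operatorname{conv}(\{p\}\cup B)$ be the resulting pyramid with apex $p$, where $\{p\}=\{y\in K:\ell(y)=0\}$ (a single point) and $B=\{y\in K:\ell(y)=n+1\}$. Then \[ \langle v,p\rangle=\min_{y\in K}\langle v,y\rangle. \]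
   Context: The barycenter of $K$ is $\frac1{\operatorname{vol}(K)}\int_K y\,dy$; $h_K(x)=\max_{y\in K}\langle y,x\rangle$ is the support function. Torus: $X=(\mathbb C^* )^n$ with coordinates $z_i=\exp(x_i/2+i\theta_i)$, $x\in\mathbb R^n$, $\theta\in(\mathbb R/2\pi\mathbb Z)^n$; $d\nu=dx\,d\theta$, with $d\theta$ Haar measure of total mass one. Torus-invariant functions on $X$ are identified with functions of $x\in\mathbb R^n$. BB13 potential of $K$: a smooth strictly convex $\varphi:\mathbb R^n\to\mathbb R$ such that $\nabla\varphi$ is a diffeomorphism from $\mathbb R^n$ onto $\operatorname{int}(K)$, $\det(D^2\varphi)=e^{-\varphi}$, and $\varphi-h_K$ is bounded. For $k\ge1$: $S_k=\mathbb Z^n\cap\operatorname{int}(kK)$, $N_k=(n+1)k$; $H_k$ is the Hilbert space of holomorphic $f$ on $X$ with $\int_X|f|^2e^{-k\varphi}d\nu<\infty$ (weighted $L^2$ inner product). The Laurent monomials $z^m$, $m\in S_k$, form an orthogonal basis of $H_k$; $s_{k,m}=z^m/\|z^m\|_{H_k}$. For a point $q\in X$, $j\ge1$: $F_{k,q}^j=\{s\in H_k:\operatorname{ord}_q(s)\ge j\}$ (vanishing order at $q$, $\operatorname{ord}_q(0)=+\infty$); $P_{k,q}^j$ is the orthogonal projection of $H_k$ onto $F_{k,q}^j$. The subscript $1$ denotes the point $(1,\dots,1)$. The exceptional set $E$: for a nonzero subspace $F\subseteq H_k$ of dimension $r$, write a nonzero $\xi\in\bigwedge^rF$ as $\xi=\sum_{\#I=r}c_I\bigwedge_{m\in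 I}s_{k,m}$ and let $P(F)=\operatorname{conv}\{\sum_{m\in I}m:c_I\ne0\}$ (independent of $\xi$). $E$ is the countable union, over all $k\ge1$ and all $1\le j\le N_k$ with $F_{k,1}^j\ne0$, of the linear hyperplanes perpendicular to the nonzero differences of vertices of $P(F_{k,1}^j)$. Weights and rays: for $v\in\mathbb R^n\setminus E$ and $p_R=(e^{-Rv_1},\dots,e^{-Rv_n})$, the operators $\sum_{j=1}^{N_k}P_{k,p_R}^j$ converge in operator norm as $R\to\infty$ to an operator that is diagonal in the basis $(s_{k,m})_{m\in S_k}$, whose eigenvalue on $s_{k,m}$ is an integer $q_{k,m}\in[0,N_k]$. The associated toric monomial ray is $u_{k,t}(z)=\frac1k\log\sum_{m\in S_k}|s_{k,m}(z)|^2e^{tq_{k,m}}$, $t\ge0$. Subsequential toric limit ray for $v$: a torus-invariant ray $\psi_t$, $t\ge0$, that is the locally uniform limit on $X\times[0,\infty)$ of $u_{k,t}$ along some sequence of positive integers $k\to\infty$, with $\psi_0=\varphi$, $0\le\psi_t-\varphi\le(n+1)t$, $(x,t)\mapsto\psi_t(x)$ convex on $\mathbb R^n\times[0,\infty)$, and $-\log\bigl(\frac1{\operatorname{vol}(K)}\int_Xe^{-\psi_t}d\nu\bigr)=nt$ for all $t\ge0$. In this situation it is known that $c\ne0$, $0\le\ell\le n+1$ on $K$, the set $\{y\in K:\ell(y)=0\}$ is a single point $p$, and $K=\operatorname{conv}(\{p\}\cup B)$. *)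

(* Defs.v *)
From HB Require Import structures.
From mathcomp Require Import all_boot all_order all_algebra.
From mathcomp Require Import complex.
From mathcomp Require Import all_classical all_reals all_analysis.

Set Implicit Arguments.
Unset Strict Implicit.
Unset Printing Implicit Defensive.

Import Order.TTheory GRing.Theory Num.Theory.
Import numFieldNormedType.Exports.

Local Open Scope classical_set_scope.
Local Open Scope ring_scope.

(** * Product measures on R^n *)

Section sigma_finite_pushforward.
Context d1 d2 (T1 : measurableType d1) (T2 : measurableType d2) (R : realType)
  (f : T1 -> T2) (g : T2 -> T1) (mf : measurable_fun setT f)
  (mg : measurable_fun setT g) (fK : cancel f g)
  (m : {sigma_finite_measure set T1 -> \bar R}).

Let mu := pushforward m f.

Let mu0 : mu set0 = 0%E. Proof. exact: measure0. Qed.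

Let mu_ge0 A : (0 <= mu A)%E. Proof. exact: measure_ge0. Qed.

Let mu_sigma_additive : semi_sigma_additive mu.
Proof. exact: measure_semi_sigma_additive. Qed.

HB.instance Definition _ := isMeasure.Build _ _ _ mu mu0 mu_ge0 mu_sigma_additive.

Let mu_sigma_finite : sigma_finite setT mu.
Proof.
have [F TF mF] := sigma_finiteT m.
exists (fun i => g @^-1` F i).
  by rewrite -preimage_bigcup -TF preimage_setT.
move=> i; have [mFi Fioo] := mF i; split.
  by rewrite -[X in measurable X]setTI; exact: mg.
rewrite /mu /pushforward (_ : f @^-1` _ = F i)//.
by apply/seteqP; split => x /=; rewrite fK.
Qed.

HB.instance Definition _ := Measure_isSigmaFinite.Build _ _ _ mu mu_sigma_finite.

(* [g] is only used to transport sigma-finiteness *)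
Definition sf_pushforward : {sigma_finite_measure set T2 -> \bar R} := mu.

End sigma_finite_pushforward.

Section measurable_row.
Context (R : realType) (n : nat).

Definition row_of_tuple (t : n.-tuple (measurableTypeR R)) : 'rV[R]_n := \row_i tnth t i.
Definition tuple_of_row (x : 'rV[R]_n) : n.-tuple (measurableTypeR R) :=
  [tuple x 0 i | i < n].

Lemma row_of_tupleK : cancel row_of_tuple tuple_of_row.
Proof. by move=> t; apply: eq_from_tnth => i; rewrite tnth_mktuple mxE. Qed.

Lemma tuple_of_rowK : cancel tuple_of_row row_of_tuple.
Proof. by move=> x; apply/rowP => i; rewrite mxE tnth_mktuple. Qed.

(* the product (Borel) sigma-algebra, transported along the bijection
   row_of_tuple *)
Definition row_measurable : set (set 'rV[R]_n) :=
  [set A | measurable (row_of_tuple @^-1` A)].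

Let row_measurable0 : row_measurable set0.
Proof. by rewrite /row_measurable /= preimage_set0. Qed.

Let row_measurableC A : row_measurable A -> row_measurable (~` A).
Proof. by rewrite /row_measurable /= preimage_setC; exact: measurableC. Qed.

Let row_measurable_bigcup (F : (set 'rV[R]_n)^nat) :
  (forall i, row_measurable (F i)) -> row_measurable (\bigcup_i F i).
Proof.
by move=> mF; rewrite /row_measurable /= preimage_bigcup; exact: bigcupT_measurable.
Qed.

HB.instance Definition _ :=
  @isMeasurable.Build default_measure_display 'rV[R]_n
    row_measurable row_measurable0 row_measurableC row_measurable_bigcup.

Lemma measurable_row_of_tuple : measurable_fun setT row_of_tuple.
Proof. by move=> _ A mA; rewrite setTI. Qed.

Lemma measurable_tuple_of_row : measurable_fun setT tuple_of_row.
Proof.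
move=> _ A mA; rewrite setTI /measurable /= /row_measurable /=.
by rewrite -comp_preimage (_ : _ \o _ = id)//; apply/funext => t; exact: row_of_tupleK.
Qed.

End measurable_row.

Section sigma_finite_product.
Context d1 d2 (T1 : measurableType d1) (T2 : measurableType d2) (R : realType)
  (m1 : {sigma_finite_measure set T1 -> \bar R})
  (m2 : {sigma_finite_measure set T2 -> \bar R}).

Let mu := product_measure1 m1 m2.

HB.instance Definition _ := Measure.on mu.

Let mu_sigma_finite : sigma_finite setT mu.
Proof.
have /sigma_finiteP[F [TF ndF Foo]] := sigma_finiteT m1.
have /sigma_finiteP[G [TG ndG Goo]] := sigma_finiteT m2.
exists (fun n => F n `*` G n).
  rewrite -setXTT TF TG predeqE => -[x y]; split.
    move=> [/= [n _ Fnx] [k _ Gky]]; exists (maxn n k) => //; split.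
    - by move: x Fnx; exact/subsetPset/ndF/leq_maxl.
    - by move: y Gky; exact/subsetPset/ndG/leq_maxr.
  by move=> [n _ []/= ? ?]; split; exists n.
move=> k; have [? ?] := Foo k; have [? ?] := Goo k.
split; first exact: measurableX.
by rewrite /mu product_measure1E// lte_mul_pinfty// ge0_fin_numE.
Qed.

HB.instance Definition _ := Measure_isSigmaFinite.Build _ _ _ mu mu_sigma_finite.

(* the library's canonical structure of [m1 \x m2] only reaches sigma-finiteness
   when both factors are subprobabilities *)
Definition sf_product : {sigma_finite_measure set (T1 * T2)%type -> \bar R} := mu.

End sigma_finite_product.

Section power_measure.
Context d (T : measurableType d) (R : realType).

Definition cons_pair n (p : T * n.-tuple T) : n.+1.-tuple T :=
  [tuple of p.1 :: p.2].
Definition uncons_pair n (t : n.+1.-tuple T) : T * n.-tuple T :=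
  (tnth t ord0, [tuple of behead t]).

Lemma cons_pairK n : cancel (@cons_pair n) (@uncons_pair n).
Proof. by move=> [x t]; congr (_, _); apply: val_inj. Qed.

Lemma measurable_cons_pair n : measurable_fun setT (@cons_pair n).
Proof. exact: measurable_cons. Qed.

Lemma measurable_uncons_pair n : measurable_fun setT (@uncons_pair n).
Proof.
apply/measurable_fun_pairP; split; first exact: measurable_tnth.
exact: measurable_behead.
Qed.

(* the n-fold product m \x ... \x m *)
Fixpoint power_measure (m : {sigma_finite_measure set T -> \bar R}) n :
    {sigma_finite_measure set (n.-tuple T) -> \bar R} :=
  match n with
  | 0 => [the {sigma_finite_measure set (0.-tuple T) -> \bar R} of dirac [tuple]]
  | n'.+1 => sf_pushforward (@measurable_cons_pair n') (@measurable_uncons_pair n')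
               (@cons_pairK n')
               (sf_product m (power_measure m n'))
  end.

End power_measure.

Definition row_power_measure (R : realType)
    (m : {sigma_finite_measure set (measurableTypeR R) -> \bar R}) n :
    {sigma_finite_measure set 'rV[R]_n -> \bar R} :=
  sf_pushforward (@measurable_row_of_tuple R n) (@measurable_tuple_of_row R n)
    (@row_of_tupleK R n) (power_measure m n).

Section euclidean.
Context (R : realType) (n : nat).
Implicit Types (x y v : 'rV[R]_n) (K P : set 'rV[R]_n).

Definition dotp x y : R := \sum_(i < n) x 0 i * y 0 i.

Definition lebesgue_row : {sigma_finite_measure set 'rV[R]_n -> \bar R} :=
  row_power_measure (@lebesgue_measure R) n.

Definition vol K : \bar R := lebesgue_row K.

Definition barycenter K : 'rV[R]_n :=
  \row_i ((fine (vol K))^-1 * \int[lebesgue_row]_(y in K) y 0 i).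

Definition support_fun K x : R := sup [set dotp y x | y in K].

Definition hull P : set 'rV[R]_n := smallest (@convex_set R 'rV[R]_n) P.

Definition extreme_point P x : Prop :=
  P x /\ forall a b (t : R), P a -> P b -> 0 < t < 1 ->
    x = t *: a + (1 - t) *: b -> a = x /\ b = x.

Definition strictly_convex (f : 'rV[R]_n -> R) : Prop :=
  forall x y (t : R), x != y -> 0 < t < 1 ->
    f (t *: x + (1 - t) *: y) < t * f x + (1 - t) * f y.

Definition is_minimum (A : set R) (a : R) : Prop := A a /\ lbound A a.

Definition of_lattice (m : 'rV[int]_n) : 'rV[R]_n := map_mx intr m.

End euclidean.

Section iterated_partials.
Context (F : numFieldType) (n : nat).

Definition partial (i : 'I_n) (f : 'rV[F]_n -> F) : 'rV[F]_n -> F :=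
  fun x => 'D_(delta_mx 0 i) f x.

Definition iter_partial (s : seq 'I_n) (f : 'rV[F]_n -> F) : 'rV[F]_n -> F :=
  foldr partial f s.

(* for U open: C^infinity on U *)
Definition smooth_on (U : set 'rV[F]_n) (f : 'rV[F]_n -> F) : Prop :=
  forall s x, U x -> differentiable (iter_partial s f) x.

Definition ord_ge (q : 'rV[F]_n) (f : 'rV[F]_n -> F) (j : nat) : Prop :=
  forall s : seq 'I_n, (size s < j)%N -> iter_partial s f q = 0.

End iterated_partials.

Section potential.
Context (R : realType) (n : nat).
Implicit Types (f phi : 'rV[R]_n -> R) (K : set 'rV[R]_n).

Definition gradient f (x : 'rV[R]_n) : 'rV[R]_n := \row_i partial i f x.

Definition hessian f (x : 'rV[R]_n) : 'M[R]_n :=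
  \matrix_(i, j) partial i (partial j f) x.

Definition diffeo_onto (V : set 'rV[R]_n) (G : 'rV[R]_n -> 'rV[R]_n) : Prop :=
  [/\ set_bij setT V G,
      forall i, smooth_on setT (fun x => G x 0 i) &
      exists H : 'rV[R]_n -> 'rV[R]_n, cancel G H /\
        forall i, smooth_on V (fun y => H y 0 i)].

Definition BB13_potential K phi : Prop :=
  [/\ smooth_on setT phi, strictly_convex phi,
      diffeo_onto (interior K) (gradient phi),
      forall x, \det (hessian phi x) = expR (- phi x) &
      exists M : R, forall x, `|phi x - support_fun K x| <= M].

End potential.

Section torus.
Context (R : realType) (n : nat).

Definition cplx : numClosedFieldType := R[i].

Local Notation C := cplx.

Definition modulus (w : C) : R := ComplexField.Normc.normc (w : R[i]).

(* X = (C^* )^n *)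
Definition torus : set 'rV[C]_n := [set z | forall i, z 0 i != 0].

Definition torus_point (x theta : 'rV[R]_n) : 'rV[C]_n :=
  \row_i ((expR (x 0 i / 2) * cos (theta 0 i)) +i*
          (expR (x 0 i / 2) * sin (theta 0 i)))%C.

(* the coordinate x of a point of X *)
Definition log_coord (z : 'rV[C]_n) : 'rV[R]_n :=
  \row_i (2 * ln (modulus (z 0 i))).

Lemma two_pi_gt0 : (0 : R) < 2 * pi.
Proof. by rewrite mulr_gt0// pi_gt0. Qed.

(* Haar probability on (R / 2 pi Z)^n, carried by the fundamental domain
   [0, 2 pi]^n *)
Definition haar : {sigma_finite_measure set 'rV[R]_n -> \bar R} :=
  row_power_measure
    [the {sigma_finite_measure set _ -> \bar R} of uniform_prob two_pi_gt0] n.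

(* d nu = dx d theta, in the coordinates (x, theta) *)
Definition nu : {sigma_finite_measure set ('rV[R]_n * 'rV[R]_n)%type -> \bar R} :=
  sf_product (lebesgue_row R n) haar.

End torus.

Section quantization.
Context (R : realType) (n : nat) (K : set 'rV[R]_n) (phi : 'rV[R]_n -> R).
Implicit Types (k j : nat) (v : 'rV[R]_n).

Local Notation C := (cplx R).
Local Notation fn := ('rV[C]_n -> C).
Local Notation X := (@torus R n).

Definition pull (f : fn) (p : 'rV[R]_n * 'rV[R]_n) : C :=
  f (torus_point p.1 p.2).

Definition weight k (p : 'rV[R]_n * 'rV[R]_n) : R := expR (- (k%:R * phi p.1)).

Definition inner k (f g : fn) : C :=
  let h p : R[i] :=
    ((pull f p : R[i]) * (pull g p : R[i])^* * (weight k p)%:C)%C in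
  ((\int[nu R n]_p complex.Re (h p)) +i* (\int[nu R n]_p complex.Im (h p)))%C.

Definition sqnorm k (f : fn) : \bar R :=
  (\int[nu R n]_p (modulus (pull f p) ^+ 2 * weight k p)%:E)%E.

Definition hnorm k (f : fn) : R := Num.sqrt (fine (sqnorm k f)).

(* functions on X are represented by their extension by zero *)
Definition Hk k : set fn :=
  [set f | [/\ forall z, X z -> differentiable f z,
               forall z, ~ X z -> f z = 0 &
               (sqnorm k f < +oo)%E]].

Definition Sk k : set 'rV[int]_n :=
  [set m | interior [set k%:R *: y | y in K] (of_lattice R m)].

Definition Nk k : nat := (n.+1 * k)%N.

Definition monomial (m : 'rV[int]_n) : fn :=
  fun z => if `[< X z >] then \prod_(i < n) z 0 i ^ m 0 i else 0.

Definition sk k (m : 'rV[int]_n) : fn :=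
  fun z => ((hnorm k (monomial m))^-1%:C)%C * monomial m z.

Definition Fk k (x : 'rV[C]_n) j : set fn := [set f | Hk k f /\ ord_ge x f j].

Definition orth_proj k (V : set fn) (f : fn) : fn :=
  xget (fun=> 0) [set g | V g /\
    forall h, V h -> inner k (fun z => f z - g z) h = 0].

Definition Pk k (x : 'rV[C]_n) j : fn -> fn := orth_proj k (Fk k x j).

Definition op_norm k (T : fn -> fn) : \bar R :=
  ereal_sup [set (hnorm k (T f))%:E | f in [set f | Hk k f /\ hnorm k f <= 1]].

Definition is_basis (V : set fn) r (b : 'I_r -> fn) : Prop :=
  [/\ forall a, V (b a),
      forall c : 'I_r -> C,
        (forall z, \sum_(a < r) c a * b a z = 0) -> forall a, c a = 0 &
      forall f, V f ->
        exists c : 'I_r -> C, forall z, f z = \sum_(a < r) c a * b a z].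

(* The nonzero vectors of the r-th exterior power of V are the nonzero multiples
   of b_1 /\ ... /\ b_r, for b a basis of V, and the coefficient of the latter
   at /\_(m in I) s_(k,m) is, up to sign, the minor with columns I of the matrix
   of coordinates of b in the orthonormal basis s_(k,m); the r-element subset I
   of S_k is given by an injective enumeration e. *)
Definition plucker_exponents k (V : set fn) : set 'rV[R]_n :=
  [set w | exists r (b : 'I_r -> fn) (e : 'I_r -> 'rV[int]_n),
    [/\ is_basis V b, injective e, forall a, Sk k (e a),
        \det (\matrix_(a, a') inner k (b a) (sk k (e a'))) != 0 &
        w = of_lattice R (\sum_(a < r) e a)]].

Definition plucker_polytope k (V : set fn) : set 'rV[R]_n :=
  hull (plucker_exponents k V).

Definition exceptional_set : set 'rV[R]_n :=
  [set v | exists k j (w1 w2 : 'rV[R]_n),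
    let V := Fk k (const_mx 1) j in
    [/\ (0 < k)%N, (1 <= j <= Nk k)%N & exists2 f, V f & f <> (fun=> 0)] /\
    [/\ extreme_point (plucker_polytope k V) w1,
        extreme_point (plucker_polytope k V) w2, w1 != w2 &
        dotp v (w1 - w2) = 0]].

Definition degeneration_point v (r : R) : 'rV[C]_n :=
  \row_i ((expR (- (r * v 0 i)))%:C)%C.

Definition diag_op k (w : 'rV[int]_n -> nat) (f : fn) : fn :=
  fun z => \sum_(m \in Sk k) (w m)%:R * inner k f (sk k m) * sk k m z.

Definition toric_weights v (q : nat -> 'rV[int]_n -> nat) : Prop :=
  forall k, (0 < k)%N ->
    (forall m, Sk k m -> (q k m <= Nk k)%N) /\
    op_norm k (fun f z =>
      \sum_(1 <= j < (Nk k).+1) Pk k (degeneration_point v r) j f z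
      - diag_op k (q k) f z) @[r --> +oo] --> 0%E.

Definition monomial_ray k (w : 'rV[int]_n -> nat) (t : R) (z : 'rV[C]_n) : R :=
  k%:R^-1 * ln (\sum_(m \in Sk k) modulus (sk k m z) ^+ 2 * expR (t * (w m)%:R)).

(* torus-invariant functions on X are identified with functions of x *)
Definition rays_converge (q : nat -> 'rV[int]_n -> nat) (kk : nat -> nat)
    (psi : R -> 'rV[R]_n -> R) : Prop :=
  forall (z0 : 'rV[C]_n) (t0 : R), X z0 -> 0 <= t0 ->
    exists2 U, nbhs (z0, t0) U &
    forall e : R, 0 < e -> \forall i \near \oo,
    forall z t, U (z, t) -> X z -> 0 <= t ->
      `|monomial_ray (kk i) (q (kk i)) t z - psi t (log_coord z)| < e.

Definition toric_limit_ray (q : nat -> 'rV[int]_n -> nat) (kk : nat -> nat)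
    (psi : R -> 'rV[R]_n -> R) : Prop :=
  [/\ rays_converge q kk psi,
      forall x, psi 0 x = phi x,
      forall t x, 0 <= t -> 0 <= psi t x - phi x <= n.+1%:R * t,
      convex_function (E := ('rV[R]_n * R)%type)
        [set xt | 0 <= xt.2] (fun xt => psi xt.2 xt.1) &
      forall t, 0 <= t ->
        (- lne ((fine (vol K))^-1%:E * \int[nu R n]_p (expR (- psi t p.1))%:E) =
         (n%:R * t)%:E)%E].

End quantization.

(* Main.v *)
From HB Require Import structures.
From mathcomp Require Import all_boot all_order all_algebra.
From mathcomp Require Import complex.
From mathcomp Require Import all_classical all_reals all_analysis.
From mathcomp Require Import measurable_realfun.
From mathcomp Require Import ring lra zify.
Require Import Defs.
Set Implicit Arguments.
Unset Strict Implicit.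
Unset Printing Implicit Defensive.
Import Order.TTheory GRing.Theory Num.Theory.
Import numFieldNormedType.Exports.
Local Open Scope classical_set_scope.
Local Open Scope ring_scope.
Section interval_integral.
Context (R : realType).
Implicit Types (f g : R -> R) (a b c x r e : R).

Definition cts_on a b f := forall x, a <= x <= b -> forall e, 0 < e ->
  exists2 d, 0 < d & forall y, a <= y <= b -> `|y - x| < d -> `|f y - f x| <= e.

Definition itg f a b : R := \int[@lebesgue_measure R]_(x in `[a, b]) f x.

Lemma cts_on_within a b f : cts_on a b f -> {within `[a, b], continuous f}.
Proof.
move=> cf; apply/subspace_continuousP => x /=; rewrite in_itv/= => xab.
apply/cvgrPdist_le => e e0; have [d d0 H] := cf _ xab _ e0.
rewrite near_withinE; apply/nbhs_ballP; exists d => // y; rewrite /ball/= => xy.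
by rewrite in_itv/= => yab; rewrite distrC; apply: H => //; rewrite distrC.
Qed.

Lemma cts_on_integrable a b f : cts_on a b f ->
  (@lebesgue_measure R).-integrable `[a, b] (EFin \o f).
Proof.
move=> cf; apply: continuous_compact_integrable; first exact: segment_compact.
exact: cts_on_within.
Qed.

Lemma cts_onS a b a' b' f : a <= a' -> b' <= b -> cts_on a b f -> cts_on a' b' f.
Proof.
move=> aa bb cf x xab e e0.
have [|d d0 H] := cf x _ e e0.
  by move/andP: xab => [? ?]; rewrite (le_trans aa)// (le_trans _ bb).
exists d => // y /andP[? ?]; apply: H.
by rewrite (le_trans aa)// (le_trans _ bb).
Qed.

Lemma cts_onB a b f g : cts_on a b f -> cts_on a b g ->
  cts_on a b (fun x => f x - g x).
Proof.
move=> cf cg x xab e e0.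
have e20 : 0 < e / 2 by rewrite divr_gt0.
have [d d0 Hd] := cf _ xab _ e20; have [d' d'0 Hd'] := cg _ xab _ e20.
exists (Num.min d d'); first by rewrite lt_min d0.
move=> y yab; rewrite lt_min => /andP[yd yd'].
have -> : f y - g y - (f x - g x) = (f y - f x) - (g y - g x) by ring.
by rewrite (le_trans (ler_normB _ _))// (splitr e) lerD ?Hd ?Hd'.
Qed.

Lemma itg_split a c b f : a <= c -> c <= b -> cts_on a b f ->
  itg f a b = itg f a c + itg f c b.
Proof.
move=> ac cb cf; have fi := cts_on_integrable cf.
have := @Rintegral_itvB _ f (BLeft a) (BRight b) c fi.
rewrite !bnd_simp => /(_ ac cb) H.
rewrite /itg -(@Rintegral_itv_obnd_cbnd _ c (BRight b)); last first.
  apply: integrableS fi => // z /=; rewrite !in_itv/= => /andP[cz ->].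
  by rewrite (le_trans ac (ltW cz)).
by rewrite -H; ring.
Qed.

Lemma itgB a b f g : cts_on a b f -> cts_on a b g ->
  itg (fun x => f x - g x) a b = itg f a b - itg g a b.
Proof. by move=> cf cg; rewrite /itg RintegralB//; exact: cts_on_integrable. Qed.

Lemma itg_cst a b r : a <= b -> itg (fun=> r) a b = r * (b - a).
Proof.
move=> ab; rewrite /itg Rintegral_cst//.
congr (_ * _); rewrite -[X in fine X]/(lebesgue_measure `[a, b]%classic) lebesgue_measure_itv/= lte_fin.
by case: ltgtP ab => //= -> _; rewrite subrr.
Qed.

Lemma itg_approx a b f r e : a <= b -> cts_on a b f ->
  (forall x, a <= x <= b -> `|f x - r| <= e) ->
  `|itg f a b - r * (b - a)| <= e * (b - a).
Proof.
move=> ab cf H.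
have cc s : cts_on a b (fun=> s).
  by move=> x _ d d0; exists 1 => // y _ _; rewrite subrr normr0 ltW.
rewrite -itg_cst// -itgB// -[leRHS]itg_cst//.
have ci := cts_on_integrable (cts_onB cf (cc r)).
rewrite (le_trans (le_normr_Rintegral _ ci))//.
apply: le_Rintegral => //.
- have := integrable_abse ci; apply: eq_integrable => //.
- exact: (cts_on_integrable (cc e)).
Qed.

End interval_integral.

Section goursat.
Context (R : realType).
Implicit Types (U V : R -> R -> R) (a b c d : R).

Definition div_free U V a b c d := forall x y, a <= x <= b -> c <= y <= d ->
  exists al be ga : R, forall e, 0 < e -> exists2 dl, 0 < dl &
  forall x' y', a <= x' <= b -> c <= y' <= d ->
    `|x' - x| < dl -> `|y' - y| < dl ->
    `|U x' y' - U x y - (al * (x' - x) + be * (y' - y))|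
      <= e * (`|x' - x| + `|y' - y|) /\
    `|V x' y' - V x y - (ga * (x' - x) + al * (y' - y))|
      <= e * (`|x' - x| + `|y' - y|).

Definition flux U V a b c d :=
  itg (fun y => U b y - U a y) c d - itg (fun x => V x d - V x c) a b.

Lemma div_freeS U V a b c d a' b' c' d' : a <= a' -> b' <= b -> c <= c' ->
  d' <= d -> div_free U V a b c d -> div_free U V a' b' c' d'.
Proof.
move=> aa bb cc dd H.
have ab u : a' <= u <= b' -> a <= u <= b.
  by move=> /andP[? ?]; rewrite (le_trans aa)// (le_trans _ bb).
have cd u : c' <= u <= d' -> c <= u <= d.
  by move=> /andP[? ?]; rewrite (le_trans cc)// (le_trans _ dd).
move=> x y /ab xab /cd ycd; have [al [be [ga G]]] := H x y xab ycd.
exists al, be, ga => e e0; have [dl dl0 K] := G e e0; exists dl => //.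
by move=> x' y' /ab ? /cd ?; exact: K.
Qed.

Lemma lin_cts (al e t : R) : 0 < e -> 0 <= t -> t <= 1 ->
  t < e / (`|al| + 1) -> `|al| * t <= e.
Proof.
move=> e0 t0 t1; rewrite ltr_pdivlMr ?ltr_wpDl// => H.
have : `|al| * t <= t * (`|al| + 1) by rewrite mulrDr mulr1 mulrC ler_wpDr.
by move=> /le_trans; apply; exact: ltW.
Qed.

Lemma div_free_ctsU U V a b c d x : a <= x <= b -> div_free U V a b c d ->
  cts_on c d (U x).
Proof.
move=> xab H y ycd e e0; have [al [be [ga G]]] := H x y xab ycd.
have e20 : 0 < e / 2 by rewrite divr_gt0.
have [dl dl0 K] := G (e / 2) e20.
pose dd := Num.min dl (Num.min 1 (e / 2 / (`|be| + 1))).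
have dd0 : 0 < dd by rewrite !lt_min dl0 ltr01/= divr_gt0// ltr_wpDl.
exists dd => // y' y'cd; rewrite !lt_min => /and3P[ydl y1 y2].
have [|+ _] := K x y' xab y'cd _ ydl; first by rewrite subrr normr0.
rewrite subrr normr0 mulr0 !add0r => K1.
have -> : U x y' - U x y = (U x y' - U x y - be * (y' - y)) + be * (y' - y) by ring.
rewrite (le_trans (ler_normD _ _))// (splitr e) lerD//.
  by rewrite (le_trans K1)// ler_piMr// ltW.
by rewrite normrM lin_cts// ltW.
Qed.

Lemma div_free_ctsV U V a b c d y : c <= y <= d -> div_free U V a b c d ->
  cts_on a b (V^~ y).
Proof.
move=> ycd H x xab e e0; have [al [be [ga G]]] := H x y xab ycd.
have e20 : 0 < e / 2 by rewrite divr_gt0.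
have [dl dl0 K] := G (e / 2) e20.
pose dd := Num.min dl (Num.min 1 (e / 2 / (`|ga| + 1))).
have dd0 : 0 < dd by rewrite !lt_min dl0 ltr01/= divr_gt0// ltr_wpDl.
exists dd => // x' x'cd; rewrite !lt_min => /and3P[xdl x1 x2].
have [|_] := K x' y x'cd ycd xdl; first by rewrite subrr normr0.
rewrite subrr normr0 mulr0 !addr0 => K1.
have -> : V x' y - V x y = (V x' y - V x y - ga * (x' - x)) + ga * (x' - x) by ring.
rewrite (le_trans (ler_normD _ _))// (splitr e) lerD//.
  by rewrite (le_trans K1)// ler_piMr// ltW.
by rewrite normrM lin_cts// ltW.
Qed.

Lemma flux_splitx U V a m b c d : a <= m -> m <= b -> c <= d ->
  div_free U V a b c d ->
  flux U V a b c d = flux U V a m c d + flux U V m b c d.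
Proof.
move=> am mb cd H; have ab := le_trans am mb; rewrite /flux.
have cU x : a <= x <= b -> cts_on c d (U x) by move=> ?; apply: div_free_ctsU H.
have cV y : c <= y <= d -> cts_on a b (V^~ y) by move=> ?; apply: div_free_ctsV H.
rewrite (itg_split am mb); last by apply: cts_onB; apply: cV; rewrite ?lexx ?cd.
have -> : itg (fun y => U b y - U a y) c d =
    itg (fun y => U m y - U a y) c d + itg (fun y => U b y - U m y) c d.
  by rewrite !itgB; [ring|..]; apply: cU; rewrite ?lexx ?ab ?am ?mb.
ring.
Qed.

Lemma flux_splity U V a b c m d : c <= m -> m <= d -> a <= b ->
  div_free U V a b c d ->
  flux U V a b c d = flux U V a b c m + flux U V a b m d.
Proof.
move=> am mb cd H; have ab := le_trans am mb; rewrite /flux.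
have cU x : a <= x <= b -> cts_on c d (U x) by move=> ?; apply: div_free_ctsU H.
have cV y : c <= y <= d -> cts_on a b (V^~ y) by move=> ?; apply: div_free_ctsV H.
rewrite (itg_split am mb); last by apply: cts_onB; apply: cU; rewrite ?lexx ?cd.
have -> : itg (fun y => V y d - V y c) a b =
    itg (fun y => V y m - V y c) a b + itg (fun y => V y d - V y m) a b.
  by rewrite !itgB; [ring|..]; apply: cV; rewrite ?lexx ?ab ?am ?mb.
ring.
Qed.

Lemma flux_local U V a b c d x y (al be ga e : R) : a <= b -> c <= d ->
  a <= x <= b -> c <= y <= d -> 0 <= e -> div_free U V a b c d ->
  (forall x' y', a <= x' <= b -> c <= y' <= d ->
    `|U x' y' - U x y - (al * (x' - x) + be * (y' - y))|
      <= e * (`|x' - x| + `|y' - y|) /\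
    `|V x' y' - V x y - (ga * (x' - x) + al * (y' - y))|
      <= e * (`|x' - x| + `|y' - y|)) ->
  `|flux U V a b c d| <= 4 * e * ((b - a) + (d - c)) ^+ 2.
Proof.
move=> ab cd xab ycd e0 H K.
have cU t : a <= t <= b -> cts_on c d (U t) by move=> ?; apply: div_free_ctsU H.
have cV t : c <= t <= d -> cts_on a b (V^~ t) by move=> ?; apply: div_free_ctsV H.
pose p := (b - a) + (d - c).
have ba0 : 0 <= b - a by rewrite subr_ge0.
have dc0 : 0 <= d - c by rewrite subr_ge0.
have p0 : 0 <= p by rewrite addr_ge0.
have D x' y' : a <= x' <= b -> c <= y' <= d -> e * (`|x' - x| + `|y' - y|) <= e * p.
  move=> /andP[? ?] /andP[? ?]; move: xab ycd => /andP[? ?] /andP[? ?].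
  rewrite ler_wpM2l// lerD// ler_norml; apply/andP; split; lra.
have aab : a <= a <= b by rewrite lexx ab.
have bab : a <= b <= b by rewrite lexx ab.
have ccd : c <= c <= d by rewrite lexx cd.
have dcd : c <= d <= d by rewrite lexx cd.
have E1 : `|itg (fun y => U b y - U a y) c d - al * (b - a) * (d - c)| <= 2 * e * p * (d - c).
  apply: itg_approx => //; first by apply: cts_onB; apply: cU.
  move=> t tcd.
  have [A1 _] := K b t bab tcd; have [A2 _] := K a t aab tcd.
  have -> : U b t - U a t - al * (b - a) =
    (U b t - U x y - (al * (b - x) + be * (t - y)))
    - (U a t - U x y - (al * (a - x) + be * (t - y))) by ring.
  rewrite (le_trans (ler_normB _ _))// -mulrA mulr2n mulrDl mul1r.
  by rewrite lerD// ?(le_trans A1)// ?(le_trans A2)// D.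
have E2 : `|itg (fun t => V t d - V t c) a b - al * (d - c) * (b - a)| <= 2 * e * p * (b - a).
  apply: itg_approx => //; first by apply: cts_onB; apply: cV.
  move=> t tcd.
  have [_ A1] := K t d tcd dcd; have [_ A2] := K t c tcd ccd.
  have -> : V t d - V t c - al * (d - c) =
    (V t d - V x y - (ga * (t - x) + al * (d - y)))
    - (V t c - V x y - (ga * (t - x) + al * (c - y))) by ring.
  rewrite (le_trans (ler_normB _ _))// -mulrA mulr2n mulrDl mul1r.
  by rewrite lerD// ?(le_trans A1)// ?(le_trans A2)// D.
have -> : flux U V a b c d =
  (itg (fun y => U b y - U a y) c d - al * (b - a) * (d - c)) -
  (itg (fun t => V t d - V t c) a b - al * (d - c) * (b - a)).
  by rewrite /flux; ring.
rewrite (le_trans (ler_normB _ _))// (le_trans (lerD E1 E2))//.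
have -> : 2 * e * p * (d - c) + 2 * e * p * (b - a) = 2 * e * p ^+ 2 by rewrite /p; ring.
have : 0 <= e * p ^+ 2 by rewrite mulr_ge0// exprn_ge0.
rewrite -/p; lra.
Qed.

(* one bisection step keeps a quadrant carrying a quarter of the flux *)
Lemma flux_quadrant U V a b c d : a <= b -> c <= d ->
  div_free U V a b c d -> let w := (b - a) / 2 in let h := (d - c) / 2 in
  exists x y, [/\ a <= x, x + w <= b, c <= y, y + h <= d &
    `|flux U V a b c d| <= 4 * `|flux U V x (x + w) y (y + h)|].
Proof.
move=> ab cd H w h.
have [m0 m1] : a <= a + w /\ a + w <= b by rewrite /w; split; lra.
have [n0 n1] : c <= c + h /\ c + h <= d by rewrite /h; split; lra.
have eb : b = (a + w) + w by rewrite /w; field.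
have ed : d = (c + h) + h by rewrite /h; field.
have E : flux U V a b c d =
  (flux U V a (a + w) c (c + h) + flux U V a (a + w) (c + h) d) +
  (flux U V (a + w) b c (c + h) + flux U V (a + w) b (c + h) d).
  rewrite (flux_splitx m0 m1 cd H) (flux_splity n0 n1 m0).
    by rewrite (flux_splity n0 n1 m1)//; apply: div_freeS H.
  by apply: div_freeS H.
move: E; set F := flux U V.
set A := F a _ c (c + h); set B := F a _ (c + h) _; set C := F (a + w) _ c _.
set D := F (a + w) _ _ _ => E.
have [bA|bA] := leP (`|F a b c d|) (4 * `|A|).
  by exists a, c; split => //; rewrite ?lexx.
have [bB|bB] := leP (`|F a b c d|) (4 * `|B|).
  by exists a, (c + h); split => //; rewrite -ed.
have [bC|bC] := leP (`|F a b c d|) (4 * `|C|).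
  by exists (a + w), c; split => //; rewrite -eb.
exists (a + w), (c + h); split; rewrite -?eb -?ed//.
have : `|F a b c d| <= `|A| + `|B| + (`|C| + `|D|).
  by rewrite E (le_trans (ler_normD _ _))// lerD// ler_normD.
rewrite -/D; lra.
Qed.

Theorem flux_eq0 U V a b c d : a <= b -> c <= d -> div_free U V a b c d ->
  itg (fun y => U b y - U a y) c d = itg (fun x => V x d - V x c) a b.
Proof.
move=> ab cd H; apply/eqP; rewrite -subr_eq0 -/(flux _ _ _ _ _ _); apply/eqP.
pose w n := (b - a) / 2 ^+ n; pose h n := (d - c) / 2 ^+ n.
pose F := fun n (p : R * R) => `|flux U V p.1 (p.1 + w n) p.2 (p.2 + h n)|.
pose inside n (p : R * R) := [/\ a <= p.1, p.1 + w n <= b, c <= p.2 & p.2 + h n <= d].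
have w0 n : 0 <= w n by rewrite divr_ge0 ?subr_ge0// exprn_ge0.
have h0 n : 0 <= h n by rewrite divr_ge0 ?subr_ge0// exprn_ge0.
have wS n : w n.+1 = w n / 2 by rewrite /w exprSr invfM mulrA.
have hS n : h n.+1 = h n / 2 by rewrite /h exprSr invfM mulrA.
have step n p : {q : R * R | inside n p -> [/\ inside n.+1 q,
    p.1 <= q.1, q.1 + w n.+1 <= p.1 + w n, p.2 <= q.2 & q.2 + h n.+1 <= p.2 + h n] /\
    F n p <= 4 * F n.+1 q}.
  apply: cid; have [ip|] := pselect (inside n p); last by move=> nip; exists p.
  have [i1 i2 i3 i4] := ip.
  have [||//|x [y [x1 x2 y1 y2 xy]]] := @flux_quadrant U V p.1 (p.1 + w n) p.2 (p.2 + h n).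
  - by rewrite lerDl.
  - by rewrite lerDl.
  - by apply: div_freeS H.
  have ew : p.1 + w n - p.1 = w n by ring.
  have eh : p.2 + h n - p.2 = h n by ring.
  move: x2 y2 xy; rewrite ew eh -wS -hS => x2 y2 xy.
  exists (x, y) => _ /=; split=> //.
  split => //.
  by split => /=; rewrite ?(le_trans i1)// ?(le_trans i3)// ?(le_trans x2)// ?(le_trans y2).
pose p := fix p n := if n is n'.+1 then sval (step n' (p n')) else (a, c).
have ip n : inside n (p n).
  elim: n => [|n IH].
    by split; rewrite /= ?lexx// /w /h expr0 divr1 addrCA subrr addr0.
  by have [[]] := svalP (step n (p n)) IH.
have ps n : [/\ (p n).1 <= (p n.+1).1, (p n.+1).1 + w n.+1 <= (p n).1 + w n,
    (p n).2 <= (p n.+1).2 & (p n.+1).2 + h n.+1 <= (p n).2 + h n].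
  by have [[]] := svalP (step n (p n)) (ip n).
have Fp n : F 0%N (p 0%N) <= 4 ^+ n * F n (p n).
  elim: n => [|n IH]; first by rewrite expr0 mul1r.
  rewrite (le_trans IH)// exprSr -mulrA ler_wpM2l ?exprn_ge0//.
  by have [_] := svalP (step n (p n)) (ip n).
have mon n k : [/\ (p n).1 <= (p (n + k)%N).1, (p (n + k)%N).1 + w (n + k)%N <= (p n).1 + w n,
    (p n).2 <= (p (n + k)%N).2 & (p (n + k)%N).2 + h (n + k)%N <= (p n).2 + h n].
  elim: k => [|k [A B C D]]; first by rewrite addn0; split.
  have [A' B' C' D'] := ps (n + k)%N; rewrite addnS; split.
  - exact: le_trans A'.
  - exact: le_trans B.
  - exact: le_trans C'.
  - exact: le_trans D.
have cross n m : (p n).1 <= (p m).1 + w m /\ (p n).2 <= (p m).2 + h m.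
  have [nm|mn] := leqP n m.
    have [A _ C _] := mon n (m - n)%N; rewrite subnKC// in A C.
    by split; [rewrite (le_trans A)// lerDl|rewrite (le_trans C)// lerDl].
  have [_ B _ D] := mon m (n - m)%N; rewrite subnKC ?(ltnW mn)// in B D.
  by split; [rewrite (le_trans _ B)// lerDl|rewrite (le_trans _ D)// lerDl].
pose x := sup (range (fun n => (p n).1)); pose y := sup (range (fun n => (p n).2)).
have xin n : (p n).1 <= x <= (p n).1 + w n.
  apply/andP; split.
    apply: ub_le_sup; last by exists n.
    by exists ((p 0%N).1 + w 0%N) => _ [m _ <-]; have [] := cross m 0%N.
  apply: ge_sup; first by exists (p 0%N).1; exists 0%N.
  by move=> _ [m _ <-]; have [] := cross m n.
have yin n : (p n).2 <= y <= (p n).2 + h n.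
  apply/andP; split.
    apply: ub_le_sup; last by exists n.
    by exists ((p 0%N).2 + h 0%N) => _ [m _ <-]; have [] := cross m 0%N.
  apply: ge_sup; first by exists (p 0%N).2; exists 0%N.
  by move=> _ [m _ <-]; have [] := cross m n.
have xab : a <= x <= b.
  have /andP[x1 x2] := xin 0%N; have [i1 i2 _ _] := ip 0%N.
  by rewrite (le_trans i1)// (le_trans x2).
have ycd : c <= y <= d.
  have /andP[x1 x2] := yin 0%N; have [_ _ i1 i2] := ip 0%N.
  by rewrite (le_trans i1)// (le_trans x2).
have F0 : `|flux U V a b c d| = F 0%N (p 0%N).
  by rewrite /F/= /w /h expr0 !divr1 [a + _]addrC [c + _]addrC !subrK.
apply/eqP; rewrite -normr_eq0 eq_le normr_ge0 andbT F0.
pose P := (b - a) + (d - c); have P0 : 0 <= P by rewrite addr_ge0// subr_ge0.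
apply/ler_addgt0Pr => e0 e00; rewrite add0r.
pose e := e0 / (4 * (P ^+ 2 + 1)).
have P21 : 0 < P ^+ 2 + 1 by rewrite ltr_wpDl// exprn_ge0.
have e_gt0 : 0 < e by rewrite divr_gt0// mulr_gt0.
have [al [be [ga K]]] := H x y xab ycd.
have [dl dl0 {}K] := K e e_gt0.
have [n Pn] : exists n, P / 2 ^+ n < dl.
  have [n nP] : exists n, P / dl < n%:R.
    by exists (Num.bound (P / dl)); rewrite archi_boundP// divr_ge0// ltW.
  exists n; rewrite ltr_pdivrMr ?exprn_gt0// mulrC -ltr_pdivrMr// (lt_le_trans nP)//.
  by rewrite -natrX ler_nat ltnW// ltn_expl.
have wn : w n <= P / 2 ^+ n by rewrite ler_wpM2r ?invr_ge0 ?exprn_ge0// lerDl subr_ge0.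
have hn : h n <= P / 2 ^+ n by rewrite ler_wpM2r ?invr_ge0 ?exprn_ge0// lerDr subr_ge0.
have [i1 i2 i3 i4] := ip n.
have := @flux_local U V (p n).1 ((p n).1 + w n) (p n).2 ((p n).2 + h n) x y al be ga e.
rewrite !lerDl w0 h0 xin yin ltW// => /(_ erefl erefl erefl erefl erefl).
have HH : div_free U V (p n).1 ((p n).1 + w n) (p n).2 ((p n).2 + h n) by apply: div_freeS H.
move=> /(_ HH) => G.
have {}G : F n (p n) <= 4 * e * (w n + h n) ^+ 2.
  have -> : w n + h n = ((p n).1 + w n - (p n).1) + ((p n).2 + h n - (p n).2) by ring.
  apply: G => x' y' /andP[x'1 x'2] /andP[y'1 y'2].
  have /andP[x1 x2] := xin n; have /andP[y1 y2] := yin n.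
  apply: K.
  - by rewrite (le_trans i1)// (le_trans x'2).
  - by rewrite (le_trans i3)// (le_trans y'2).
  - apply: le_lt_trans Pn; apply: le_trans wn; rewrite ler_norml; apply/andP; split; lra.
  - apply: le_lt_trans Pn; apply: le_trans hn; rewrite ler_norml; apply/andP; split; lra.
rewrite (le_trans (Fp n))//.
have ewh : w n + h n = P / 2 ^+ n by rewrite /w /h -mulrDl.
rewrite ewh in G.
have : 4 ^+ n * F n (p n) <= 4 ^+ n * (4 * e * (P / 2 ^+ n) ^+ 2).
  by rewrite ler_wpM2l// exprn_ge0.
move=> /le_trans; apply.
have -> : 4 ^+ n * (4 * e * (P / 2 ^+ n) ^+ 2) = 4 * e * P ^+ 2 :> R.
  have -> : (4 : R) = 2 ^+ 2 by rewrite expr2; ring.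
  rewrite -exprM mulnC exprM exprMn exprVn; field.
  by rewrite expf_neq0.
rewrite /e.
have -> : 4 * (e0 / (4 * (P ^+ 2 + 1))) * P ^+ 2 = e0 * (P ^+ 2 / (P ^+ 2 + 1)).
  by field; rewrite gt_eqF.
by rewrite ler_piMr ?ltW// ltr_pdivrMr// mul1r ltrDl.
Qed.

End goursat.

Section complex_modulus.
Context (R : realType).
Local Notation C := (cplx R).
Implicit Types (z w : C).

Lemma normCE z : `|z| = ((modulus z)%:C)%C :> C. Proof. by []. Qed.

Lemma modulus_ge0 z : 0 <= modulus z.
Proof. by have := normr_ge0 z; rewrite normCE ler0c. Qed.

Lemma modulus0 : modulus (0 : C) = 0. Proof. exact: ComplexField.Normc.normc0. Qed.

Lemma modulus1 : modulus (1 : C) = 1. Proof. exact: ComplexField.Normc.normc1. Qed.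

Lemma modulus0_eq z : (modulus z == 0) = (z == 0).
Proof.
apply/eqP/eqP => [/ComplexField.Normc.eq0_normc//|->]; exact: modulus0.
Qed.

Lemma modulus_gt0 z : (0 < modulus z) = (z != 0).
Proof. by rewrite lt_neqAle eq_sym modulus0_eq modulus_ge0 andbT. Qed.

Lemma modulusM z w : modulus (z * w) = modulus z * modulus w.
Proof. exact: ComplexField.Normc.normcM. Qed.

Lemma modulusV z : modulus z^-1 = (modulus z)^-1.
Proof. exact: ComplexField.Normc.normcV. Qed.

Lemma modulusX z n : modulus (z ^+ n) = modulus z ^+ n.
Proof. by elim: n => [|n IH]; rewrite ?expr0 ?modulus1// !exprS modulusM IH. Qed.

Lemma modulusD z w : modulus (z + w) <= modulus z + modulus w.
Proof. by rewrite -lecR rmorphD/= -!normCE ler_normD. Qed.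

Lemma modulusN z : modulus (- z) = modulus z.
Proof. by apply: (@complexI R); rewrite -!normCE normrN. Qed.

Lemma modulusB z w : modulus (z - w) <= modulus z + modulus w.
Proof. by rewrite -(modulusN w) modulusD. Qed.

Lemma modulusC (r : R) : modulus (r%:C)%C = `|r|.
Proof. by rewrite /modulus/= expr0n/= addr0 sqrtr_sqr. Qed.

Lemma modulus_sum (I : Type) (r : seq I) (P : pred I) (F : I -> C) :
  modulus (\sum_(i <- r | P i) F i) <= \sum_(i <- r | P i) modulus (F i).
Proof.
elim/big_rec2: _ => [|i y x _ xy]; first by rewrite modulus0.
by rewrite (le_trans (modulusD _ _))// lerD2l.
Qed.

Lemma modulus_prod (I : Type) (r : seq I) (P : pred I) (F : I -> C) :
  modulus (\prod_(i <- r | P i) F i) = \prod_(i <- r | P i) modulus (F i).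
Proof.
by elim/big_rec2: _ => [|i y x _ <-]; [exact: modulus1 | exact: modulusM].
Qed.

Lemma le_Re_modulus z : `|complex.Re z| <= modulus z.
Proof. by rewrite -lecR; exact: normc_ge_Re. Qed.

Lemma le_Im_modulus z : `|complex.Im z| <= modulus z.
Proof.
have := le_Re_modulus (z * ('i)%C); rewrite ReiNIm normrN modulusM.
by rewrite [modulus ('i)%C]/modulus/= expr0n/= add0r expr1n sqrtr1 mulr1.
Qed.

Lemma modulus_le_ReIm z : modulus z <= `|complex.Re z| + `|complex.Im z|.
Proof.
rewrite [z in leLHS]complexE (le_trans (modulusD _ _))// modulusC lerD2l modulusM modulusC.
by rewrite [modulus ('i)%C]/modulus/= expr0n/= add0r expr1n sqrtr1 mul1r.
Qed.

Lemma modulus_sqr z : modulus z ^+ 2 = complex.Re z ^+ 2 + complex.Im z ^+ 2.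
Proof. by case: z => a b; rewrite /modulus/= sqr_sqrtr// addr_ge0// sqr_ge0. Qed.

Definition expi (x y : R) : C := ((expR x * cos y) +i* (expR x * sin y))%C.

Lemma expiD x y x' y' : expi (x + x') (y + y') = expi x y * expi x' y'.
Proof.
by apply/eqP; rewrite eq_complex /= expRD cosD sinD; apply/andP; split; apply/eqP; ring.
Qed.

Lemma expi0 : expi 0 0 = 1.
Proof. by apply/eqP; rewrite eq_complex /= expR0 cos0 sin0 mulr1 mulr0 !eqxx. Qed.

Lemma modulus_expi x y : modulus (expi x y) = expR x.
Proof.
apply/eqP; rewrite -(@eqrXn2 _ 2)// ?modulus_ge0 ?expR_ge0// modulus_sqr/= !exprMn.
by rewrite -mulrDr cos2Dsin2 mulr1.
Qed.

Lemma expi_neq0 x y : expi x y != 0.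
Proof. by rewrite -modulus_gt0 modulus_expi expR_gt0. Qed.

Lemma expi_period x y : expi x (y + 2 * pi) = expi x y.
Proof. by rewrite /expi mulr_natl cosD2pi sinD2pi. Qed.

Lemma polar z : z != 0 -> exists x y, [/\ z = expi x y, 0 <= y & y <= 2 * pi].
Proof.
move=> z0; pose r := modulus z; have r0 : 0 < r by rewrite modulus_gt0.
pose u := complex.Re z / r; pose v := complex.Im z / r.
have uv : u ^+ 2 + v ^+ 2 = 1.
  rewrite /u /v !exprMn -mulrDl -modulus_sqr -/r -exprMn divff ?expr1n// gt_eqF//.
have u1 : -1 <= u <= 1.
  by rewrite -ler_norml /u normrM normfV (gtr0_norm r0) ler_pdivrMr// mul1r le_Re_modulus.
have Ez : z = (expR (ln r) * u +i* (expR (ln r) * v))%C.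
  rewrite lnK ?posrE// /u /v; case: (z) => a b /=.
  by rewrite ![r * _]mulrC !divfK// gt_eqF.
have cu := acosK u1.
have /andP[a0 api] : 0 <= acos u <= pi by rewrite acos_ge0// acos_lepi.
have pi0 := pi_gt0 R.
have [v0|v0] := leP 0 v.
  exists (ln r), (acos u); rewrite a0; split => //; last by lra.
  by rewrite Ez /expi cu sin_acos// -uv [_ ^+ 2 + _]addrC addrK sqrtr_sqr ger0_norm.
exists (ln r), (2 * pi - acos u); split; [|lra|lra].
rewrite Ez /expi addrC mulr_natl cosD2pi sinD2pi cosN sinN cu sin_acos//.
by rewrite -uv [_ ^+ 2 + _]addrC addrK sqrtr_sqr ltr0_norm// opprK.
Qed.

End complex_modulus.

Section derivative_estimates.
Context (R : realType).
Local Notation C := (cplx R).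

Lemma derive_approx (K : numFieldType) (f : K -> K) (x d : K) :
  is_derive x 1 f d -> forall e, 0 < e -> exists2 dl, 0 < dl &
  forall y, `|y - x| < dl -> `|f y - f x - d * (y - x)| <= e * `|y - x|.
Proof.
move=> [df fd] e e0.
have : h^-1 *: (f (h *: 1 + x) - f x) @[h --> 0^'] --> 'D_1 f x.
  by apply: cvg_toP.
rewrite fd => /cvgrPdist_le /(_ _ e0).
rewrite /= near_withinE => /nbhs_ballP[dl dl0 H]; exists dl => // y yx.
have [->|yx0] := eqVneq y x; first by rewrite !subrr mulr0 subrr normr0 mulr0.
have h0 : y - x != 0 by rewrite subr_eq0.
have := H (y - x); rewrite /ball/= sub0r normrN => /(_ yx h0).
have -> : (y - x) *: (1 : K) + x = y by rewrite /GRing.scale/= mulr1 subrK.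
rewrite distrC => G.
have -> : f y - f x - d * (y - x) = ((y - x)^-1 *: (f y - f x) - d) * (y - x).
  by rewrite mulrBl; congr (_ - _); rewrite /GRing.scale/= mulrAC mulVf// mul1r.
by rewrite normrM ler_wpM2r.
Qed.

Lemma cderive_approx (f : C -> C) (x : C) : derivable f x 1 ->
  exists d : C, forall e : R, 0 < e -> exists2 dl : R, 0 < dl &
  forall y, modulus (y - x) < dl ->
    modulus (f y - f x - d * (y - x)) <= e * modulus (y - x).
Proof.
move=> /derivableP df; exists ('D_1 f x) => e e0.
have [|dl dl0 H] := derive_approx df (e := (e%:C)%C); first by rewrite ltcR.
move: dl0; rewrite ltcE/= => /andP[/eqP dli dlr].
exists (complex.Re dl) => // y yx.
have := H y; rewrite !normCE -rmorphM lecR; apply.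
by rewrite ltcE/= -dli eqxx.
Qed.

Lemma ccontP (f : C -> C) (x : C) : {for x, continuous f} <->
  forall e : R, 0 < e -> exists2 dl : R, 0 < dl &
  forall y, modulus (y - x) < dl -> modulus (f y - f x) <= e.
Proof.
split.
  move=> /cvgrPdist_le H e e0.
  have /H : 0 < (e%:C)%C :> C by rewrite ltcR.
  move=> /nbhs_ballP[dl]; rewrite /= ltcE/= => /andP[/eqP dli dlr] G.
  exists (complex.Re dl) => // y yx; rewrite -lecR -normCE distrC; apply: G.
  by rewrite /ball/= distrC normCE ltcE/= -dli eqxx.
move=> H; apply/(@cvgrPdist_le _ _ _ (nbhs x) _ f (f x)) => e; rewrite ltcE/= => /andP[/eqP ei er].
have [dl dl0 G] := H _ er; apply/nbhs_ballP; exists ((dl%:C)%C : C) => /=; first by rewrite ltcR.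
move=> y; rewrite /ball/= distrC normCE ltcR => /G yx.
by rewrite distrC normCE lecE/= -ei eqxx.
Qed.

Lemma expi_approx (e : R) : 0 < e -> exists2 dl, 0 < dl &
  forall h l, `|h| < dl -> `|l| < dl ->
    modulus (expi h l - 1 - (h +i* l)%C) <= e * (`|h| + `|l|).
Proof.
move=> e0; pose e1 := Num.min 1 (e / 10).
have e10 : 0 < e1 by rewrite lt_min ltr01 divr_gt0.
have [d1 d10 H1] := derive_approx (is_derive_expR (0 : R)) e10.
have [d2 d20 H2] := derive_approx (is_derive_cos (0 : R)) e10.
have [d3 d30 H3] := derive_approx (is_derive_sin (0 : R)) e10.
exists (Num.min (e1 / 2) (Num.min d1 (Num.min d2 d3))).
  by rewrite !lt_min d10 d20 d30 divr_gt0.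
move=> h l; rewrite !lt_min => /and4P[h0 h1 h2 h3] /and4P[l0 l1 l2 l3].
have := H1 h; rewrite !subr0 expR0 mul1r => /(_ h1) {}H1.
have := H2 l; rewrite !subr0 sin0 cos0 oppr0 mul0r subr0 => /(_ l2) {}H2.
have := H3 l; rewrite !subr0 sin0 cos0 mul1r subr0 => /(_ l3) {}H3.
have e11 : e1 <= 1 by rewrite ge_min lexx.
have e1e : e1 <= e / 10 by rewrite ge_min lexx orbT.
set u := expR h - 1 - h in H1; set v := cos l - 1 in H2; set w := sin l - l in H3.
have [hn ln] := (normr_ge0 h, normr_ge0 l).
have ue : `|expR h - 1| <= e1.
  have -> : expR h - 1 = u + h by rewrite /u; ring.
  rewrite (le_trans (ler_normD _ _))//.
  have : e1 * `|h| <= `|h| by rewrite ler_piMl.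
  lra.
have eh2 : `|expR h| <= 2.
  have -> : expR h = (expR h - 1) + 1 by ring.
  by rewrite (le_trans (ler_normD _ _))// normr1; lra.
have sl : `|sin l| <= 2 * `|l|.
  have -> : sin l = w + l by rewrite /w; ring.
  rewrite (le_trans (ler_normD _ _))//.
  have : e1 * `|l| <= `|l| by rewrite ler_piMl.
  lra.
rewrite (le_trans (modulus_le_ReIm _))//=.
have -> : expR h * cos l - 1 - h = u + expR h * v by rewrite /u /v; ring.
have -> : expR h * sin l - 0 - l = (expR h - 1) * sin l + w by rewrite /w; ring.
have A1 : `|u + expR h * v| <= e1 * `|h| + 2 * (e1 * `|l|).
  by rewrite (le_trans (ler_normD _ _))// lerD// normrM ler_pM.
have A2 : `|(expR h - 1) * sin l + w| <= e1 * (2 * `|l|) + e1 * `|l|.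
  by rewrite (le_trans (ler_normD _ _))// lerD// normrM ler_pM.
rewrite (le_trans (lerD A1 A2))//.
have B1 : e1 * `|h| <= e / 10 * `|h| by rewrite ler_wpM2r.
have B2 : e1 * `|l| <= e / 10 * `|l| by rewrite ler_wpM2r.
have [C1 C2] : 0 <= e * `|h| /\ 0 <= e * `|l| by rewrite !mulr_ge0// ltW.
lra.
Qed.

(* the composite of a holomorphic function with the exponential *)
Lemma polar_approx (g : C -> C) (p : C) x y : derivable g (p + expi x y) 1 ->
  exists D : C, forall e : R, 0 < e -> exists2 dl, 0 < dl &
  forall x' y', `|x' - x| < dl -> `|y' - y| < dl ->
    modulus (g (p + expi x' y') - g (p + expi x y) - D * ((x' - x) +i* (y' - y))%C)
      <= e * (`|x' - x| + `|y' - y|).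
Proof.
move=> /cderive_approx[d H]; set w := expi x y in H *.
exists (d * w) => e e0.
pose m := expR x; have m0 : 0 < m by exact: expR_gt0.
have dn := modulus_ge0 d.
pose e1 := Num.min 1 (e / 2 / ((modulus d + 1) * m)).
have e10 : 0 < e1 by rewrite lt_min ltr01 !divr_gt0// mulr_gt0// ltr_wpDl.
have [d1 d10 {}H] := H (e / 2 / (m * 2)) ltac:(by rewrite !divr_gt0// mulr_gt0).
have [d2 d20 G] := expi_approx e10.
exists (Num.min d2 (d1 / (m * 4))); first by rewrite lt_min d20 divr_gt0// mulr_gt0.
move=> x' y'; rewrite !lt_min => /andP[h2 h1] /andP[l2 l1].
set h := x' - x in h2 h1 *; set l := y' - y in l2 l1 *.
have {G} := G h l h2 l2; set r := expi h l - 1 - _ => G.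
have Ew : expi x' y' - w = w * ((h +i* l)%C + r).
  have -> : expi x' y' = w * expi h l by rewrite -expiD /h /l addrC subrK addrC subrK.
  by rewrite /r; ring.
have [hn ln] := (normr_ge0 h, normr_ge0 l).
have Mhl : modulus ((h +i* l)%C : C) <= `|h| + `|l| by exact: modulus_le_ReIm.
have Mw : modulus (expi x' y' - w) <= m * 2 * (`|h| + `|l|).
  rewrite Ew modulusM modulus_expi -mulrA ler_wpM2l ?expR_ge0//.
  rewrite (le_trans (modulusD _ _))// mulr2n mulrDl mul1r lerD// (le_trans G)//.
  by rewrite ler_piMl ?addr_ge0// ge_min lexx.
have {}H := H (p + expi x' y').
have Ep : p + expi x' y' - (p + w) = expi x' y' - w by ring.
rewrite Ep in H.
have wd1 : modulus (expi x' y' - w) < d1.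
  rewrite (le_lt_trans Mw)// -ltr_pdivlMl ?mulr_gt0//.
  have -> : (m * 2)^-1 * d1 = d1 / (m * 4) + d1 / (m * 4) by field; rewrite gt_eqF.
  exact: ltrD.
have {H wd1} H := H wd1.
have -> : g (p + expi x' y') - g (p + w) - d * w * (h +i* l)%C =
  (g (p + expi x' y') - g (p + w) - d * (expi x' y' - w)) + d * w * r.
  by rewrite Ew; ring.
rewrite (le_trans (modulusD _ _))// (splitr e) mulrDl lerD//.
  rewrite (le_trans H)//.
  have -> : e / 2 * (`|h| + `|l|) = e / 2 / (m * 2) * (m * 2 * (`|h| + `|l|)).
    by field; rewrite gt_eqF.
  by rewrite ler_wpM2l// !divr_ge0// ?mulr_ge0// ltW.
rewrite !modulusM modulus_expi -/m.
have : modulus d * m * modulus r <= (modulus d + 1) * m * (e1 * (`|h| + `|l|)).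
  rewrite ler_pM// ?mulr_ge0 ?modulus_ge0 ?expR_ge0//.
  by rewrite ler_wpM2r ?expR_ge0// lerDl.
move=> /le_trans; apply.
have dm0 : 0 < (modulus d + 1) * m by rewrite mulr_gt0// ltr_wpDl.
have : (modulus d + 1) * m * e1 <= e / 2.
  by rewrite -ler_pdivlMl// mulrC ge_min lexx orbT.
by rewrite !mulrA => ?; rewrite ler_wpM2r// addr_ge0.
Qed.

End derivative_estimates.

Section locally_constant.
Context (R : realType).
Lemma continuous_locally_constant (c : R -> R) (E : seq R) :
  continuous c ->
  (forall x, x \notin E -> exists2 d, 0 < d & forall y, `|y - x| < d -> c y = c x) ->
  forall x y, c x = c y.
Proof.
move=> cc cE.
have key (s : R) a b : a < b -> s * c a < s * c b -> False.
  move=> ab cab.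
  (* a value strictly between that c does not take on E *)
  have [v [av vb vE]] : exists v, [/\ s * c a < v, v < s * c b &
      forall e, e \in E -> s * c e != v].
    elim: E {cE} => [|e E [v [av vb vE]]].
      by exists ((s * c a + s * c b) / 2); split => //; lra.
    have [ev|ev] := eqVneq (s * c e) v; last first.
      by exists v; split => // e'; rewrite inE => /predU1P[->|/vE].
    have [d [d0 dv dE]] : exists d, [/\ 0 < d, v + d < s * c b &
        forall e', e' \in E -> s * c e' > v -> s * c e' > v + d].
      elim: E {vE} => [|e' E' [d [d0 dv dE]]].
        by exists ((s * c b - v) / 2); split => //; lra.
      have [e'v|e'v] := leP (s * c e') v.
        exists d; split => // e''; rewrite inE => /predU1P[->|/dE//].
        by rewrite ltNge e'v.
      exists (Num.min d ((s * c e' - v) / 2)).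
      have md : Num.min d ((s * c e' - v) / 2) <= d by rewrite ge_min lexx.
      have me : Num.min d ((s * c e' - v) / 2) <= (s * c e' - v) / 2 by rewrite ge_min lexx orbT.
      split; [by rewrite lt_min d0; lra | lra |].
      move=> e''; rewrite inE => /predU1P[->|/dE H] ?; [lra|].
      by have := H ltac:(assumption); lra.
    exists (v + d); split => //; first lra.
    move=> e'; rewrite inE => /predU1P[->|e'E]; first by rewrite ev lt_eqF// ltrDl.
    have [h|h|h] := ltgtP (s * c e') v.
    - by rewrite lt_eqF//; lra.
    - by have := dE _ e'E h => ?; rewrite gt_eqF//; lra.
    - by have := vE _ e'E; rewrite h eqxx.
  pose A := [set x | a <= x <= b /\ s * c x <= v].
  have Aa : A a by split; rewrite ?lexx ltW.
  have hA : has_sup A by split; [exists a|exists b => x [/andP[]]].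
  pose m := sup A.
  have am : a <= m by apply: ub_le_sup => //; case: hA.
  have mb : m <= b by apply: ge_sup => [|x [/andP[]]//]; exists a.
  have csm : forall e, 0 < e -> exists2 d, 0 < d & forall y, `|y - m| < d -> `|s * c y - s * c m| < e.
    move=> e e0; have : continuous_at m (fun x => s * c x).
      by apply: cvgM; [exact: cvg_cst|exact: cc].
    move=> /cvgrPdist_lt /(_ _ e0) /nbhs_ballP[d d0 H]; exists d => // y yd.
    by rewrite distrC; apply: H; rewrite /ball/= distrC.
  have mE : m \notin E.
    apply/negP => /vE; have : s * c m <= v.
      rewrite leNgt; apply/negP => vm.
      have [d d0 H] := csm (s * c m - v) ltac:(by rewrite subr_gt0).
      have [x Ax mx] := sup_adherent d0 hA; have [/andP[ax xb] xv] := Ax.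
      rewrite -/m in mx.
      have xm : x <= m by apply: ub_le_sup => //; case: hA.
      have /H : `|x - m| < d by rewrite ltr_norml; apply/andP; split; lra.
      by rewrite ltr_norml => /andP[? ?]; lra.
    move=> mv /eqP; apply; apply/eqP; rewrite eq_le mv leNgt; apply/negP => {}mv.
    have [d d0 H] := csm (v - s * c m) ltac:(by rewrite subr_gt0).
    have mb' : m < b by rewrite lt_neqAle mb andbT; apply/eqP => mb1; rewrite mb1 in mv; lra.
    pose y := Num.min b (m + d / 2).
    have my : m < y by rewrite lt_min mb'; lra.
    have [yb yd] : y <= b /\ y <= m + d / 2 by split; rewrite ge_min lexx ?orbT.
    have : A y.
      split; first by rewrite yb (le_trans am)// ltW.
      have /H : `|y - m| < d by rewrite ltr_norml; apply/andP; split; lra.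
      by rewrite ltr_norml => /andP[? ?]; lra.
    by move=> /(ub_le_sup _); case: hA => _ hA /(_ hA); rewrite leNgt my.
  have [d d0 H] := cE _ mE.
  have mv : s * c m <= v.
    have [x Ax mx] := sup_adherent d0 hA; have [/andP[ax xb] xv] := Ax.
    have xm : x <= m by apply: ub_le_sup => //; case: hA.
    rewrite -/m in mx.
    have xmd : `|x - m| < d by rewrite ltr_norml; apply/andP; split; lra.
    by rewrite -(H _ xmd).
  have mb' : m < b by rewrite lt_neqAle mb andbT; apply/eqP => mb1; rewrite mb1 in mv; lra.
  pose y := Num.min b (m + d / 2).
  have my : m < y by rewrite lt_min mb'; lra.
  have [yb yd] : y <= b /\ y <= m + d / 2 by split; rewrite ge_min lexx ?orbT.
  have : A y.
    split; first by rewrite yb (le_trans am)// ltW.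
    have ymd : `|y - m| < d by rewrite ltr_norml; apply/andP; split; lra.
    by rewrite (H _ ymd).
  by move=> /(ub_le_sup _); case: hA => _ hA /(_ hA); rewrite leNgt my.
have eqc a b : a < b -> c a = c b.
  move=> ab; have k1 := key 1 a b ab; have k2 := key (-1) a b ab.
  rewrite !mul1r in k1; rewrite !mulN1r ltrN2 in k2.
  by case: (ltgtP (c a) (c b)).
move=> x y; case: (ltgtP x y) => [/eqc//|/eqc//|->//].
Qed.

End locally_constant.

Section circle_means.
Context (R : realType).
Local Notation C := (cplx R).
Implicit Types (g : C -> C) (p z : C).

Definition cmean_def g p (x : R) : C :=
  (itg (fun y => complex.Re (g (p + expi x y))) 0 (2 * pi) +i*
   itg (fun y => complex.Im (g (p + expi x y))) 0 (2 * pi))%C.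
Definition cmean := locked cmean_def.

Lemma cmeanE g p x : cmean g p x =
  (itg (fun y => complex.Re (g (p + expi x y))) 0 (2 * pi) +i*
   itg (fun y => complex.Im (g (p + expi x y))) 0 (2 * pi))%C.
Proof. by rewrite /cmean -lock. Qed.

Lemma pi2_gt0 : (0 : R) < 2 * pi.
Proof. by rewrite mulr_gt0// pi_gt0. Qed.

Lemma expi_continuous (x y e : R) : 0 < e -> exists2 d, 0 < d & forall x' y',
  `|x' - x| < d -> `|y' - y| < d -> modulus (expi x' y' - expi x y) < e.
Proof.
move=> e0; have [|D H] := @polar_approx R id 0 x y; first exact: derivable_id.
have [d d0 {}H] := H 1 ltr01.
have D0 : 0 < modulus D + 2 by rewrite ltr_wpDl// modulus_ge0.
exists (Num.min d (e / 4 / (modulus D + 2))); first by rewrite lt_min d0 !divr_gt0.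
move=> x' y'; rewrite !lt_min => /andP[x1 x2] /andP[y1 y2].
have {H} := H _ _ x1 y1; rewrite !add0r mul1r => H.
rewrite -(subrK (D * ((x' - x) +i* (y' - y))%C) (_ - _)) (le_lt_trans (modulusD _ _))//.
have M : modulus ((x' - x) +i* (y' - y) : C)%C <= `|x' - x| + `|y' - y| by exact: modulus_le_ReIm.
have : modulus (D * ((x' - x) +i* (y' - y))%C) <= modulus D * (`|x' - x| + `|y' - y|).
  by rewrite modulusM ler_wpM2l// modulus_ge0.
move=> /(lerD H) /le_lt_trans; apply.
set s := `|x' - x| + `|y' - y|.
have s1 : s < 2 * (e / 4 / (modulus D + 2)) by rewrite mulr2n mulrDl mul1r ltrD.
have s2 : s * (modulus D + 2) < e / 2.
  rewrite -ltr_pdivlMr// (lt_le_trans s1)//.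
  by rewrite le_eqVlt; apply/orP; left; apply/eqP; field; rewrite gt_eqF.
have s0 : 0 <= s by rewrite addr_ge0.
by rewrite mulrDr in s2; rewrite mulrC; lra.
Qed.

Lemma circle_cts g p x : (forall y, {for p + expi x y, continuous g}) ->
  forall y e, 0 < e -> exists2 d, 0 < d &
    forall y', `|y' - y| < d -> modulus (g (p + expi x y') - g (p + expi x y)) <= e.
Proof.
move=> H y e e0; have /ccontP/(_ _ e0)[d d0 G] := H y.
have [d' d'0 K] := expi_continuous x y d0; exists d' => // y' yy'.
apply: G; have -> : p + expi x y' - (p + expi x y) = expi x y' - expi x y by ring.
by apply: K => //; rewrite subrr normr0.
Qed.

Lemma circle_ctsRe g p x a b : (forall y, {for p + expi x y, continuous g}) ->
  cts_on a b (fun y => complex.Re (g (p + expi x y))).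
Proof.
move=> H y _ e e0; have [d d0 G] := circle_cts H y e0; exists d => // y' _ /G.
by apply: le_trans; rewrite -raddfB le_Re_modulus.
Qed.

Lemma circle_ctsIm g p x a b : (forall y, {for p + expi x y, continuous g}) ->
  cts_on a b (fun y => complex.Im (g (p + expi x y))).
Proof.
move=> H y _ e e0; have [d d0 G] := circle_cts H y e0; exists d => // y' _ /G.
by apply: le_trans; rewrite -raddfB le_Im_modulus.
Qed.

Lemma cmean_approx g p x (c : C) e : (forall y, {for p + expi x y, continuous g}) ->
  (forall y, 0 <= y <= 2 * pi -> modulus (g (p + expi x y) - c) <= e) ->
  modulus (cmean g p x - ((2 * pi)%:C)%C * c) <= 4 * pi * e.
Proof.
move=> H G; rewrite cmeanE (le_trans (modulus_le_ReIm _))//.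
have -> : 4 * pi * e = e * (2 * pi - 0) + e * (2 * pi - 0) by ring.
have p0 : (0 : R) <= 2 * pi by rewrite ltW// pi2_gt0.
rewrite lerD//.
  have -> : complex.Re ((itg (fun y => complex.Re (g (p + expi x y))) 0 (2 * pi) +i*
   itg (fun y => complex.Im (g (p + expi x y))) 0 (2 * pi))%C - ((2 * pi)%:C)%C * c) =
    itg (fun y => complex.Re (g (p + expi x y))) 0 (2 * pi) - complex.Re c * (2 * pi - 0).
    by case: (c) => u v /=; ring.
  apply: itg_approx => //; first exact: circle_ctsRe.
  by move=> y /G; apply: le_trans; rewrite -raddfB le_Re_modulus.
have -> : complex.Im ((itg (fun y => complex.Re (g (p + expi x y))) 0 (2 * pi) +i*
   itg (fun y => complex.Im (g (p + expi x y))) 0 (2 * pi))%C - ((2 * pi)%:C)%C * c) =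
  itg (fun y => complex.Im (g (p + expi x y))) 0 (2 * pi) - complex.Im c * (2 * pi - 0).
  by case: (c) => u v /=; ring.
apply: itg_approx => //; first exact: circle_ctsIm.
by move=> y /G; apply: le_trans; rewrite -raddfB le_Im_modulus.
Qed.

Lemma derivable_ccont g z : derivable g z 1 -> {for z, continuous g}.
Proof.
move=> /cderive_approx[d H]; apply/ccontP => e e0.
have [dl dl0 G] := H 1 ltr01.
have d0 : 0 < modulus d + 1 by rewrite ltr_wpDl// modulus_ge0.
exists (Num.min dl (e / (modulus d + 1))); first by rewrite lt_min dl0 divr_gt0.
move=> y; rewrite lt_min => /andP[/G {}G]; rewrite ltr_pdivlMr// => ye.
rewrite -(subrK (d * (y - z)) (_ - _)) (le_trans (modulusD _ _))//.
by rewrite (le_trans (lerD G (lexx _)))// modulusM -mulrDl addrC mulrC ltW.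
Qed.

Lemma cmean_const g p a b : a <= b ->
  (forall x y, a <= x <= b -> derivable g (p + expi x y) 1) ->
  cmean g p a = cmean g p b.
Proof.
move=> ab H.
have cg x y : a <= x <= b -> {for p + expi x y, continuous g}.
  by move=> xab; apply: derivable_ccont; exact: H.
have p0 : (0 : R) <= 2 * pi by rewrite ltW// pi2_gt0.
pose U x y := complex.Re (g (p + expi x y)).
pose V x y := complex.Im (g (p + expi x y)).
have aab : a <= a <= b by rewrite lexx.
have bab : a <= b <= b by rewrite lexx andbT.
have per x : expi x (2 * pi) = expi x 0 by rewrite -[2 * pi]add0r expi_period.
have D1 : div_free U V a b 0 (2 * pi).
  move=> x y xab _; have [[al be] K] := polar_approx (H x y xab).
  exists al, (- be), be => e e0; have [d d0 {}K] := K e e0.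
  exists d => // x' y' _ _ xx' yy'; have {}K := K x' y' xx' yy'.
  split; apply: le_trans K.
    apply: le_trans (le_Re_modulus _); rewrite !raddfB/= /U.
    by rewrite le_eqVlt; apply/orP; left; apply/eqP; congr (`|_|); ring.
  apply: le_trans (le_Im_modulus _); rewrite !raddfB/= /V.
  by rewrite le_eqVlt; apply/orP; left; apply/eqP; congr (`|_|); ring.
have D2 : div_free V (fun x y => - U x y) a b 0 (2 * pi).
  move=> x y xab _; have [[al be] K] := polar_approx (H x y xab).
  exists be, al, (- al) => e e0; have [d d0 {}K] := K e e0.
  exists d => // x' y' _ _ xx' yy'; have {}K := K x' y' xx' yy'.
  split; apply: le_trans K.
    apply: le_trans (le_Im_modulus _); rewrite !raddfB/= /V.
    by rewrite le_eqVlt; apply/orP; left; apply/eqP; congr (`|_|); ring.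
  apply: le_trans (le_Re_modulus _); rewrite !raddfB/= /U -normrN.
  by rewrite le_eqVlt; apply/orP; left; apply/eqP; congr (`|_|); ring.
have E1 := flux_eq0 ab p0 D1.
have E2 := flux_eq0 ab p0 D2.
rewrite itgB in E1; [|by apply: circle_ctsRe => y; exact: cg..].
rewrite itgB in E2; [|by apply: circle_ctsIm => y; exact: cg..].
have Z1 : itg (fun x => V x (2 * pi) - V x 0) a b = 0.
  rewrite (_ : (fun x => _) = fun=> 0) ?itg_cst ?mul0r//.
  by apply/funext => x; rewrite /V per subrr.
have Z2 : itg (fun x => - U x (2 * pi) - - U x 0) a b = 0.
  rewrite (_ : (fun x => _) = fun=> 0) ?itg_cst ?mul0r//.
  by apply/funext => x; rewrite /U per subrr.
rewrite Z1 in E1; rewrite Z2 in E2.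
rewrite !cmeanE; move/subr0_eq: E1 => E1; move/subr0_eq: E2 => E2.
by rewrite /U /V in E1 E2; rewrite E1 E2.
Qed.

Lemma cmean_continuous g p x e : (forall z, z != p -> {for z, continuous g}) ->
  0 < e -> exists2 d, 0 < d & forall x', `|x' - x| < d ->
    modulus (cmean g p x' - cmean g p x) <= e.
Proof.
move=> cg e0.
have cg' x' y : {for p + expi x' y, continuous g}.
  by apply: cg; rewrite -subr_eq0 addrC addKr expi_neq0.
have pp := pi2_gt0; have p0 := ltW pp.
pose e1 := e / (4 * pi).
have e10 : 0 < e1 by rewrite divr_gt0//; have := pi_gt0 R; lra.
have /compact_near_coveringP cov := @segment_compact R 0 (2 * pi).
pose P (x' y : R) := modulus (g (p + expi x' y) - g (p + expi x y)) <= e1.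
have : \forall x' \near x, `[0, 2 * pi]%classic `<=` P x'.
  apply: (cov _ (nbhs x) P _) => y _; have e20 : 0 < e1 / 2 by rewrite divr_gt0.
  have /ccontP/(_ _ e20)[d d0 H] := cg' x y.
  have [d' d'0 G] := expi_continuous x y d0.
  exists (ball y d', ball x d') => /=; first by split; apply: nbhsx_ballx.
  move=> [y' x'] [/= yy' xx']; rewrite /P.
  have -> : g (p + expi x' y') - g (p + expi x y') =
    (g (p + expi x' y') - g (p + expi x y)) - (g (p + expi x y') - g (p + expi x y)) by ring.
  rewrite (le_trans (modulusB _ _))// (splitr e1) lerD//; apply: H.
    have -> : p + expi x' y' - (p + expi x y) = expi x' y' - expi x y by ring.
    by apply: G; rewrite distrC.
  have -> : p + expi x y' - (p + expi x y) = expi x y' - expi x y by ring.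
  by apply: G; rewrite ?subrr ?normr0// distrC.
move=> /nbhs_ballP[d d0 H]; exists d => // x' xx'.
have {}H y : 0 <= y <= 2 * pi -> P x' y.
  by move=> yp; apply: (H x'); rewrite ?/ball/= 1?distrC// in_itv.
rewrite !cmeanE (le_trans (modulus_le_ReIm _))// !raddfB/= -!itgB; try exact: circle_ctsRe; try exact: circle_ctsIm.
have -> : e = e1 * (2 * pi - 0) + e1 * (2 * pi - 0).
  have pi0 : pi != 0 :> R by rewrite gt_eqF ?pi_gt0.
  have -> : e = e1 * (4 * pi) by rewrite divfK// mulf_neq0.
  by ring.
rewrite lerD//.
  rewrite -[X in `|X|]subr0 -[X in _ - X](mul0r (2 * pi - 0)).
  apply: itg_approx => //; first by apply: cts_onB; exact: circle_ctsRe.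
  by move=> y /H; apply: le_trans; rewrite subr0 -raddfB le_Re_modulus.
rewrite -[X in `|X|]subr0 -[X in _ - X](mul0r (2 * pi - 0)).
apply: itg_approx => //; first by apply: cts_onB; exact: circle_ctsIm.
by move=> y /H; apply: le_trans; rewrite subr0 -raddfB le_Im_modulus.
Qed.

End circle_means.

Section liouville.
Context (R : realType).
Local Notation C := (cplx R).
Implicit Types (g : C -> C) (p z : C).

(* the mean over circles about p does not depend on the radius *)
Lemma cmean_eq g p (E : seq C) : (forall z, z != p -> {for z, continuous g}) ->
  (forall z, z != p -> z \notin E -> derivable g z 1) ->
  forall x x', cmean g p x = cmean g p x'.
Proof.
move=> cg dg.
pose F := [seq ln (modulus (z - p)) | z <- E].
have loc x : x \notin F -> exists2 d, 0 < d & forall y, `|y - x| < d -> cmean g p y = cmean g p x.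
  move=> xF.
  have [d d0 H] : exists2 d, 0 < d & forall f, f \in F -> d <= `|f - x|.
    elim: F xF => [|f F IH]; first by exists 1.
    rewrite inE negb_or => /andP[xf /IH[d d0 H]].
    exists (Num.min d `|f - x|); first by rewrite lt_min d0 normr_gt0 subr_eq0 eq_sym.
    move=> f'; rewrite inE => /predU1P[->|/H]; first by rewrite ge_min lexx orbT.
    by move=> ?; rewrite ge_min; apply/orP; left.
  exists d => // y xy.
  have D u t : `|u - x| < d -> derivable g (p + expi u t) 1.
    move=> ux; apply: dg; first by rewrite -subr_eq0 addrC addKr expi_neq0.
    apply/negP => /(map_f (fun z => ln (modulus (z - p)))) /H.
    have -> : p + expi u t - p = expi u t by ring.
    by rewrite modulus_expi expRK leNgt ux.
  have [xy'|yx'] := leP x y.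
    apply/esym; apply: cmean_const => // u t /andP[xu uy]; apply: D.
    by move: xy; rewrite !ltr_norml => /andP[? ?]; apply/andP; split; lra.
  apply: cmean_const => [|u t /andP[xu uy]]; first exact: ltW.
  by apply: D; move: xy; rewrite !ltr_norml => /andP[? ?]; apply/andP; split; lra.
have cR : continuous (fun x => complex.Re (cmean g p x)).
  move=> x; apply/(@cvgrPdist_le _ R^o) => e e0.
  have [d d0 H] := cmean_continuous x cg e0; apply/nbhs_ballP; exists d => // y /=.
  rewrite /ball/= distrC => /H /(le_trans (le_Re_modulus _)).
  by rewrite raddfB distrC.
have cI : continuous (fun x => complex.Im (cmean g p x)).
  move=> x; apply/(@cvgrPdist_le _ R^o) => e e0.
  have [d d0 H] := cmean_continuous x cg e0; apply/nbhs_ballP; exists d => // y /=.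
  rewrite /ball/= distrC => /H /(le_trans (le_Im_modulus _)).
  by rewrite raddfB distrC.
move=> x x'; apply/eqP; rewrite eq_complex; apply/andP; split; apply/eqP.
  apply: (continuous_locally_constant cR (E := F)) => u /loc[d d0 H].
  by exists d => // y /H ->.
apply: (continuous_locally_constant cI (E := F)) => u /loc[d d0 H].
by exists d => // y /H ->.
Qed.

(* Liouville's theorem for functions vanishing at infinity *)
Lemma liouville g (E : seq C) : continuous g ->
  (forall z, z \notin E -> derivable g z 1) ->
  (forall e, 0 < e -> exists r, forall z, r < modulus z -> modulus (g z) <= e) ->
  forall z, g z = 0.
Proof.
move=> cg dg g0 p.
have M := @cmean_eq g p E (fun z _ => cg z) (fun z _ => dg z).
have pp : (0 : R) < pi by exact: pi_gt0.
apply/eqP; rewrite -modulus0_eq eq_le modulus_ge0 andbT.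
apply/ler_addgt0Pr => e e0; rewrite add0r.
have e40 : 0 < e / 4 by rewrite divr_gt0.
have [r H] := g0 _ e40.
have /ccontP/(_ _ e40)[d d0 G] := cg p.
pose x1 := ln (modulus p + Num.max r 0 + 1).
have r1 : 0 < modulus p + Num.max r 0 + 1.
  by rewrite ltr_wpDl// addr_ge0 ?modulus_ge0// le_max lexx orbT.
have A1 : modulus (cmean g p x1 - ((2 * pi)%:C)%C * 0) <= 4 * pi * (e / 4).
  apply: cmean_approx => [y|y _]; first exact: cg.
  rewrite subr0; apply: H.
  have := modulusB (p + expi x1 y) p.
  have -> : p + expi x1 y - p = expi x1 y by ring.
  rewrite modulus_expi lnK ?posrE// => K.
  have : r <= Num.max r 0 by rewrite le_max lexx.
  lra.
pose x2 := ln (d / 2).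
have A2 : modulus (cmean g p x2 - ((2 * pi)%:C)%C * g p) <= 4 * pi * (e / 4).
  apply: cmean_approx => [y|y _]; first exact: cg.
  apply: G; have -> : p + expi x2 y - p = expi x2 y by ring.
  by rewrite modulus_expi lnK ?posrE ?divr_gt0//; lra.
rewrite (M x1 x2) mulr0 subr0 in A1.
have : modulus (((2 * pi)%:C)%C * g p) <= 2 * pi * e.
  have -> : ((2 * pi)%:C)%C * g p = cmean g p x2 - (cmean g p x2 - ((2 * pi)%:C)%C * g p) by ring.
  by rewrite (le_trans (modulusB _ _))// (le_trans (lerD A1 A2))//; lra.
by rewrite modulusM modulusC gtr0_norm ?ler_pM2l// mulr_gt0.
Qed.

End liouville.

Section divided_difference.
Context (K : numFieldType).
Implicit Types (g h : K -> K) (a z : K).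

Definition divdiff g a : K -> K :=
  fun z => if z == a then 'D_1 g a else (g z - g a) / (z - a).

Lemma divdiffE g a z : g z = g a + (z - a) * divdiff g a z.
Proof.
rewrite /divdiff; have [->|za] := eqVneq z a; first by rewrite subrr mul0r addr0.
by rewrite mulrC divfK ?subr_eq0// addrC subrK.
Qed.

Lemma near_neq a z : z != a -> \forall w \near z, w != a.
Proof.
move=> za; pose P w := w - a != 0.
have : \forall w \near z, P w.
  apply: (@cvgr_neq0 _ _ _ (nbhs z) _ (fun w => w - a) (z - a)); last by rewrite subr_eq0.
  by apply: cvgB; [exact: cvg_id|exact: cvg_cst].
by apply: filterS => w; rewrite /P subr_eq0.
Qed.

Lemma divdiff_near g a z : z != a -> \forall w \near z,
  divdiff g a w = (g w - g a) / (w - a).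
Proof.
by move=> /near_neq; apply: filterS => w /negPf wa; rewrite /divdiff wa.
Qed.

Lemma continuous_divdiff_neq g a z : z != a -> {for z, continuous g} ->
  {for z, continuous (divdiff g a)}.
Proof.
move=> za cg; rewrite /prop_for /continuous_at {2}/divdiff (negPf za).
have E : {near z, (fun w => (g w - g a) / (w - a)) =1 divdiff g a}.
  by near=> w; apply/esym; near: w; exact: divdiff_near.
apply: (cvg_trans (near_eq_cvg E)).
have A : (fun w => g w - g a) @ z --> g z - g a.
  by apply: (@cvgB _ _ _ (nbhs z) _ g (cst (g a)) (g z) (g a) cg); exact: cvg_cst.
have B : (fun w => w - a) @ z --> z - a.
  by apply: (@cvgB _ _ _ (nbhs z) _ id (cst a) z a); [exact: cvg_id|exact: cvg_cst].
have B' : (fun w => (w - a)^-1) @ z --> (z - a)^-1.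
  by apply: (@cvgV _ _ (nbhs z) _ _ _ _ B); rewrite subr_eq0.
exact: (@cvgM _ _ (nbhs z) _ _ _ _ _ A B').
Unshelve. all: by end_near. Qed.

Lemma derivable_divdiff_neq g a z : z != a -> derivable g z 1 ->
  derivable (divdiff g a) z 1.
Proof.
move=> za dg.
apply: (@near_eq_derivable _ _ _ (fun w => (g w - g a) * (w - a)^-1)).
  by near=> w; apply/esym; near: w; exact: divdiff_near.
apply: derivableM; first by apply: derivableB => //; exact: derivable_cst.
apply: derivableV; first by rewrite subr_eq0.
by apply: derivableB; [exact: derivable_id|exact: derivable_cst].
Unshelve. all: by end_near. Qed.

Lemma derivable_mulX g z n : derivable g z 1 ->
  derivable ((fun w => w ^+ n * g w) : K -> K) z 1.
Proof.
move=> dg; have dX : derivable (fun w : K => w ^+ n) z 1.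
  elim: n => [|n IH].
    rewrite (_ : (fun w => _) = cst 1); first exact: derivable_cst.
    by apply/funext => w; rewrite expr0.
  have := derivableM (@derivable_id _ _ z 1) IH.
  by congr (derivable _ z 1); apply/funext => w; rewrite exprS.
have := derivableM dX dg.
by congr (derivable _ z 1); apply/funext.
Qed.

Lemma near_derivable g h z : (\forall w \near z, h w = g w) ->
  derivable g z 1 -> derivable h z 1.
Proof.
move=> gh; apply: near_eq_derivable; near=> w; apply/esym; near: w; exact: gh.
Unshelve. all: by end_near. Qed.

End divided_difference.

Section laurent1.
Context (R : realType).
Local Notation C := (cplx R).
Implicit Types (g h : C -> C) (a z : C).

Lemma continuous_divdiff g a : derivable g a 1 -> {for a, continuous (divdiff g a)}.
Proof.
move=> dg; apply/ccontP => e e0.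
have := derive_approx (derivableP dg) (e := (e%:C)%C).
rewrite ltcR => /(_ e0)[dl]; rewrite ltcE/= => /andP[/eqP dli dlr] H.
exists (complex.Re dl) => // y ya.
have [->|yna] := eqVneq y a; first by rewrite subrr modulus0 ltW.
have := H y; rewrite !normCE -rmorphM lecR ltcE/= -dli eqxx => /(_ ya) K.
rewrite /divdiff eqxx (negPf yna).
have ya0 : y - a != 0 by rewrite subr_eq0.
have -> : (g y - g a) / (y - a) - 'D_1 g a = (g y - g a - 'D_1 g a * (y - a)) / (y - a).
  by rewrite [RHS]mulrBl mulfK.
by rewrite modulusM modulusV ler_pdivrMr// modulus_gt0.
Qed.

Lemma fresh_point (E : seq C) : exists a : C, a \notin E.
Proof.
exists ((\sum_(z <- E) modulus z + 1)%:C)%C.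
apply/negP => aE.
have : modulus ((\sum_(z <- E) modulus z + 1)%:C)%C <= \sum_(z <- E) modulus z.
  rewrite [leRHS](big_rem _ aE)/= lerDl; apply: sumr_ge0 => i _; exact: modulus_ge0.
rewrite modulusC ger0_norm; first by rewrite gerDl ler10.
by rewrite addr_ge0// sumr_ge0// => i _; exact: modulus_ge0.
Qed.

Lemma divdiff_growth h a A m : derivable h a 1 ->
  (forall z, modulus (h z) <= A * (1 + modulus z) ^+ m) ->
  exists B, forall z, modulus (divdiff h a z) * (1 + modulus z) <= B * (1 + modulus z) ^+ m.
Proof.
move=> dh hA.
have /ccontP/(_ _ ltr01)[d d0 H] := continuous_divdiff dh.
have A0 : 0 <= A.
  by have := hA 0; rewrite modulus0 addr0 expr1n mulr1; apply: le_trans; exact: modulus_ge0.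
pose c := modulus (divdiff h a a) + 1.
have c0 : 0 <= c by rewrite addr_ge0// modulus_ge0.
pose K := 1 + (1 + modulus a) / d.
have ma0 := modulus_ge0 a.
have K0 : 0 <= K by rewrite addr_ge0// divr_ge0// ?addr_ge0// ltW.
exists (c * (1 + modulus a + d) + (A + modulus (h a)) * K) => z.
have mz0 := modulus_ge0 z.
have e1 : 1 <= (1 + modulus z) ^+ m by apply: exprn_ege1; rewrite lerDl.
have e0 := le_trans ler01 e1.
have ha0 := modulus_ge0 (h a).
have triz : modulus z <= modulus a + modulus (z - a).
  by rewrite -{1}(subrK a z) addrC modulusD.
have [zd|zd] := ltP (modulus (z - a)) d.
  have := H z zd => {}H.
  have Hc : modulus (divdiff h a z) <= c.
    rewrite -(subrK (divdiff h a a) (divdiff h a z)) (le_trans (modulusD _ _))//.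
    by rewrite /c addrC lerD2l.
  rewrite (@le_trans _ _ (c * (1 + modulus a + d)))//.
    apply: ler_pM => //; [exact: modulus_ge0|by rewrite addr_ge0|lra].
  rewrite (@le_trans _ _ ((c * (1 + modulus a + d)) * (1 + modulus z) ^+ m))//.
    by rewrite ler_peMr// mulr_ge0// !addr_ge0// ltW.
  by rewrite ler_wpM2r// lerDl mulr_ge0// addr_ge0.
have za : z != a.
  by apply/eqP => E; move: zd; rewrite E subrr modulus0 leNgt d0.
have zap : 0 < modulus (z - a) by rewrite modulus_gt0 subr_eq0.
rewrite /divdiff (negPf za) modulusM modulusV.
have R1 : (1 + modulus z) / modulus (z - a) <= K.
  rewrite ler_pdivrMr// /K mulrDl mul1r.
  have : (1 + modulus a) <= (1 + modulus a) / d * modulus (z - a).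
    by rewrite mulrAC ler_pdivlMr// ler_wpM2l// addr_ge0.
  lra.
have R2 : modulus (h z - h a) <= (A + modulus (h a)) * (1 + modulus z) ^+ m.
  rewrite (le_trans (modulusB _ _))// mulrDl lerD ?hA//.
  by rewrite ler_peMr.
rewrite -mulrA [_^-1 * _]mulrC.
rewrite (@le_trans _ _ ((A + modulus (h a)) * (1 + modulus z) ^+ m * K))//.
  by apply: ler_pM => //; [exact: modulus_ge0|rewrite divr_ge0// ?addr_ge0// ltW].
by rewrite mulrAC ler_wpM2r// lerDr mulr_ge0// !addr_ge0// ltW.
Qed.

Lemma divdiff_regular h (E : seq C) a : continuous h ->
  (forall z, z \notin E -> derivable h z 1) -> a \notin E ->
  continuous (divdiff h a) /\
  forall z, z \notin a :: E -> derivable (divdiff h a) z 1.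
Proof.
move=> ch dh aE; split=> [z|z].
  have [->|za] := eqVneq z a; first by apply: continuous_divdiff; exact: dh.
  by apply: continuous_divdiff_neq za _; exact: ch.
rewrite inE negb_or => /andP[za zE].
by apply: derivable_divdiff_neq => //; exact: dh.
Qed.

(* an entire function of polynomial growth is a polynomial; finitely many
   removable points are tolerated so that divided differences stay in the class *)
Lemma poly_growth m h (E : seq C) A : continuous h ->
  (forall z, z \notin E -> derivable h z 1) ->
  (forall z, modulus (h z) <= A * (1 + modulus z) ^+ m) ->
  exists2 p : {poly C}, (size p <= m.+1)%N & forall z, h z = p.[z].
Proof.
elim: m h E A => [|m IH] h E A ch dh hA.
- have [a aE] := fresh_point E; have [B hB] := divdiff_growth (dh _ aE) hA.
  have [cd dd] := divdiff_regular ch dh aE.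
  have d0 := liouville cd dd.
  exists (h a)%:P; first exact: size_polyC_leq1.
  move=> z; rewrite hornerC (divdiffE h a z) d0 ?mulr0 ?addr0// => e e0.
  exists (B / e) => w we; have := hB w; rewrite expr0 mulr1.
  have w1 : 0 < 1 + modulus w by rewrite ltr_wpDr// modulus_ge0.
  rewrite -ler_pdivlMr// => /le_trans; apply.
  by rewrite ler_pdivrMr// mulrC -ler_pdivrMr//; move: we => /ltW; lra.
- have [a aE] := fresh_point E; have [B hB] := divdiff_growth (dh _ aE) hA.
  have [cd dd] := divdiff_regular ch dh aE.
  have [z|p sp hp] := IH (divdiff h a) (a :: E) B cd dd.
    have w1 : 0 < 1 + modulus z by rewrite ltr_wpDr// modulus_ge0.
    by have := hB z; rewrite exprSr mulrA ler_pM2r.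
  exists ((h a)%:P + ('X - a%:P) * p).
    rewrite (leq_trans (size_polyD _ _))// geq_max (leq_trans (size_polyC_leq1 _))//=.
    by rewrite (leq_trans (size_polyMleq _ _))// size_XsubC.
  by move=> z; rewrite !hornerE -hp -divdiffE.
Qed.

Lemma laurent_growth g (A : R) D : (forall z, z != 0 -> derivable g z 1) ->
  (forall z, z != 0 -> modulus (g z) <= A * (modulus z ^+ D + modulus z ^- D)) ->
  exists2 p : {poly C}, (size p <= (2 * D).+2)%N &
    forall z, z != 0 -> z ^+ D.+1 * g z = p.[z].
Proof.
move=> dg gA.
pose h z := if z == 0 then 0 else z ^+ D.+1 * g z.
have hb z : z != 0 -> modulus (h z) <= A * (modulus z ^+ (2 * D).+1 + modulus z).
  move=> z0; rewrite /h (negPf z0) modulusM modulusX.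
  have mz : modulus z != 0 by rewrite modulus0_eq.
  rewrite (@le_trans _ _ (modulus z ^+ D.+1 * (A * (modulus z ^+ D + modulus z ^- D))))//.
    by rewrite ler_wpM2l ?gA// exprn_ge0// modulus_ge0.
  rewrite mulrCA mulrDr -exprD addSn addnn -mul2n.
  by rewrite [modulus z ^+ D.+1]exprS [X in _ + X]mulfK// expf_neq0.
have A0 : 0 <= A.
  have := gA 1 (oner_neq0 _); rewrite modulus1 !expr1n invr1.
  by move=> /(le_trans (modulus_ge0 _)); rewrite pmulr_lge0.
have h_near z : z != 0 -> \forall w \near z, h w = w ^+ D.+1 * g w.
  by move=> /near_neq; apply: filterS => w /negPf w0; rewrite /h w0.
have dh z : z \notin [:: 0] -> derivable h z 1.
  rewrite inE => z0.
  apply: (near_derivable (h_near z z0)).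
  by apply: derivable_mulX; exact: dg.
have ch : continuous h.
  move=> z; have [->|z0] := eqVneq z 0; last first.
    by apply: derivable_ccont; apply: dh; rewrite inE.
  apply/ccontP => e e0; exists (Num.min 1 (e / (2 * A + 1))).
    by rewrite lt_min ltr01 divr_gt0// ltr_wpDl// mulr_ge0.
  move=> y; rewrite subr0 lt_min => /andP[y1 ye].
  have [->|y0] := eqVneq y 0; first by rewrite subrr modulus0 ltW.
  rewrite {2}/h eqxx subr0 (le_trans (hb _ y0))//.
  have my := modulus_ge0 y.
  have : modulus y ^+ (2 * D).+1 <= modulus y.
    by rewrite exprS ler_piMr// exprn_ile1// ltW.
  rewrite ltr_pdivlMr in ye; last by rewrite ltr_wpDl// mulr_ge0.
  move=> yy; rewrite (@le_trans _ _ (A * (modulus y + modulus y)))//.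
    by rewrite ler_wpM2l// lerD2r.
  have : A * (modulus y + modulus y) <= modulus y * (2 * A + 1).
    have -> : modulus y * (2 * A + 1) = A * (modulus y + modulus y) + modulus y by ring.
    by rewrite lerDl.
  by move=> /le_trans; apply; exact: ltW.
have hg z : modulus (h z) <= (A * 2) * (1 + modulus z) ^+ (2 * D).+1.
  have mz := modulus_ge0 z.
  have [->|z0] := eqVneq z 0.
    by rewrite /h eqxx modulus0 mulr_ge0 ?mulr_ge0// exprn_ge0.
  rewrite (le_trans (hb _ z0))// -mulrA ler_wpM2l// mulr2n mulrDl mul1r lerD//.
    by rewrite lerXn2r ?nnegrE// ?addr_ge0// lerDr.
  rewrite (@le_trans _ _ (1 + modulus z))// ?lerDr// exprS ler_peMr ?addr_ge0//.
  by rewrite exprn_ege1// lerDl.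
have [p sp hp] := poly_growth ch dh hg.
by exists p => // z z0; rewrite -hp /h (negPf z0).
Unshelve. all: by end_near. Qed.

End laurent1.

Section generic_derivable.
Context (K : numFieldType).
Implicit Types (f g : K -> K) (a z : K).

Lemma derivable_mul f g z : derivable f z 1 -> derivable g z 1 ->
  derivable ((fun w => f w * g w) : K -> K) z 1.
Proof.
move=> df dg; have := derivableM df dg.
by congr (derivable _ z 1); apply/funext.
Qed.

Lemma derivable_kernel a z : z != a -> derivable ((fun w => w / (w - a)) : K -> K) z 1.
Proof.
move=> za; apply: derivable_mul; first exact: derivable_id.
apply: derivableV; first by rewrite subr_eq0.
by apply: derivableB; [exact: derivable_id|exact: derivable_cst].
Qed.

Lemma continuous_mulid f z : {for z, continuous f} ->
  {for z, continuous ((fun w => w * f w) : K -> K)}.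
Proof.
move=> cf; have A : (fun w : K => w) @ z --> z by exact: cvg_id.
exact: (@cvgM _ _ (nbhs z) _ _ _ _ _ A cf).
Qed.

End generic_derivable.

Section annulus.
Context (R : realType).
Local Notation C := (cplx R).
Implicit Types (g f k : C -> C) (p z : C).

Lemma itgZl (a b r : R) (f : R -> R) : cts_on a b f -> itg (fun x => r * f x) a b = r * itg f a b.
Proof. by move=> cf; rewrite /itg RintegralZl//; exact: cts_on_integrable. Qed.

Lemma cts_onZ (a b r : R) (f : R -> R) : cts_on a b f -> cts_on a b (fun x => r * f x).
Proof.
move=> cf x xab e e0.
have r0 : 0 < `|r| + 1 by rewrite ltr_wpDl.
have [d d0 H] := cf x xab (e / (`|r| + 1)) ltac:(by rewrite divr_gt0).
exists d => // y yab /(H _ yab) {}H; rewrite -mulrBr normrM.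
move: H; rewrite ler_pdivlMr// mulrDr mulr1 mulrC => H.
by rewrite (le_trans _ H)// lerDl.
Qed.

Lemma itg_norm_le (a b : R) (f h : R -> R) : cts_on a b f -> cts_on a b h ->
  (forall x, a <= x <= b -> `|f x| <= h x) -> `|itg f a b| <= itg h a b.
Proof.
move=> cf ch fh; have ci := cts_on_integrable cf.
rewrite (le_trans (le_normr_Rintegral _ ci))//.
apply: le_Rintegral => //.
- by have := integrable_abse ci; apply: eq_integrable.
- exact: (cts_on_integrable ch).
Qed.

Lemma modulus_dist (z w : C) : `|modulus z - modulus w| <= modulus (z - w).
Proof.
have A := modulusD (z - w) w; have B := modulusD (w - z) z.
rewrite -(modulusN (w - z)) opprB in B; rewrite !subrK in A B.
by rewrite ler_norml; apply/andP; split; lra.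
Qed.

Lemma circle_cts_modulus g p x a b : (forall y, {for p + expi x y, continuous g}) ->
  cts_on a b (fun y => modulus (g (p + expi x y))).
Proof.
move=> H y _ e e0; have [d d0 G] := circle_cts H y e0; exists d => // y' _ /G.
by apply: le_trans; exact: modulus_dist.
Qed.

Lemma cmeanB f k c p x : (forall y, {for p + expi x y, continuous f}) ->
  (forall y, {for p + expi x y, continuous k}) ->
  cmean (fun z => f z - c * k z) p x = cmean f p x - c * cmean k p x.
Proof.
move=> cf ck; rewrite !cmeanE.
have fR := circle_ctsRe (a:=0) (b:=2 * pi) cf; have fI := circle_ctsIm (a:=0) (b:=2 * pi) cf.
have kR := circle_ctsRe (a:=0) (b:=2 * pi) ck; have kI := circle_ctsIm (a:=0) (b:=2 * pi) ck.
case: c => c d.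
have -> : (fun y => complex.Re (f (p + expi x y) - ((c +i* d)%C : C) * k (p + expi x y))) =
    (fun y => complex.Re (f (p + expi x y)) -
      (c * complex.Re (k (p + expi x y)) - d * complex.Im (k (p + expi x y)))).
  by apply/funext => y; case: (f _) => a b; case: (k _).
have -> : (fun y => complex.Im (f (p + expi x y) - ((c +i* d)%C : C) * k (p + expi x y))) =
    (fun y => complex.Im (f (p + expi x y)) -
      (c * complex.Im (k (p + expi x y)) - (- d) * complex.Re (k (p + expi x y)))).
  by apply/funext => y; case: (f _) => a b; case: (k _) => u v /=; ring.
rewrite !itgB ?itgZl//; try (apply: cts_onB); try (exact: cts_onZ).
by apply/eqP; rewrite eq_complex /=; apply/andP; split; apply/eqP; ring.
Qed.

Lemma cmean_le f g p x (M : R) : (forall y, {for p + expi x y, continuous f}) ->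
  (forall y, {for p + expi x y, continuous g}) ->
  (forall y, modulus (f (p + expi x y)) <= M * modulus (g (p + expi x y))) ->
  modulus (cmean f p x) <=
    2 * M * itg (fun y => modulus (g (p + expi x y))) 0 (2 * pi).
Proof.
move=> cf cg fg; rewrite cmeanE (le_trans (modulus_le_ReIm _))//=.
have gM := circle_cts_modulus (a:=0) (b:=2 * pi) cg.
have -> : 2 * M * itg (fun y => modulus (g (p + expi x y))) 0 (2 * pi) =
    itg (fun y => M * modulus (g (p + expi x y))) 0 (2 * pi) +
    itg (fun y => M * modulus (g (p + expi x y))) 0 (2 * pi).
  by rewrite itgZl//; ring.
rewrite lerD//.
  apply: itg_norm_le; [exact: circle_ctsRe|exact: cts_onZ|move=> y _].
  by rewrite (le_trans (le_Re_modulus _)).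
apply: itg_norm_le; [exact: circle_ctsIm|exact: cts_onZ|move=> y _].
by rewrite (le_trans (le_Im_modulus _)).
Qed.

Lemma kernel_le (x0 y0 x y : R) : x0 + 1 <= x \/ x <= x0 - 1 ->
  modulus (expi x y / (expi x y - expi x0 y0)) <= 2.
Proof.
move=> xx; have e2 : (2 : R) <= expR 1 by exact: expR_ge1Dx.
have tri := modulusB (expi x y) (expi x y - expi x0 y0).
rewrite (_ : expi x y - (expi x y - expi x0 y0) = expi x0 y0) in tri; last by ring.
have tri' := modulusD (expi x y - expi x0 y0) (expi x0 y0).
rewrite subrK in tri'.
rewrite !modulus_expi in tri tri'.
rewrite modulusM modulusV modulus_expi.
have ex0 := expR_gt0 x; have ex00 := expR_gt0 x0.
have H : 2 * expR x0 <= expR x \/ 2 * expR x <= expR x0.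
  case: xx => xx; [left|right].
    rewrite (@le_trans _ _ (expR (x0 + 1)))// ?ler_expR//.
    by rewrite expRD mulrC ler_wpM2l// ltW.
  rewrite (@le_trans _ _ (expR (x + 1)))// ?ler_expR; last by lra.
  by rewrite expRD mulrC ler_wpM2l// ltW.
by rewrite ler_pdivrMr; case: H => H; lra.
Qed.

Lemma kernel_approx (x0 y0 x y e : R) : 0 < e ->
  (2 * (1 + e^-1) * expR x0 <= expR x ->
     modulus (expi x y / (expi x y - expi x0 y0) - 1) <= e) /\
  (2 * (1 + e^-1) * expR x <= expR x0 ->
     modulus (expi x y / (expi x y - expi x0 y0)) <= e).
Proof.
move=> e0.
have tri := modulusB (expi x y) (expi x y - expi x0 y0).
rewrite (_ : expi x y - (expi x y - expi x0 y0) = expi x0 y0) in tri; last by ring.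
have tri' := modulusD (expi x y - expi x0 y0) (expi x0 y0).
rewrite subrK in tri'.
rewrite !modulus_expi in tri tri'.
have ex0 := expR_gt0 x; have ex00 := expR_gt0 x0.
have ei : 0 < e^-1 by rewrite invr_gt0.
set M := modulus (expi x y - expi x0 y0) in tri tri'.
split=> H.
  have h2 : 0 <= e^-1 * expR x0 by rewrite ltW// mulr_gt0.
  have M0 : 0 < M by lra.
  have nz : expi x y - expi x0 y0 != 0 by rewrite -modulus_gt0.
  have -> : expi x y / (expi x y - expi x0 y0) - 1 = expi x0 y0 / (expi x y - expi x0 y0).
    by field.
  rewrite modulusM modulusV modulus_expi -/M ler_pdivrMr// -ler_pdivrMl//.
  lra.
have h2 : 0 <= e^-1 * expR x by rewrite ltW// mulr_gt0.
have M0 : 0 < M by lra.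
rewrite modulusM modulusV modulus_expi -/M ler_pdivrMr// -ler_pdivrMl//.
lra.
Qed.

Section cauchy_kernel.
Variables (x0 y0 : R).
Let a : C := expi x0 y0.
Let ker (z : C) : C := z / (z - a).

Lemma expi_neq x y : x != x0 -> expi x y != a.
Proof.
move=> xx0; apply/eqP => /(congr1 (@modulus R)); rewrite !modulus_expi => /expR_inj xE.
by rewrite xE eqxx in xx0.
Qed.

Let ker_cont x y : x != x0 -> {for 0 + expi x y, continuous ker}.
Proof.
by move=> xx0; apply: derivable_ccont; apply: derivable_kernel; rewrite add0r expi_neq.
Qed.

Let cmean_ker_right x : x0 < x -> cmean ker 0 x = ((2 * pi)%:C)%C.
Proof.
move=> xx; apply/eqP; rewrite -subr_eq0 -modulus0_eq eq_le modulus_ge0 andbT.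
apply/ler_addgt0Pr => e e0; rewrite add0r.
have pp := pi_gt0 R.
pose e1 := e / (4 * pi); have e10 : 0 < e1 by rewrite divr_gt0// mulr_gt0.
pose L := 2 * (1 + e1^-1) * expR x0.
have L0 : 0 < L by rewrite !mulr_gt0// ?expR_gt0// addr_gt0// invr_gt0.
pose x' := Num.max x (ln L).
have xx' : x <= x' by rewrite le_max lexx.
have -> : cmean ker 0 x = cmean ker 0 x'.
  apply: cmean_const => // u v /andP[xu _]; apply: derivable_kernel; rewrite add0r.
  by apply: expi_neq; rewrite gt_eqF// (lt_le_trans xx).
have x'0 : x' != x0 by rewrite gt_eqF// (lt_le_trans xx).
rewrite -[X in cmean _ _ _ - X]mulr1.
have -> : e = 4 * pi * e1 by rewrite mulrC divfK// mulf_neq0// gt_eqF.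
apply: cmean_approx => [y|y _]; first exact: ker_cont.
rewrite add0r; apply: (kernel_approx x0 y0 x' y e10).1.
by rewrite -/L -[leLHS]lnK ?posrE// ler_expR le_max lexx orbT.
Qed.

Let cmean_ker_left x : x < x0 -> cmean ker 0 x = 0.
Proof.
move=> xx; apply/eqP; rewrite -modulus0_eq eq_le modulus_ge0 andbT.
apply/ler_addgt0Pr => e e0; rewrite add0r.
have pp := pi_gt0 R.
pose e1 := e / (4 * pi); have e10 : 0 < e1 by rewrite divr_gt0// mulr_gt0.
pose L := expR x0 / (2 * (1 + e1^-1)).
have d0 : 0 < 2 * (1 + e1^-1) by rewrite mulr_gt0// addr_gt0// invr_gt0.
have L0 : 0 < L by rewrite divr_gt0// expR_gt0.
pose x' := Num.min x (ln L).
have xx' : x' <= x by rewrite ge_min lexx.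
have -> : cmean ker 0 x = cmean ker 0 x'.
  apply/esym; apply: cmean_const => // u v /andP[_ xu]; apply: derivable_kernel; rewrite add0r.
  by apply: expi_neq; rewrite lt_eqF// (le_lt_trans xu).
have x'0 : x' != x0 by rewrite lt_eqF// (le_lt_trans xx').
rewrite -[X in modulus X]subr0 -[X in cmean _ _ _ - X](mulr0 ((2 * pi)%:C)%C).
have -> : e = 4 * pi * e1 by rewrite mulrC divfK// mulf_neq0// gt_eqF.
apply: cmean_approx => [y|y _]; first exact: ker_cont.
rewrite add0r subr0; apply: (kernel_approx x0 y0 x' y e10).2.
rewrite mulrC -ler_pdivlMr// -/L -[leRHS]lnK ?posrE// ler_expR.
by rewrite ge_min lexx orbT.
Qed.

(* Cauchy's formula on the annulus between the circles of log-radii x2 < x0 < x1 *)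
Lemma annulus_bound g x1 x2 : (forall z, z != 0 -> derivable g z 1) ->
  x0 + 1 <= x1 -> x2 <= x0 - 1 ->
  pi * modulus (g (expi x0 y0)) <=
    2 * (itg (fun y => modulus (g (expi x1 y))) 0 (2 * pi) +
         itg (fun y => modulus (g (expi x2 y))) 0 (2 * pi)).
Proof.
move=> dg h1 h2.
have a0 : a != 0 by exact: expi_neq0.
have da := dg _ a0.
pose Phi (z : C) : C := z * divdiff g a z.
have M : cmean Phi 0 x1 = cmean Phi 0 x2.
  apply: (@cmean_eq _ Phi 0 [:: a]) => z z0.
    apply: continuous_mulid; have [->|za] := eqVneq z a; first exact: continuous_divdiff.
    exact: (continuous_divdiff_neq za (derivable_ccont (dg _ z0))).
  rewrite inE => za; apply: derivable_mul; first exact: derivable_id.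
  exact: (derivable_divdiff_neq za (dg _ z0)).
pose G (z : C) : C := g z * ker z.
have PhiE x : x != x0 -> cmean Phi 0 x = cmean G 0 x - g a * cmean ker 0 x.
  move=> xx0; rewrite -cmeanB => [|y|y]; last exact: ker_cont; last first.
    apply: derivable_ccont; apply: derivable_mul; rewrite add0r; first by apply: dg; exact: expi_neq0.
    by apply: derivable_kernel; exact: expi_neq.
  have E y : Phi (0 + expi x y) = G (0 + expi x y) - g a * ker (0 + expi x y).
    by rewrite add0r /Phi /divdiff (negPf (expi_neq y xx0)) /G /ker; ring.
  rewrite !cmeanE; congr (_ +i* _)%C; congr (itg _ _ _); apply/funext => y; exact: congr1 (E y).
have x10 : x1 != x0 by rewrite gt_eqF//; lra.
have x20 : x2 != x0 by rewrite lt_eqF//; lra.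
move: M; rewrite !PhiE// cmean_ker_right ?cmean_ker_left; [|lra..].
rewrite mulr0 subr0 => M.
have {}M : g a * ((2 * pi)%:C)%C = cmean G 0 x1 - cmean G 0 x2 by rewrite -M; ring.
have B x : x != x0 -> x0 + 1 <= x \/ x <= x0 - 1 ->
  modulus (cmean G 0 x) <= 2 * 2 * itg (fun y => modulus (g (expi x y))) 0 (2 * pi).
  move=> xx0 xx.
  have -> : (fun y => modulus (g (expi x y))) = (fun y => modulus (g (0 + expi x y))).
    by apply/funext => y; rewrite add0r.
  apply: cmean_le => y.
  - apply: derivable_ccont; apply: derivable_mul; rewrite add0r; first by apply: dg; exact: expi_neq0.
    by apply: derivable_kernel; exact: expi_neq.
  - by apply: derivable_ccont; apply: dg; rewrite add0r expi_neq0.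
  - rewrite add0r /G modulusM mulrC ler_wpM2r ?modulus_ge0//; exact: kernel_le.
have : modulus (g a * ((2 * pi)%:C)%C) <= 2 * 2 * itg (fun y => modulus (g (expi x1 y))) 0 (2 * pi) +
   2 * 2 * itg (fun y => modulus (g (expi x2 y))) 0 (2 * pi).
  by rewrite M (le_trans (modulusB _ _))// lerD// B//; [left|right].
have pp := pi_gt0 R.
rewrite modulusM modulusC gtr0_norm ?mulr_gt0//; lra.
Qed.

End cauchy_kernel.
End annulus.

Ltac measurable_tac := repeat first
  [ exact: measurable_fst | exact: measurable_snd | exact: measurable_id
  | exact: (measurableT_comp measurable_fst measurable_fst)
  | exact: (measurableT_comp measurable_snd measurable_fst)
  | exact: (measurableT_comp measurable_fst measurable_snd)
  | exact: (measurableT_comp measurable_snd measurable_snd)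
  | exact: measurable_cst
  | apply: (measurableT_comp (@measurable_cons_pair _ _ _))
  | apply/measurable_fun_pairP; split => /= ].

Section measure_transport.
Local Open Scope ereal_scope.
Context d1 d2 (T1 : measurableType d1) (T2 : measurableType d2) (R : realType).

Lemma ge0_integral_sf_pushforward (f : T1 -> T2) (g : T2 -> T1)
    (mf : measurable_fun setT f) (mg : measurable_fun setT g) (fK : cancel f g)
    (m : {sigma_finite_measure set T1 -> \bar R}) (h : T2 -> \bar R) :
  measurable_fun setT h -> (forall y, 0 <= h y) ->
  \int[sf_pushforward mf mg fK m]_y h y = \int[m]_x h (f x).
Proof.
move=> mh h0.
transitivity (\int[pushforward m f]_(y in setT) h y).
  by apply: eq_measure_integral.
by rewrite ge0_integral_pushforward// preimage_setT.
Qed.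

Lemma ge0_integral_sf_product (m1 : {sigma_finite_measure set T1 -> \bar R})
    (m2 : {sigma_finite_measure set T2 -> \bar R}) (h : T1 * T2 -> \bar R) :
  measurable_fun setT h -> (forall y, 0 <= h y) ->
  \int[sf_product m1 m2]_z h z = \int[m1]_x \int[m2]_y h (x, y).
Proof.
move=> mh h0.
transitivity (\int[(m1 \x m2)%E]_(y in setT) h y).
  by apply: eq_measure_integral.
by rewrite fubini_tonelli1.
Qed.

End measure_transport.

Section iterated_slices.
Local Open Scope ereal_scope.
Context d (T : measurableType d) (R : realType).
Variables (m1 m2 : {sigma_finite_measure set T -> \bar R}).
Variable J : T -> T -> R.
Hypothesis J0 : forall a b, (0 <= J a b)%R.
Hypothesis mJ : forall a, measurable_fun setT (J a).

Lemma ge0_integral_power n (h : n.+1.-tuple T -> \bar R) (m : {sigma_finite_measure set T -> \bar R}) :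
  measurable_fun setT h -> (forall y, 0 <= h y) ->
  \int[power_measure m n.+1]_t h t =
  \int[m]_a \int[power_measure m n]_t h (cons_pair (a, t)).
Proof.
move=> mh h0; rewrite ge0_integral_sf_pushforward// ge0_integral_sf_product//.
by apply: measurableT_comp => //; exact: measurable_cons_pair.
Qed.

Definition setnth n (t : n.-tuple T) (i : 'I_n) (a : T) : n.-tuple T :=
  [tuple if j == i then a else tnth t j | j < n].

Definition Jprod n (t t' : n.-tuple T) : R := (\prod_(i < n) J (tnth t i) (tnth t' i))%R.

Lemma Jprod_ge0 n (t t' : n.-tuple T) : (0 <= Jprod t t')%R.
Proof. by apply: prodr_ge0. Qed.

Lemma measurable_Jprod n (t : n.-tuple T) : measurable_fun setT (Jprod t).
Proof.
apply: measurable_prod => i _; apply: measurableT_comp; first exact: mJ.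
exact: measurable_tnth.
Qed.

Lemma tuple_cons n (t : n.+1.-tuple T) : exists a t0, t = cons_pair (a, t0).
Proof.
exists (thead t), [tuple of behead t]; apply: val_inj.
by case/tupleP: t => a t.
Qed.

Lemma tnth_cons0 n (t : n.-tuple T) a : tnth (cons_pair (a, t)) ord0 = a.
Proof. by rewrite (tnth_nth a). Qed.

Lemma tnth_consS n (t : n.-tuple T) a i :
  tnth (cons_pair (a, t)) (lift ord0 i) = tnth t i.
Proof. by rewrite !(tnth_nth a). Qed.

Lemma setnth0 n (t : n.-tuple T) a b :
  setnth (cons_pair (a, t)) ord0 b = cons_pair (b, t).
Proof.
apply: eq_from_tnth => i; rewrite tnth_mktuple.
by case: (unliftP ord0 i) => [j ->|->]; rewrite ?tnth_consS ?tnth_cons0 ?eqxx.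
Qed.

Lemma setnthS n (t : n.-tuple T) (i : 'I_n) a b :
  setnth (cons_pair (a, t)) (lift ord0 i) b = cons_pair (a, setnth t i b).
Proof.
apply: eq_from_tnth => j; rewrite tnth_mktuple.
case: (unliftP ord0 j) => [k ->|->]; last by rewrite !tnth_cons0.
by rewrite (inj_eq (@lift_inj _ _)) !tnth_consS tnth_mktuple.
Qed.

Lemma JprodS n (a a' : T) (t t' : n.-tuple T) :
  (Jprod (cons_pair (a, t)) (cons_pair (a', t')) = J a a' * Jprod t t')%R.
Proof.
rewrite /Jprod big_ord_recl !tnth_cons0; congr (_ * _)%R.
by apply: eq_bigr => i _; rewrite !tnth_consS.
Qed.

Lemma slice_bound n (G : n.-tuple T * n.-tuple T -> \bar R) (c : R) : (0 <= c)%R ->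
  measurable_fun setT G -> (forall p, 0 <= G p) ->
  (forall t s i, G (t, s) <= c%:E * \int[m1]_a \int[m2]_b
     ((J (tnth t i) a)%:E * G (setnth t i a, setnth s i b))) ->
  forall t s, G (t, s) <= (c ^+ n)%:E *
    \int[power_measure m1 n]_t' \int[power_measure m2 n]_s'
      ((Jprod t t')%:E * G (t', s')).
Proof.
move=> c0; elim: n G => [|n IH] G mG G0 HG t s.
  rewrite expr0 mul1e (tuple0 t) (tuple0 s).
  have cstE (m : {sigma_finite_measure set T -> \bar R}) (r : \bar R) :
      \int[power_measure m 0]_x cst r x = r.
    by rewrite integral_cst// -[RHS]mule1; congr (_ * _); exact: diracT.
  rewrite (_ : (fun t' => _) = cst (G ([tuple], [tuple]))) ?cstE//.
  apply/funext => t'; rewrite (_ : (fun s' => _) = cst (G ([tuple], [tuple]))) ?cstE//.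
  by apply/funext => s'; rewrite /Jprod big_ord0 mul1e (tuple0 t') (tuple0 s').
have [a0 [t0 ->]] := tuple_cons t; have [b0 [s0 ->]] := tuple_cons s.
pose P1 := power_measure m1 n; pose P2 := power_measure m2 n.
pose K (ab : T * T) (ts : n.-tuple T * n.-tuple T) :=
  (Jprod t0 ts.1)%:E * G (cons_pair (ab.1, ts.1), cons_pair (ab.2, ts.2)).
have K0 ab ts : 0 <= K ab ts by rewrite mule_ge0// lee_fin Jprod_ge0.
have mGc : measurable_fun setT (fun z : (T * T) * (n.-tuple T * n.-tuple T) =>
    G (cons_pair (z.1.1, z.2.1), cons_pair (z.1.2, z.2.2))).
  by apply: (measurableT_comp mG); measurable_tac.
have mK : measurable_fun setT (fun z : (T * T) * (n.-tuple T * n.-tuple T) => K z.1 z.2).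
  apply: emeasurable_funM => //; apply/measurable_EFinP.
  by apply: (measurableT_comp (measurable_Jprod t0)); measurable_tac.
have mKab ab : measurable_fun setT (K ab).
  exact: (measurableT_comp mK (@measurable_pair1 _ _ _ _ ab)).
pose Phi ab := \int[P1]_t' \int[P2]_s' K ab (t', s').
have Phi0 ab : 0 <= Phi ab by apply: integral_ge0 => t' _; exact: integral_ge0.
have mPhi : measurable_fun setT Phi.
  have -> : Phi = fubini_F (sf_product P1 P2) (fun z => K z.1 z.2).
    by apply/funext => ab; rewrite /fubini_F/= ge0_integral_sf_product.
  exact: measurable_fun_fubini_tonelli_F.
have mPhia a : measurable_fun setT (fun b => Phi (a, b)).
  by apply: (measurableT_comp mPhi); exact: measurable_pair1.
have IHab a b : G (cons_pair (a, t0), cons_pair (b, s0)) <= (c ^+ n)%:E * Phi (a, b).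
  have mGab : measurable_fun setT (fun p : n.-tuple T * n.-tuple T =>
      G (cons_pair (a, p.1), cons_pair (b, p.2))).
    exact: (measurableT_comp mGc (@measurable_pair1 _ _ _ _ (a, b))).
  apply: (IH _ mGab) => [p|t' s' i]; first exact: G0.
  have := HG (cons_pair (a, t')) (cons_pair (b, s')) (lift ord0 i).
  rewrite tnth_consS => H; apply: (le_trans H).
  apply: lee_wpmul2l; first by rewrite lee_fin.
  rewrite [leLHS](eq_integral (fun a' => \int[m2]_b' ((J (tnth t' i) a')%:E *
    G (cons_pair (a, setnth t' i a'), cons_pair (b, setnth s' i b'))))); first exact: lexx.
  by move=> a' _; apply: eq_integral => b' _; rewrite !setnthS.
apply: (le_trans (HG _ _ ord0)); rewrite tnth_cons0.
have cn0 : (0 <= c ^+ n)%R by rewrite exprn_ge0.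
have -> : \int[power_measure m1 n.+1]_t' \int[power_measure m2 n.+1]_s'
    ((Jprod (cons_pair (a0, t0)) t')%:E * G (t', s')) =
  \int[m1]_a ((J a0 a)%:E * \int[m2]_b Phi (a, b)).
  have mJG : measurable_fun setT (fun z : n.+1.-tuple T * n.+1.-tuple T =>
      (Jprod (cons_pair (a0, t0)) z.1)%:E * G z).
    apply: emeasurable_funM => //; apply/measurable_EFinP.
    by apply: (measurableT_comp (measurable_Jprod _)).
  have JG0 z : 0 <= (Jprod (cons_pair (a0, t0)) z.1)%:E * G z.
    by rewrite mule_ge0// lee_fin Jprod_ge0.
  rewrite ge0_integral_power; last 2 first.
  - exact: (@measurable_fun_fubini_tonelli_F _ _ _ _ _ (power_measure m2 n.+1) _ mJG JG0).
  - by move=> t'; apply: integral_ge0 => s' _; exact: (JG0 (t', s')).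
  apply: eq_integral => a _.
  have -> : \int[m2]_b Phi (a, b) = \int[P1]_t' \int[m2]_b \int[P2]_s' K (a, b) (t', s').
    have mKa : measurable_fun setT (fun z : (T * n.-tuple T) * n.-tuple T => K (a, z.1.1) (z.1.2, z.2)).
      apply: (@measurableT_comp _ _ _ _ _ _ _ _ (fun z => ((a, z.1.1), (z.1.2, z.2))) mK).
      by measurable_tac.
    apply: (@fubini_tonelli _ _ _ _ _ m2 P1 (fun z => \int[P2]_s' K (a, z.1) (z.2, s'))).
      exact: (@measurable_fun_fubini_tonelli_F _ _ _ _ _ P2 _ mKa).
    by move=> z; exact: integral_ge0.
  have mKt t' : measurable_fun setT (fun z : T * n.-tuple T => K (a, z.1) (t', z.2)).
    apply: (@measurableT_comp _ _ _ _ _ _ _ _ (fun z => ((a, z.1), (t', z.2))) mK).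
    by measurable_tac.
  rewrite -ge0_integralZl//; last 3 first.
  - have mKa2 : measurable_fun setT (fun z : n.-tuple T * (T * n.-tuple T) => K (a, z.2.1) (z.1, z.2.2)).
      apply: (@measurableT_comp _ _ _ _ _ _ _ _ (fun z => ((a, z.2.1), (z.1, z.2.2))) mK).
      by measurable_tac.
    have := @measurable_fun_fubini_tonelli_F _ _ _ _ _ (sf_product m2 P2) _ mKa2 (fun z => K0 _ _).
    congr measurable_fun; apply/funext => t'.
    by rewrite /fubini_F ge0_integral_sf_product//=; exact: mKt.
  - by move=> t' _; apply: integral_ge0 => b _; exact: integral_ge0.
  - by rewrite lee_fin.
  apply: eq_integral => t' _.
  rewrite ge0_integral_power; last 2 first.
  - apply: emeasurable_funM => //.
    by apply: (measurableT_comp mG); exact: measurable_pair1.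
  - by move=> s'; exact: (JG0 (_, s')).
  rewrite -ge0_integralZl//; last 3 first.
  - exact: (@measurable_fun_fubini_tonelli_F _ _ _ _ _ P2 _ (mKt t')).
  - by move=> b _; exact: integral_ge0.
  - by rewrite lee_fin.
  apply: eq_integral => b _.
  rewrite -ge0_integralZl//; last 2 first.
  - by apply: (measurableT_comp (mKab (a, b))); exact: measurable_pair1.
  - by rewrite lee_fin.
  by apply: eq_integral => s' _; rewrite JprodS EFinM -muleA.
clearbody Phi; rewrite exprS EFinM -muleA lee_wpmul2l ?lee_fin//.
have mPhi2 : measurable_fun setT (fun a => \int[m2]_b Phi (a, b)).
  exact: (@measurable_fun_fubini_tonelli_F _ _ _ _ _ m2 _ mPhi).
have Phi20 a : 0 <= \int[m2]_b Phi (a, b) by exact: integral_ge0.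
have mJ0 : measurable_fun setT (fun a => (J a0 a)%:E) by apply/measurable_EFinP.
have mJPhi : measurable_fun setT (fun a => (J a0 a)%:E * \int[m2]_b Phi (a, b)).
  exact: emeasurable_funM.
have JPhi0 a : 0 <= (J a0 a)%:E * \int[m2]_b Phi (a, b) by rewrite mule_ge0// lee_fin.
have cnE : 0 <= (c ^+ n)%:E by rewrite lee_fin.
have -> : (c ^+ n)%:E * \int[m1]_a ((J a0 a)%:E * \int[m2]_b Phi (a, b)) =
    \int[m1]_a ((c ^+ n)%:E * ((J a0 a)%:E * \int[m2]_b Phi (a, b))).
  by rewrite ge0_integralZl.
have mG2 : measurable_fun setT (fun z : T * T => G (cons_pair (z.1, t0), cons_pair (z.2, s0))).
  by apply: (measurableT_comp mG); measurable_tac.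
have mJG2 : measurable_fun setT (fun z : T * T =>
    (J a0 z.1)%:E * G (setnth (cons_pair (a0, t0)) ord0 z.1, setnth (cons_pair (b0, s0)) ord0 z.2)).
  apply: emeasurable_funM.
    by apply/measurable_EFinP; apply: (measurableT_comp (mJ a0)); measurable_tac.
  rewrite (_ : (fun z => _) = fun z => G (cons_pair (z.1, t0), cons_pair (z.2, s0)))//.
  by apply/funext => z; rewrite !setnth0.
apply: ge0_le_integral => //.
- by move=> a _; apply: integral_ge0 => b _; rewrite mule_ge0// lee_fin.
- apply: (@measurable_fun_fubini_tonelli_F _ _ _ _ _ m2 _ mJG2) => z.
  by rewrite mule_ge0// lee_fin.
- exact: emeasurable_funM.
move=> a _; rewrite muleCA.
have -> : (c ^+ n)%:E * \int[m2]_b Phi (a, b) = \int[m2]_b ((c ^+ n)%:E * Phi (a, b)).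
  by rewrite ge0_integralZl.
have mcPhi : measurable_fun setT (fun b => (c ^+ n)%:E * Phi (a, b)) by exact: emeasurable_funM.
rewrite -ge0_integralZl ?lee_fin//; last by move=> b _; rewrite mule_ge0.
apply: ge0_le_integral => //.
- by move=> b _; rewrite mule_ge0// lee_fin.
- exact: (measurableT_comp mJG2 (@measurable_pair1 _ _ _ _ a)).
- exact: emeasurable_funM.
by move=> b _; rewrite !setnth0 lee_wpmul2l ?lee_fin.
Qed.

End iterated_slices.

Section continuous_measurable.
Context (R : realType).
Local Notation Rm := (measurableTypeR R).

Lemma measurable_floor_eq (N : nat) (k : int) :
  measurable ([set x : R | Num.floor (x * N.+1%:R) = k] : set Rm).
Proof.
have N0 : (0 : R) < N.+1%:R by rewrite ltr0n.
rewrite (_ : [set x | _] = `[k%:~R / N.+1%:R, (k + 1)%:~R / N.+1%:R[%classic).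
  exact: measurable_itv.
apply/seteqP; split => x /=; rewrite in_itv/= ler_pdivrMr// ltr_pdivlMr//.
  by move=> <-; exact: floor_itv.
by move=> /floor_def.
Qed.

Lemma continuous_tuple_measurable n (g : n.-tuple Rm * n.-tuple Rm -> R) :
  (forall p e, 0 < e -> exists2 d : R, 0 < d & forall p',
    (forall i, `|(tnth p'.1 i : R) - tnth p.1 i| < d /\ `|(tnth p'.2 i : R) - tnth p.2 i| < d) ->
    `|g p' - g p| <= e) ->
  measurable_fun setT g.
Proof.
move=> cg.
pose fl N (x : R) : int := Num.floor (x * N.+1%:R).
pose up N (k : int) : R := k%:~R / N.+1%:R.
pose idx N (p : n.-tuple Rm * n.-tuple Rm) := ([tuple fl N (tnth p.1 i) | i < n], [tuple fl N (tnth p.2 i) | i < n]).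
pose h N (u : n.-tuple int * n.-tuple int) : R :=
  g ([tuple up N (tnth u.1 i) | i < n] : n.-tuple Rm, [tuple up N (tnth u.2 i) | i < n] : n.-tuple Rm).
apply: (@measurable_fun_cvg _ _ _ setT (fun N p => h N (idx N p))).
  move=> N _ A mA; rewrite setTI.
  pose F u := if `[< A (h N u) >] then idx N @^-1` [set u] else set0.
  have -> : (fun p => h N (idx N p)) @^-1` A = \bigcup_u F u.
    apply/seteqP; split => p /=.
      by move=> Ap; exists (idx N p) => //; rewrite /F; case: asboolP.
    by move=> [u _]; rewrite /F; case: asboolP => //= Au ->.
  apply: countable_bigcupT_measurable => [|u]; first exact: countableP.
  rewrite /F; case: asboolP => // _.
  have -> : idx N @^-1` [set u] =
    (\big[setI/setT]_(i < n) [set p | fl N (tnth p.1 i) = tnth u.1 i]) `&`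
    (\big[setI/setT]_(i < n) [set p | fl N (tnth p.2 i) = tnth u.2 i]).
    apply/seteqP; split => p /=.
      move=> <-; split; rewrite -bigcap_seq => i _ /=; by rewrite tnth_mktuple.
    rewrite -!bigcap_seq => -[H1 H2]; case: u H1 H2 => u1 u2 H1 H2.
    congr (_, _); apply: eq_from_tnth => i; rewrite tnth_mktuple.
      by apply: H1; rewrite /= mem_index_enum.
    by apply: H2; rewrite /= mem_index_enum.
  apply: measurableI; apply: bigsetI_measurable => i _.
    have m1 : measurable_fun setT (fun p : n.-tuple Rm * n.-tuple Rm => tnth p.1 i).
      exact: (measurableT_comp (measurable_tnth i) measurable_fst).
    by have := m1 measurableT _ (measurable_floor_eq N (tnth u.1 i)); rewrite setTI.
  have m2 : measurable_fun setT (fun p : n.-tuple Rm * n.-tuple Rm => tnth p.2 i).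
    exact: (measurableT_comp (measurable_tnth i) measurable_snd).
  by have := m2 measurableT _ (measurable_floor_eq N (tnth u.2 i)); rewrite setTI.
move=> p _; apply/cvgrPdist_le => e e0; have [d d0 H] := cg p e e0.
near=> N; rewrite distrC; apply: H => i /=; rewrite !tnth_mktuple /up /fl.
have key (x : R) : `|(Num.floor (x * N.+1%:R))%:~R / N.+1%:R - x| < d.
  have N0 : (0 : R) < N.+1%:R by rewrite ltr0n.
  have /andP[f1 f2] := floor_itv (x * N.+1%:R); rewrite intrD in f2.
  have dN : d^-1 < N.+1%:R.
    near: N; exists (Num.bound d^-1) => // N /= bN.
    by rewrite (lt_le_trans (archi_boundP _)) ?invr_ge0 ?ltW// ltr_nat ltnS.
  have {}dN : 1 < d * N.+1%:R by rewrite mulrC -ltr_pdivrMr// div1r.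
  set k := (Num.floor _)%:~R in f1 f2 *.
  have -> : k / N.+1%:R - x = (k - x * N.+1%:R) / N.+1%:R.
    by field; rewrite gt_eqF.
  rewrite normrM normfV (gtr0_norm N0) ltr_pdivrMr// ler0_norm ?subr_le0//; lra.
by split; exact: key.
Unshelve. all: by end_near. Qed.

End continuous_measurable.

Section slices.
Context (R : realType) (n : nat).
Local Notation C := (cplx R).
Local Notation Rm := (measurableTypeR R).
Implicit Types (f : 'rV[C]_n -> C) (z : 'rV[C]_n) (x th : 'rV[R]_n).

Definition setc z (i : 'I_n) (w : C) : 'rV[C]_n :=
  \row_j (if j == i then w else z 0 j).

Lemma torus_pointE x th i : torus_point x th 0 i = expi (x 0 i / 2) (th 0 i).
Proof. by rewrite mxE. Qed.

Lemma torus_torus_point x th : torus (torus_point x th).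
Proof. by move=> i; rewrite torus_pointE expi_neq0. Qed.

Lemma torus_setc z i w : torus z -> w != 0 -> torus (setc z i w).
Proof. by move=> tz w0 j; rewrite mxE; case: ifP. Qed.

Lemma setc_id z i : setc z i (z 0 i) = z.
Proof. by apply/rowP => j; rewrite mxE; case: eqP => // ->. Qed.

Lemma setc_derivable f z i w : differentiable f (setc z i w) ->
  derivable (fun w => f (setc z i w)) w 1.
Proof.
move=> df; have := @diff_derivable _ _ _ f (setc z i w) (delta_mx 0 i) df.
rewrite /derivable => H; set F := (X in cvg (X @ _)).
suff -> : F = fun h => h^-1 *: ((f \o shift (setc z i w)) (h *: delta_mx 0 i) - f (setc z i w)) by [].
apply/funext => h; rewrite /F /=; congr (_ *: (f _ - _)).
apply/rowP => j; rewrite !mxE /=.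
by case: (j == i) => /=; rewrite ?mulr0 ?add0r.
Qed.

Lemma pull_cts f x th : differentiable f (torus_point x th) ->
  forall e, 0 < e -> exists2 d : R, 0 < d & forall x' th',
    (forall i, `|x' 0 i - x 0 i| < d /\ `|th' 0 i - th 0 i| < d) ->
    modulus (pull f (x', th') - pull f (x, th)) <= e.
Proof.
move=> /differentiable_continuous cf e e0.
have /cf : nbhs (f (torus_point x th)) [set w | modulus (w - f (torus_point x th)) <= e].
  apply/nbhs_ballP; exists ((e%:C)%C : C) => /=; first by rewrite ltcR.
  by move=> w; rewrite /ball/= distrC normCE ltcR => /ltW.
move=> /nbhs_ballP[d /= d0 H].
move: (d0); rewrite ltcE/= => /andP[/eqP di dr].
have [d' d'0 G] : exists2 d' : R, 0 < d' & forall i (x' y' : R), `|x' - x 0 i| < d' ->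
    `|y' - th 0 i| < d' -> modulus (expi (x' / 2) y' - expi (x 0 i / 2) (th 0 i)) < complex.Re d.
  suff [d' d'0 G] : exists2 d' : R, 0 < d' & forall i, i \in enum 'I_n ->
      forall x' y' : R, `|x' - x 0 i| < d' ->
    `|y' - th 0 i| < d' -> modulus (expi (x' / 2) y' - expi (x 0 i / 2) (th 0 i)) < complex.Re d.
    by exists d' => // i; apply: G; rewrite mem_enum.
  elim: (enum 'I_n) => [|j s [d' d'0 IH]]; first by exists 1.
  have [dj dj0 Hj] := @expi_continuous R (x 0 j / 2) (th 0 j) _ dr.
  exists (Num.min d' dj); first by rewrite lt_min d'0.
  move=> i; rewrite inE => /predU1P[->|/IH {}IH] x' y'; rewrite !lt_min => /andP[a1 a2] /andP[b1 b2].
    apply: Hj => //; rewrite -mulrBl normrM normfV [X in _ / X]ger0_norm//.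
    by rewrite (le_lt_trans _ a2)// ler_pdivrMr// ler_peMr// ler1n.
  exact: IH.
exists d' => // x' th' H'; apply: H; split=> // i j /=; rewrite (ord1 i) {i} /ball/=.
rewrite !torus_pointE distrC normCE ltcE/= -di eqxx/=.
by have [a b] := H' j; exact: G.
Qed.

End slices.

Section torus_integral.
Context (R : realType) (n : nat).
Local Notation C := (cplx R).
Local Notation Rm := (measurableTypeR R).
Local Notation unif := ([the {sigma_finite_measure set (measurableTypeR R) -> \bar R}
  of uniform_prob (@two_pi_gt0 R)]).
Local Notation leb := (@lebesgue_measure R).

Lemma measurable_rows (h : 'rV[R]_n * 'rV[R]_n -> R) :
  measurable_fun setT (fun p : n.-tuple Rm * n.-tuple Rm =>
    h (row_of_tuple p.1, row_of_tuple p.2)) ->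
  measurable_fun setT h.
Proof.
move=> mh.
have mt : measurable_fun setT (fun p : 'rV[R]_n * 'rV[R]_n => (tuple_of_row p.1, tuple_of_row p.2)).
  apply/measurable_fun_pairP; split => /=.
    exact: (measurableT_comp (@measurable_tuple_of_row R n) measurable_fst).
  exact: (measurableT_comp (@measurable_tuple_of_row R n) measurable_snd).
have := measurableT_comp mh mt; congr (measurable_fun _ _).
by apply/funext => -[x y] /=; rewrite !tuple_of_rowK.
Qed.

Lemma continuous_measurable_rows (h : 'rV[R]_n * 'rV[R]_n -> R) :
  (forall (x th : 'rV[R]_n) (e : R), 0 < e -> exists2 d : R, 0 < d & forall x' th' : 'rV[R]_n,
    (forall i, `|x' 0 i - x 0 i| < d /\ `|th' 0 i - th 0 i| < d) ->
    `|h (x', th') - h (x, th)| <= e) ->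
  measurable_fun setT h.
Proof.
move=> ch; apply: measurable_rows; apply: continuous_tuple_measurable => p e e0.
have [d d0 H] := ch (row_of_tuple p.1) (row_of_tuple p.2) e e0.
by exists d => // p' pp'; apply: H => i; rewrite !mxE; exact: pp'.
Qed.

Lemma ge0_integral_nu (h : 'rV[R]_n * 'rV[R]_n -> \bar R) :
  measurable_fun setT h -> (forall p, 0 <= h p)%E ->
  (\int[nu R n]_p h p = \int[power_measure leb n]_t \int[power_measure unif n]_s
    h (row_of_tuple t, row_of_tuple s))%E.
Proof.
move=> mh h0; rewrite /nu ge0_integral_sf_product//.
rewrite /lebesgue_row /row_power_measure ge0_integral_sf_pushforward; last 2 first.
- exact: (@measurable_fun_fubini_tonelli_F _ _ _ _ _ (haar R n) _ mh).
- by move=> x; exact: integral_ge0.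
apply: eq_integral => t _.
rewrite /haar /row_power_measure ge0_integral_sf_pushforward//.
exact: (measurableT_comp mh (@measurable_pair1 _ _ _ _ _)).
Qed.

Definition window (a b : Rm) : R := if `|b - a| <= 4 then 1 else 0.

Lemma window_ge0 a b : 0 <= window a b. Proof. by rewrite /window; case: ifP. Qed.

Lemma window_le1 a b : window a b <= 1. Proof. by rewrite /window; case: ifP. Qed.

Lemma measurable_window a : measurable_fun setT (window a).
Proof.
rewrite (_ : window a = \1_(`[(a : R) - 4, (a : R) + 4]%classic : set Rm)).
  exact: measurable_indic.
apply/funext => b; rewrite /window indicE mem_setE in_itv/= ler_distl.
by case: ifP.
Qed.

Lemma circle_mean (g : C -> C) (x : R) : (forall w, w != 0 -> derivable g w 1) ->
  (\int[unif]_b (modulus (g (expi x b)))%:E =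
   ((2 * pi)^-1 * itg (fun y => modulus (g (expi x y))) 0 (2 * pi))%:E)%E.
Proof.
move=> dg.
have cg y : {for 0 + expi x y, continuous g}.
  by rewrite add0r; apply: derivable_ccont; apply: dg; exact: expi_neq0.
have cm a b : cts_on a b (fun y => modulus (g (expi x y))).
  have := @circle_cts_modulus _ g 0 x a b cg; congr cts_on.
  by apply/funext => y; rewrite add0r.
rewrite integral_uniform//=; last 2 first.
- apply/measurable_EFinP; apply: continuous_measurable_fun => y.
  apply/(@cvgrPdist_le _ R^o) => e e0.
  have [d d0 H] := @circle_cts _ g 0 x cg y e e0.
  apply/nbhs_ballP; exists d => // y' yy'; rewrite /ball/= distrC in yy'.
  by rewrite distrC (le_trans (modulus_dist _ _))//; have := H _ yy'; rewrite !add0r.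
- by move=> y; rewrite lee_fin modulus_ge0.
rewrite subr0 EFinM; congr (_ * _)%E; rewrite /itg /Rintegral fineK//.
exact: (integrable_fin_num _ (cts_on_integrable (cm 0 (2 * pi)))).
Qed.

Lemma mean_slice (g : C -> C) (x y : R) : (forall w, w != 0 -> derivable g w 1) ->
  measurable_fun setT (fun ab : Rm * Rm => modulus (g (expi ((ab.1 : R) / 2) ab.2))) ->
  ((modulus (g (expi (x / 2) y)))%:E <= 4%:E * \int[leb]_a \int[unif]_b
    ((window x a)%:E * (modulus (g (expi ((a : R) / 2) b)))%:E))%E.
Proof.
move=> dg mg; have pp := pi_gt0 R.
pose G := modulus (g (expi (x / 2) y)).
have G0 : 0 <= G by exact: modulus_ge0.
pose A a := (2 * pi)^-1 * itg (fun y => modulus (g (expi (a / 2) y))) 0 (2 * pi).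
have GA a1 a2 : x + 2 <= a1 -> a2 <= x - 2 -> G <= 4 * (A a1 + A a2).
  move=> h1 h2; have := @annulus_bound _ (x / 2) y g (a1 / 2) (a2 / 2) dg.
  have h1' : x / 2 + 1 <= a1 / 2 by lra.
  have h2' : a2 / 2 <= x / 2 - 1 by lra.
  move=> /(_ h1' h2'); rewrite -ler_pdivlMl// => H; apply: (le_trans H).
  have E (P s : R) : 0 < P -> P^-1 * (2 * s) = 4 * ((2 * P)^-1 * s).
    by move=> P0; field; rewrite gt_eqF.
  by rewrite /A -mulrDr E.
have mF : measurable_fun setT (fun ab : Rm * Rm =>
    ((window x ab.1)%:E * (modulus (g (expi ((ab.1 : R) / 2) ab.2)))%:E)%E).
  apply: emeasurable_funM; apply/measurable_EFinP => //.
  exact: (measurableT_comp (measurable_window x) measurable_fst).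
have F0 (ab : Rm * Rm) : (0 <= (window x ab.1)%:E * (modulus (g (expi ((ab.1 : R) / 2) ab.2)))%:E)%E.
  by rewrite mule_ge0// lee_fin ?window_ge0 ?modulus_ge0.
have key (u v : R) : v - u = 2 -> (forall a, u <= a <= v -> G / 8 <= A a /\ `|a - x| <= 4) ->
    (G%:E <= 4%:E * \int[leb]_a \int[unif]_b
    ((window x a)%:E * (modulus (g (expi ((a : R) / 2) b)))%:E))%E.
  move=> uv H.
  have : (\int[leb]_(a in `[u, v]) (G / 8)%:E <= \int[leb]_(a in `[u, v]) \int[unif]_b
    ((window x a)%:E * (modulus (g (expi ((a : R) / 2) b)))%:E))%E.
    apply: ge0_le_integral => //.
    - by move=> a _; rewrite lee_fin divr_ge0.
    - apply: measurable_funTS.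
      exact: (@measurable_fun_fubini_tonelli_F _ _ _ _ _ unif _ mF F0).
    - move=> a; rewrite /= in_itv/= => /H[h1 h2].
      have -> : window x a = 1 by rewrite /window h2.
      rewrite (eq_integral (fun b : Rm => (modulus (g (expi (a / 2) b)))%:E)).
        by rewrite circle_mean// lee_fin.
      by move=> b _; rewrite mul1e.
  rewrite integral_cst//= lebesgue_measure_itv/= lte_fin.
  rewrite ifT; last by rewrite -subr_gt0 uv.
  rewrite -EFinB uv -EFinM => K.
  have {}K : ((G / 4)%:E <= \int[leb]_a \int[unif]_b
    ((window x a)%:E * (modulus (g (expi ((a : R) / 2) b)))%:E))%E.
    apply: (@le_trans _ _ (G / 8 * 2)%:E); first by rewrite lee_fin; lra.
    apply: (le_trans K); apply: ge0_subset_integral => //.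
    - exact: (@measurable_fun_fubini_tonelli_F _ _ _ _ _ unif _ mF F0).
    - by move=> a _; apply: integral_ge0 => b _; exact: (F0 (a, b)).
  have -> : G%:E = (4%:E * (G / 4)%:E)%E by rewrite -EFinM; congr EFin; field.
  by apply: lee_wpmul2l.
have [h|] := pselect (forall a, x + 2 <= a <= x + 4 -> G / 8 <= A a).
  apply: (key (x + 2) (x + 4)); first ring.
  move=> a xa; split; first exact: h.
  by rewrite ler_norml; apply/andP; split; move: xa => /andP[? ?]; lra.
move=> /existsNP[a1 /not_implyP[/andP[h1 h1'] /negP]]; rewrite -ltNge => h2.
apply: (key (x - 4) (x - 2)); first ring.
move=> a /andP[h3 h4]; split; last by rewrite ler_norml; apply/andP; split; lra.
have L (u v w : R) : u <= 4 * (v + w) -> v < u / 8 -> u / 8 <= w by lra.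
exact: (L _ _ _ (GA a1 a h1 h4) h2).
Qed.

End torus_integral.

Section bergman_bound.
Context (R : realType) (n : nat).
Local Notation C := (cplx R).
Local Notation Rm := (measurableTypeR R).
Local Notation unif := ([the {sigma_finite_measure set (measurableTypeR R) -> \bar R}
  of uniform_prob (@two_pi_gt0 R)]).
Local Notation leb := (@lebesgue_measure R).
Implicit Types (f : 'rV[C]_n -> C) (x th : 'rV[R]_n).

Lemma row_ctsP (phi : 'rV[R]_n -> R) x : {for x, continuous phi} ->
  forall e, 0 < e -> exists2 d : R, 0 < d & forall x' : 'rV[R]_n,
    (forall i, `|x' 0 i - x 0 i| < d) -> `|phi x' - phi x| <= e.
Proof.
move=> /cvgrPdist_le H e /H /nbhs_ballP[d /= d0 G]; exists d => // x' xx'.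
rewrite distrC; apply: G; split=> // i j; rewrite (ord1 i) /ball/= distrC; exact: xx'.
Qed.

Lemma unif_mass m (r : \bar R) : (\int[power_measure unif m]_s cst r s = r)%E.
Proof.
have E k : (\int[power_measure unif k]_s cst 1 s = 1)%E.
  elim: k => [|k IH]; first by rewrite integral_cst// mul1e; exact: diracT.
  rewrite ge0_integral_power//.
  rewrite (eq_integral (cst 1%E)); last by move=> a _; exact: IH.
  by rewrite integral_cst// mul1e; exact: probability_setT.
rewrite integral_cst// -[RHS]mule1; congr (_ * _)%E.
by rewrite -(E m) integral_cst// mul1e.
Qed.

Lemma window_mass m (t : m.-tuple Rm) :
  (\int[power_measure leb m]_t' (Jprod (@window R) t t')%:E = (8 ^+ m)%:E)%E.
Proof.
elim: m t => [|m IH] t.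
  rewrite (_ : (fun t' => _) = cst 1%E); last first.
    by apply/funext => t'; rewrite /Jprod big_ord0.
  by rewrite integral_cst// mul1e; exact: diracT.
have [a [t0 ->]] := tuple_cons t.
rewrite ge0_integral_power; last 2 first.
- by apply/measurable_EFinP; apply: measurable_Jprod; exact: measurable_window.
- by move=> t'; rewrite lee_fin Jprod_ge0// => *; exact: window_ge0.
rewrite (eq_integral (fun b : Rm => (window a b)%:E * (8 ^+ m)%:E)%E); last first.
  move=> b _; rewrite -(IH t0) -ge0_integralZl//; last 3 first.
  - by apply/measurable_EFinP; apply: measurable_Jprod; exact: measurable_window.
  - by move=> t' _; rewrite lee_fin Jprod_ge0// => *; exact: window_ge0.
  - by rewrite lee_fin window_ge0.
  by apply: eq_integral => t' _; rewrite JprodS.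
rewrite ge0_integralZr//; last 2 first.
- by apply/measurable_EFinP; exact: measurable_window.
- by move=> b _; rewrite lee_fin window_ge0.
rewrite exprS EFinM; congr (_ * _)%E.
rewrite (_ : (fun b => _) = EFin \o \1_(`[(a : R) - 4, (a : R) + 4]%classic : set Rm)); last first.
  by apply/funext => b /=; rewrite /window indicE mem_setE in_itv/= ler_distl; case: ifP.
rewrite integral_indic// setIT.
rewrite [LHS](lebesgue_measure_itv `[(a : R) - 4, (a : R) + 4]) /= lte_fin ifT; last by lra.
by rewrite -EFinB; congr EFin; ring.
Qed.

Lemma differentiable_pull_measurable f : (forall z, torus z -> differentiable f z) ->
  measurable_fun setT (fun p => modulus (pull f p)).
Proof.
move=> df; apply: continuous_measurable_rows => x th e e0.
have [d d0 H] := pull_cts (df _ (@torus_torus_point R n x th)) e0.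
by exists d => // x' th' /H; apply: le_trans; exact: modulus_dist.
Qed.

Lemma measurable_setnth (t : n.-tuple Rm) (i : 'I_n) :
  measurable_fun setT (fun a : Rm => setnth t i a).
Proof.
apply/measurable_fun_tnthP => j; case ji : (j == i).
  have : measurable_fun setT (fun a : Rm => a) by exact: measurable_id.
  by congr (measurable_fun _ _); apply/funext => a; rewrite /= tnth_mktuple ji.
have : measurable_fun setT (fun a : Rm => tnth t j) by exact: measurable_cst.
by congr (measurable_fun _ _); apply/funext => a; rewrite /= tnth_mktuple ji.
Qed.

Lemma iterated_mean_value f x th : (forall z, torus z -> differentiable f z) ->
  ((modulus (pull f (x, th)))%:E <= (4 ^+ n)%:E *
    \int[power_measure leb n]_t' \int[power_measure unif n]_s'
     ((Jprod (@window R) (tuple_of_row x) t')%:E *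
      (modulus (pull f (row_of_tuple t', row_of_tuple s')))%:E))%E.
Proof.
move=> df; pose G (p : n.-tuple Rm * n.-tuple Rm) : \bar R :=
  (modulus (pull f (row_of_tuple p.1, row_of_tuple p.2)))%:E.
have mp : measurable_fun setT (fun p : n.-tuple Rm * n.-tuple Rm =>
    (row_of_tuple p.1, row_of_tuple p.2)).
  apply/measurable_fun_pairP; split => /=.
    exact: (measurableT_comp (@measurable_row_of_tuple R n) measurable_fst).
  exact: (measurableT_comp (@measurable_row_of_tuple R n) measurable_snd).
have mG : measurable_fun setT G.
  by apply/measurable_EFinP; exact: (measurableT_comp (differentiable_pull_measurable df) mp).
have G0 p : (0 <= G p)%E by rewrite lee_fin modulus_ge0.
have := @slice_bound _ Rm R leb unif (@window R) (@window_ge0 R) (@measurable_window R)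
  n G 4 (ler0n _ _) mG G0.
have E : G (tuple_of_row x, tuple_of_row th) = (modulus (pull f (x, th)))%:E.
  by rewrite /G /= !tuple_of_rowK.
rewrite -E; apply => t s i.
pose z := torus_point (row_of_tuple t) (row_of_tuple s).
have zE a b : setc z i (expi (a / 2) b) =
    torus_point (row_of_tuple (setnth t i a)) (row_of_tuple (setnth s i b)).
  apply/rowP => j; rewrite mxE !torus_pointE !mxE !tnth_mktuple.
  by case: ifP => // _; rewrite ?mxE.
have tz : torus z by exact: torus_torus_point.
have := @mean_slice R (fun w => f (setc z i w)) (tnth t i) (tnth s i).
rewrite /G /pull /=.
have -> : expi ((tnth t i : R) / 2) (tnth s i) = z 0 i by rewrite torus_pointE !mxE.
rewrite setc_id -/z => K.
rewrite (eq_integral (fun a : Rm => \int[unif]_b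
    ((window (tnth t i) a)%:E * (modulus (f (setc z i (expi ((a : R) / 2) b))))%:E))%E); last first.
  by move=> a _; apply: eq_integral => b _; rewrite zE.
apply: K => [w w0|].
  by apply: setc_derivable; apply: df; exact: torus_setc.
have ms : measurable_fun setT (fun ab : Rm * Rm => (setnth t i ab.1, setnth s i ab.2)).
  apply/measurable_fun_pairP; split => /=.
    exact: (measurableT_comp (measurable_setnth t i) measurable_fst).
  exact: (measurableT_comp (measurable_setnth s i) measurable_snd).
have := measurableT_comp mG ms; move=> /measurable_EFinP; congr (measurable_fun _ _).
by apply/funext => ab; rewrite /= zE.
Qed.

End bergman_bound.

Section hk_bound.
Context (R : realType) (n : nat) (K : set 'rV[R]_n) (phi : 'rV[R]_n -> R).
Local Notation C := (cplx R).
Local Notation Rm := (measurableTypeR R).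
Local Notation unif := ([the {sigma_finite_measure set (measurableTypeR R) -> \bar R}
  of uniform_prob (@two_pi_gt0 R)]).
Local Notation leb := (@lebesgue_measure R).
Hypothesis phi_cts : continuous phi.
Variable osc : R.
Hypothesis phi_osc : forall x x' : 'rV[R]_n, (forall i, `|x' 0 i - x 0 i| <= 4) ->
  phi x' <= support_fun K x + osc.
Implicit Types (f : 'rV[C]_n -> C) (x th : 'rV[R]_n) (k : nat).

Lemma measurable_weight k : measurable_fun setT (@weight R n phi k).
Proof.
apply: measurableT_comp; first exact: measurable_expR.
rewrite (_ : (fun p => _) = fun p => (- k%:R) * phi p.1); last first.
  by apply/funext => p; rewrite mulNr.
apply: measurable_funM => //.
apply: continuous_measurable_rows => x th e e0.
have [d d0 H] := row_ctsP (@phi_cts x) e0.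
by exists d => // x' th' xx'; apply: H => i; have [] := xx' i.
Qed.

Lemma weight_gt0 k p : 0 < @weight R n phi k p. Proof. exact: expR_gt0. Qed.

Lemma measurable_sq f k : (forall z, torus z -> differentiable f z) ->
  measurable_fun setT (fun p => (modulus (pull f p) ^+ 2 * weight phi k p)%:E).
Proof.
move=> df; apply/measurable_EFinP; apply: measurable_funM; last exact: measurable_weight.
by apply: measurable_funX; exact: differentiable_pull_measurable.
Qed.

Lemma sqnorm_ge0 f k : (0 <= sqnorm phi k f)%E.
Proof.
by apply: integral_ge0 => p _; rewrite lee_fin mulr_ge0 ?exprn_ge0 ?modulus_ge0// ltW// weight_gt0.
Qed.

Lemma sqnorm_fineK f k : Hk phi k f -> (fine (sqnorm phi k f))%:E = sqnorm phi k f.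
Proof. by move=> [_ _ fin]; rewrite fineK// ge0_fin_numE ?sqnorm_ge0. Qed.

Lemma Hk_pointwise_bound k : exists2 A : R, 0 < A &
  forall f, Hk phi k f -> forall x th la, 0 < la ->
    modulus (pull f (x, th)) <=
      A * (la + expR (k%:R * support_fun K x) * fine (sqnorm phi k f) / la).
Proof.
pose A := 4 ^+ n * (8 ^+ n + expR (k%:R * osc)) : R.
have A0 : 0 < A by rewrite mulr_gt0 ?exprn_gt0// addr_gt0 ?exprn_gt0// expR_gt0.
exists A => // f Hf x th la la0; have [df f0 fin] := Hf.
have dft z : torus z -> differentiable f z by exact: df.
have S0 : 0 <= fine (sqnorm phi k f) by rewrite fine_ge0// sqnorm_ge0.
pose S := fine (sqnorm phi k f).
pose E := expR (k%:R * support_fun K x).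
have E0 : 0 < E by exact: expR_gt0.
pose E' := expR (k%:R * (support_fun K x + osc)).
have E'E : E' = E * expR (k%:R * osc) by rewrite /E' mulrDr expRD.
pose t := tuple_of_row x.
pose P := power_measure leb n; pose Q := power_measure unif n.
pose J (z : n.-tuple Rm * n.-tuple Rm) : R := Jprod (@window R) t z.1.
pose G (z : n.-tuple Rm * n.-tuple Rm) : R := modulus (pull f (row_of_tuple z.1, row_of_tuple z.2)).
pose W (z : n.-tuple Rm * n.-tuple Rm) : R :=
  G z ^+ 2 * weight phi k (row_of_tuple z.1, row_of_tuple z.2).
have J0 z : 0 <= J z by apply: Jprod_ge0 => *; exact: window_ge0.
have G0 z : 0 <= G z by exact: modulus_ge0.
have W0 z : 0 <= W z by rewrite mulr_ge0 ?exprn_ge0// ltW// weight_gt0.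
have mp : measurable_fun setT (fun p : n.-tuple Rm * n.-tuple Rm =>
    (row_of_tuple p.1, row_of_tuple p.2)).
  apply/measurable_fun_pairP; split => /=.
    exact: (measurableT_comp (@measurable_row_of_tuple R n) measurable_fst).
  exact: (measurableT_comp (@measurable_row_of_tuple R n) measurable_snd).
have mJ : measurable_fun setT J.
  exact: (measurableT_comp (measurable_Jprod (@measurable_window R) t) measurable_fst).
have mG : measurable_fun setT G.
  exact: (measurableT_comp (differentiable_pull_measurable dft) mp).
have mW : measurable_fun setT W.
  apply: measurable_funM; first exact: measurable_funX.
  exact: (measurableT_comp (@measurable_weight k) mp).
have pw z : J z * G z <= la * J z + E' / la * W z.
  have [Jz|] := pselect (J z = 0).
    rewrite Jz mul0r mulr0 add0r mulr_ge0// divr_ge0 ?ltW//; exact: expR_gt0.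
  move=> /eqP; rewrite /J /Jprod => /prodf_neq0 nJ.
  have win i : `|(tnth z.1 i : R) - x 0 i| <= 4.
    by have := nJ i isT; rewrite /window /t tnth_mktuple; case: ifP => //; rewrite eqxx.
  have J1 : J z <= 1.
    apply: prodr_ile1 => i _; rewrite window_ge0; exact: window_le1.
  have ph : phi (row_of_tuple z.1) <= support_fun K x + osc.
    by apply: phi_osc => i; rewrite mxE; exact: win.
  have EW : 1 <= E' * weight phi k (row_of_tuple z.1, row_of_tuple z.2).
    rewrite /E' /weight -expRD -[leLHS]expR0 ler_expR /= -mulrBr mulr_ge0// subr_ge0//.
  have GG : G z <= la + G z ^+ 2 / la.
    rewrite -(ler_pM2r la0) mulrDl divfK ?gt_eqF//.
    have := sqr_ge0 (G z - la); rewrite sqrrB.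
    have := mulr_ge0 (G0 z) (ltW la0); have := sqr_ge0 (G z); rewrite -expr2.
    have := sqr_ge0 la; rewrite mulr2n; lra.
  have GW : G z ^+ 2 / la <= E' / la * W z.
    rewrite /W; have -> : E' / la * (G z ^+ 2 * weight phi k (row_of_tuple z.1, row_of_tuple z.2)) =
      G z ^+ 2 / la * (E' * weight phi k (row_of_tuple z.1, row_of_tuple z.2)) by ring.
    by rewrite ler_peMr// divr_ge0// ?sqr_ge0// ltW.
  have GJ : J z * (G z ^+ 2 / la) <= G z ^+ 2 / la.
    by rewrite ler_piMl// divr_ge0 ?sqr_ge0// ltW.
  rewrite (le_trans (ler_wpM2l (J0 z) GG))// mulrDr [J z * la]mulrC lerD2l.
  exact: le_trans GW.
have mJE : measurable_fun setT (EFin \o J) by apply/measurable_EFinP.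
have mWE : measurable_fun setT (EFin \o W) by apply/measurable_EFinP.
have := iterated_mean_value x th dft.
have -> : (\int[power_measure leb n]_t' \int[power_measure unif n]_s'
     ((Jprod (@window R) (tuple_of_row x) t')%:E *
      (modulus (pull f (row_of_tuple t', row_of_tuple s')))%:E) =
   \int[sf_product P Q]_z (J z * G z)%:E)%E.
  rewrite ge0_integral_sf_product//.
    by apply/measurable_EFinP; exact: measurable_funM.
  by move=> z; rewrite lee_fin mulr_ge0.
move=> H.
have I1 : (\int[sf_product P Q]_z (J z)%:E = (8 ^+ n)%:E)%E.
  rewrite ge0_integral_sf_product//.
  rewrite -(window_mass t); apply: eq_integral => t' _.
  exact: (@unif_mass R n (Jprod (@window R) t t')%:E).
have I2 : (\int[sf_product P Q]_z (W z)%:E = S%:E)%E.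
  rewrite /S sqnorm_fineK// /sqnorm ge0_integral_nu//.
  - by rewrite ge0_integral_sf_product// => z; rewrite lee_fin.
  - exact: measurable_sq.
  - by move=> p; rewrite lee_fin mulr_ge0 ?exprn_ge0 ?modulus_ge0// ltW// weight_gt0.
have El0 : 0 <= E' / la by rewrite divr_ge0 ?ltW//; exact: expR_gt0.
have I3 : (\int[sf_product P Q]_z (J z * G z)%:E <= (la * 8 ^+ n + E' / la * S)%:E)%E.
  apply: (@le_trans _ _ (\int[sf_product P Q]_z (la%:E * (J z)%:E + (E' / la)%:E * (W z)%:E))%E).
    apply: ge0_le_integral => //.
    - by move=> z _; rewrite lee_fin mulr_ge0.
    - by apply/measurable_EFinP; exact: measurable_funM.
    - by apply: emeasurable_funD; apply: emeasurable_funM => //.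
    - by move=> z _; rewrite -!EFinM -EFinD lee_fin.
  rewrite ge0_integralD//; last 4 first.
  - by move=> z _; rewrite mule_ge0// lee_fin// ltW.
  - exact: emeasurable_funM.
  - by move=> z _; rewrite mule_ge0// lee_fin.
  - exact: emeasurable_funM.
  rewrite ge0_integralZl//; last 2 first.
  - by move=> z _; rewrite lee_fin.
  - by rewrite lee_fin ltW.
  rewrite ge0_integralZl//; last by move=> z _; rewrite lee_fin.
  by rewrite I1 I2 -!EFinM -EFinD.
have : ((modulus (pull f (x, th)))%:E <= (4 ^+ n)%:E * (la * 8 ^+ n + E' / la * S)%:E)%E.
  by rewrite (le_trans H)// lee_wpmul2l// lee_fin exprn_ge0.
rewrite -EFinM lee_fin => /le_trans; apply.
rewrite /A -[leRHS]mulrA ler_wpM2l ?exprn_ge0// -/S -/E E'E mulrDl.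
have eo : 0 < expR (k%:R * osc) by exact: expR_gt0.
have n8 : 0 < (8 : R) ^+ n by rewrite exprn_gt0.
have ES0 : 0 <= E * S / la by rewrite divr_ge0 ?mulr_ge0// ltW.
rewrite !mulrDr [la * 8 ^+ n]mulrC.
have -> : E * expR (k%:R * osc) / la * S = expR (k%:R * osc) * (E * S / la) by ring.
have := mulr_ge0 (ltW n8) ES0; have := mulr_ge0 (ltW eo) (ltW la0); lra.
Qed.

End hk_bound.

Section laurent_interpolation.
Context (R : realType).
Local Notation C := (cplx R).

Definition node (l : nat) : C := l.+1%:R.

Lemma node_neq0 l : node l != 0. Proof. by rewrite /node pnatr_eq0. Qed.

Lemma node_inj : injective node.
Proof. by move=> i j /eqP; rewrite /node eqr_nat => /eqP[]. Qed.

Definition lagrange N (l : 'I_N) : {poly C} :=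
  \prod_(j < N | j != l) ((node l - node j)^-1 *: ('X - (node j)%:P)).

Lemma size_lagrange N (l : 'I_N) : (size (lagrange l) <= N)%N.
Proof.
rewrite /lagrange (leq_trans (size_poly_prod_leq _ _))//.
have le2 i : (size ((node l - node i)^-1 *: ('X - (node i)%:P)) <= 2)%N.
  by rewrite (leq_trans (size_scale_leq _ _))// size_XsubC.
have : (\sum_(i < N | i != l) size ((node l - node i)^-1 *: ('X - (node i)%:P))
    <= \sum_(i < N | i != l) 2)%N by apply: leq_sum => i _; exact: le2.
have cP : #|[pred i : 'I_N | i != l]| = N.-1 by rewrite cardC1 card_ord.
rewrite sum_nat_const [X in (_ <= X * _)%N]cP => H.
rewrite [X in (_ - X <= _)%N](_ : _ = N.-1); last by rewrite -cP; apply: eq_card.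
have N0 : (0 < N)%N by case: (l) => m /=; exact: leq_ltn_trans.
rewrite leq_subLR (leq_trans (n := (N.-1 * 2).+1))//; lia.
Qed.

Lemma lagrange_node N (l i : 'I_N) : (lagrange l).[node i] = (i == l)%:R.
Proof.
rewrite /lagrange horner_prod; have [->|il] := eqVneq i l.
  rewrite big1// => j jl; rewrite !hornerE mulVf// subr_eq0.
  by apply: contra_neq jl => /node_inj/val_inj.
by rewrite (bigD1 i)//= !hornerE subrr mulr0 mul0r.
Qed.

Lemma interpolation N (p : {poly C}) : (size p <= N)%N ->
  p = \sum_(l < N) p.[node l] *: lagrange l.
Proof.
move=> sp; apply/eqP; rewrite -subr_eq0; apply/eqP.
apply: (@roots_geq_poly_eq0 _ _ [seq node (val i) | i <- enum 'I_N]).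
- apply/allP => _ /mapP[i _ ->]; rewrite /root !hornerE horner_sum (bigD1 i)//=.
  rewrite hornerZ lagrange_node eqxx mulr1 big1 ?addr0 ?subrr// => j ji.
  by rewrite hornerZ lagrange_node eq_sym (negPf ji) mulr0.
- by rewrite map_inj_uniq ?enum_uniq// => i j /node_inj/val_inj.
- rewrite size_map size_enum_ord (leq_trans (size_polyD _ _))// geq_max sp size_polyN.
  apply: (leq_trans (size_sum _ _ _)); apply/bigmax_leqP => i _.
  by rewrite (leq_trans (size_scale_leq _ _))// size_lagrange.
Qed.

(* a Laurent function on C^* of growth D is determined by 2D+2 values *)
Lemma laurent_formula D (g : C -> C) (A : R) :
  (forall z, z != 0 -> derivable g z 1) ->
  (forall z, z != 0 -> modulus (g z) <= A * (modulus z ^+ D + modulus z ^- D)) ->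
  forall z, z != 0 -> g z = \sum_(l < (2 * D).+2) \sum_(e < (2 * D).+2)
    (node l ^+ D.+1 * (lagrange l)`_e) * g (node l) * z ^ (e%:Z - D.+1%:Z).
Proof.
move=> dg gA z z0; have [p sp hp] := laurent_growth dg gA.
have -> : g z = p.[z] / z ^+ D.+1 by rewrite -hp// mulrC mulKf// expf_neq0.
rewrite [in LHS](interpolation sp) horner_sum mulr_suml; apply: eq_bigr => l _.
rewrite hornerZ (horner_coef_wide z (size_lagrange l)) mulr_sumr mulr_suml.
apply: eq_bigr => e _; rewrite -hp ?node_neq0//.
by rewrite expfzDr// -exprnN -exprnP; ring.
Qed.

End laurent_interpolation.

Section laurent_polynomials.
Context (R : realType) (n : nat).
Local Notation C := (cplx R).
Implicit Types (f : 'rV[C]_n -> C) (z : 'rV[C]_n) (x th : 'rV[R]_n) (m : 'rV[int]_n).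

Lemma monomialE m z : torus z -> monomial m z = \prod_(i < n) z 0 i ^ m 0 i.
Proof. by move=> tz; rewrite /monomial; case: asboolP. Qed.

Lemma monomial_out m z : ~ torus z -> monomial m z = 0 :> C.
Proof. by move=> tz; rewrite /monomial; case: asboolP. Qed.

Lemma monomialD m m' z : torus z -> monomial (m + m') z = monomial m z * monomial m' z.
Proof.
move=> tz; rewrite !monomialE// -big_split/=; apply: eq_bigr => i _.
by rewrite mxE expfzDr//; exact: tz.
Qed.

Lemma torus_polar z : torus z -> exists x th, z = torus_point x th.
Proof.
move=> tz; have /choice[g Hg] : forall i, exists p : R * R, z 0 i = expi (p.1 / 2) p.2.
  move=> i; have [x [y [-> _ _]]] := polar (tz i).
  by exists (2 * x, y); rewrite /= mulrAC divff// mul1r.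
exists (\row_i (g i).1), (\row_i (g i).2).
by apply/rowP => i; rewrite torus_pointE !mxE.
Qed.

Lemma setc_torus_point x th i (x' y' : R) : setc (torus_point x th) i (expi (x' / 2) y') =
  torus_point (\row_j (if j == i then x' else x 0 j)) (\row_j (if j == i then y' else th 0 j)).
Proof.
by apply/rowP => j; rewrite mxE !torus_pointE !mxE; case: ifP.
Qed.

Definition mix r (nu z : 'rV[C]_n) : 'rV[C]_n :=
  \row_j (if (j < r)%N then nu 0 j else z 0 j).

Lemma torus_mix r nu z : torus nu -> torus z -> torus (mix r nu z).
Proof. by move=> tn tz j; rewrite mxE; case: ifP. Qed.

Lemma separate_laurent f (A : R) (D : nat) : (forall z, torus z -> differentiable f z) ->
  (forall x th, modulus (pull f (x, th)) <= A * expR (D%:R / 2 * \sum_i `|x 0 i|)) ->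
  exists (T : finType) (nu : T -> 'rV[C]_n) (m : T -> 'rV[int]_n) (c : T -> C),
  forall z, torus z -> f z = \sum_t c t * monomial (m t) z.
Proof.
move=> df fA.
have A0 : 0 <= A.
  have := le_trans (modulus_ge0 _) (fA 0 0).
  by rewrite pmulr_lge0// expR_gt0.
have step z i : torus z -> exists B, forall w, w != 0 ->
    modulus (f (setc z i w)) <= B * (modulus w ^+ D + modulus w ^- D).
  move=> tz; have [x [th zE]] := torus_polar tz.
  exists (A * expR (D%:R / 2 * \sum_(j | j != i) `|x 0 j|)) => w /polar[u [v [-> _ _]]].
  have -> : u = (2 * u) / 2 by rewrite mulrAC divff// mul1r.
  rewrite zE setc_torus_point.
  apply: (le_trans (fA _ _)); rewrite -[leRHS]mulrA ler_wpM2l//.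
  set S := \sum_(j | j != i) _.
  have -> : D%:R / 2 * \sum_j `|(\row_j (if j == i then 2 * u else x 0 j)) 0 j| =
      D%:R / 2 * S + D%:R / 2 * `|2 * u|.
    rewrite (bigD1 i)//= mxE eqxx mulrDr addrC; congr (_ * _ + _).
    by apply: eq_bigr => j /negPf ji; rewrite mxE ji.
  rewrite expRD ler_wpM2l ?expR_ge0// modulus_expi.
  have -> : 2 * u / 2 = u by field.
  have -> : D%:R / 2 * `|2 * u| = D%:R * `|u| by rewrite normrM ger0_norm//; field.
  rewrite -[expR u ^+ D]expRM_natl -expRN.
  have [u0|u0] := leP 0 u; first by rewrite ger0_norm// lerDl expR_ge0.
  by rewrite ltr0_norm// mulrN lerDr expR_ge0.
have partial_expansion r : (r <= n)%N -> exists (T : finType) (nu : T -> 'rV[C]_n) (m : T -> 'rV[int]_n) (c : T -> C),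
    (forall t, torus (nu t)) /\ forall z, torus z ->
      f z = \sum_t c t * f (mix r (nu t) z) * monomial (m t) z.
  elim: r => [_|r IH rn].
    exists unit, (fun=> const_mx 1), (fun=> 0), (fun=> 1); split.
      by move=> _ i; rewrite mxE oner_neq0.
    move=> z tz; rewrite (big_pred1 tt); last by case.
    rewrite mul1r monomialE// big1 ?mulr1; last by move=> i _; rewrite mxE expr0z.
    by congr f; apply/rowP => j; rewrite mxE.
  have [T [nu [m [c [tnu H]]]]] := IH (ltnW rn).
  pose i := Ordinal rn; pose N := (2 * D).+2.
  exists (T * ('I_N * 'I_N))%type, (fun t : T * ('I_N * 'I_N) => setc (nu t.1) i (node R t.2.1)),
    (fun t : T * ('I_N * 'I_N) => m t.1 + (t.2.2%:Z - D.+1%:Z) *: delta_mx 0 i),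
    (fun t : T * ('I_N * 'I_N) => c t.1 * (node R t.2.1 ^+ D.+1 * (lagrange R t.2.1)`_t.2.2)); split.
    by move=> t; apply: torus_setc => //; exact: node_neq0.
  have sum3 (G : T * ('I_N * 'I_N) -> C) : \sum_p G p = \sum_t \sum_l \sum_e G (t, (l, e)).
    under [in RHS]eq_bigr do rewrite pair_bigA.
    by rewrite pair_bigA; apply: eq_bigr => -[t [l e]].
  move=> z tz; rewrite H// sum3; apply: eq_bigr => t _.
  have tm : torus (mix r (nu t) z) by exact: torus_mix.
  have [B hB] := step _ i tm.
  have -> : f (mix r (nu t) z) = f (setc (mix r (nu t) z) i (z 0 i)).
    congr f; rewrite -[in LHS](setc_id (mix r (nu t) z) i).
    by rewrite /mix [X in setc _ _ X]mxE ltnn.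
  have dg w : w != 0 -> derivable (fun w => f (setc (mix r (nu t) z) i w)) w 1.
    by move=> w0; apply: setc_derivable; apply: df; exact: torus_setc.
  have /= -> := laurent_formula dg hB (tz i).
  rewrite mulr_sumr mulr_suml; apply: eq_bigr => l _.
  rewrite mulr_sumr mulr_suml; apply: eq_bigr => e _.
  have -> : setc (mix r (nu t) z) i (node R l) = mix r.+1 (setc (nu t) i (node R l)) z.
    apply/rowP => j; rewrite !mxE ltnS.
    have [->|ji] := eqVneq j i; first by rewrite leqnn.
    by rewrite -val_eqE/= in ji; rewrite [in RHS]leq_eqVlt (negPf ji).
  rewrite monomialD//.
  have -> : monomial ((e%:Z - D.+1%:Z) *: delta_mx 0 i) z = z 0 i ^ (e%:Z - D.+1%:Z).
    rewrite monomialE// (bigD1 i)//= big1 => [|j ji].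
      by rewrite !mxE !eqxx mulr1 mulr1.
    by rewrite !mxE (negPf ji) andbF mulr0 expr0z.
  ring.
have [T [nu [m [c [tnu H]]]]] := partial_expansion n (leqnn n).
exists T, nu, m, (fun t => c t * f (nu t)) => z tz; rewrite H//.
by apply: eq_bigr => t _; congr (_ * f _ * _); apply/rowP => j; rewrite mxE ltn_ord.
Qed.

Definition laurent_on (M : seq 'rV[int]_n) (a : 'rV[int]_n -> C) f :=
  forall z, torus z -> f z = \sum_(m <- M) a m * monomial m z.

Lemma collect_laurent (T : finType) (m : T -> 'rV[int]_n) (c : T -> C) f :
  (forall z, torus z -> f z = \sum_t c t * monomial (m t) z) ->
  laurent_on (undup [seq m t | t <- enum T]) (fun k => \sum_(t | m t == k) c t) f.
Proof.
move=> H z tz; rewrite H//.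
under [in RHS]eq_bigr do rewrite mulr_suml big_mkcond.
rewrite exchange_big/=; apply: eq_bigr => t _.
rewrite (bigD1_seq (m t)) ?undup_uniq//=; last first.
  by rewrite mem_undup; apply: map_f; rewrite mem_enum.
by rewrite eqxx big1 ?addr0// => k kt; rewrite eq_sym (negPf kt).
Qed.

Lemma expiX (x y : R) k : expi x y ^+ k = expi (k%:R * x) (k%:R * y) :> C.
Proof.
elim: k => [|k IH]; first by rewrite expr0 !mul0r expi0.
by rewrite exprS IH -expiD -[k.+1]addn1 natrD !mulrDl !mul1r ![_ + x]addrC ![_ + y]addrC.
Qed.

Lemma expiV (x y : R) : (expi x y)^-1 = expi (- x) (- y) :> C.
Proof.
apply: (@mulfI _ (expi x y)); first exact: expi_neq0.
by rewrite mulfV ?expi_neq0// -expiD !subrr expi0.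
Qed.

Lemma expiXz (x y : R) (k : int) : expi x y ^ k = expi (k%:~R * x) (k%:~R * y) :> C.
Proof.
case: k => k; first by rewrite -exprnP expiX.
by rewrite NegzE -exprnN expiX expiV !mulrNz !mulNr.
Qed.

Lemma expi_eq1 (t : R) : 0 < t < 2 * pi -> expi 0 t != 1.
Proof.
move=> /andP[t0 t2]; apply/eqP => /(congr1 (@complex.Re R)) /=.
rewrite expR0 mul1r => ct.
have s0 : 0 < sin (t / 2) by apply: sin_gt0_pi; apply/andP; split; lra.
have : cos t = 1 - 2 * sin (t / 2) ^+ 2.
  rewrite [in LHS](_ : t = t / 2 + t / 2); last by rewrite -splitr.
  by rewrite cosD -!expr2 cos2sin2; ring.
by rewrite ct => /eqP; rewrite eq_sym subr_eq addrC -subr_eq subrr eq_sym mulf_eq0 pnatr_eq0/= sqrf_eq0 gt_eqF.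
Qed.

Lemma root_of_unity_sum (N : nat) (d : int) : (`|d| < N)%N ->
  \sum_(j < N) expi 0 (d%:~R * (2 * pi * j%:R / N%:R)) = (if d == 0 then N%:R else 0) :> C.
Proof.
move=> dN; have N0 : (0 < N)%N by exact: leq_ltn_trans dN.
have NR : (0 : R) < N%:R by rewrite ltr0n.
have [->|d0] := eqVneq d 0.
  under eq_bigr do rewrite mul0r expi0.
  by rewrite sumr_const card_ord.
have pp := pi_gt0 R.
pose om : C := expi 0 (d%:~R * (2 * pi / N%:R)).
have -> : \sum_(j < N) expi 0 (d%:~R * (2 * pi * j%:R / N%:R)) = \sum_(j < N) om ^+ j.
  apply: eq_bigr => j _; rewrite expiX mulr0; congr expi.
  by ring.
have omN : om ^+ N = 1.
  rewrite expiX mulr0 mulrCA [N%:R * _]mulrC divfK ?gt_eqF//.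
  have per (k : nat) : expi 0 (k%:R * (2 * pi)) = 1 :> C.
    elim: k => [|k IH]; first by rewrite mul0r expi0.
    by rewrite -[k.+1]addn1 natrD mulrDl mul1r expi_period.
  case: (d) => k; first exact: per.
  by rewrite NegzE mulrNz mulNr -[X in expi X]oppr0 -expiV per invr1.
have om1 : om != 1.
  have key (k : nat) : (0 < k < N)%N -> expi 0 (k%:R * (2 * pi / N%:R)) != 1 :> C.
    move=> /andP[k0 kN]; apply: expi_eq1; apply/andP; split.
      by rewrite mulr_gt0 ?divr_gt0 ?ltr0n// mulr_gt0.
    rewrite mulrCA gtr_pMr ?mulr_gt0//.
    by rewrite ltr_pdivrMr// mul1r ltr_nat.
  move: d0 dN; rewrite /om; case: (d) => k k0 kN.
    by apply: key; rewrite kN andbT lt0n -(eqz_nat k 0).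
  rewrite NegzE mulrNz mulNr -[X in expi X]oppr0 -expiV -[X in _ != X]invr1 (inj_eq invr_inj).
  by apply: key; rewrite ltn0Sn/=.
have := subrX1 om N; rewrite omN subrr => /esym/eqP.
by rewrite mulf_eq0 subr_eq0 (negPf om1) => /eqP.
Qed.

Lemma monomial_torus_point m x th : monomial m (torus_point x th) =
  \prod_(i < n) expi ((m 0 i)%:~R * (x 0 i / 2)) ((m 0 i)%:~R * th 0 i).
Proof.
rewrite monomialE; last exact: torus_torus_point.
by apply: eq_bigr => i _; rewrite torus_pointE expiXz.
Qed.

Lemma coefficient_bound (M : seq 'rV[int]_n) a f x b : uniq M -> laurent_on M a f ->
  (forall th, modulus (pull f (x, th)) <= b) ->
  forall m, m \in M -> modulus (a m) * expR (dotp (of_lattice R m) x / 2) <= b.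
Proof.
move=> uM Mf fb m0 m0M.
pose N := (2 * \sum_(m <- M) \sum_(i < n) `|m 0%R i|%N).+1.
have N0 : (0 : R) < N%:R by rewrite ltr0n.
have small m i : m \in M -> (`|m 0%R i| <= \sum_(m <- M) \sum_(i < n) `|m 0%R i|%N)%N.
  by move=> mM; rewrite (big_rem m)//= (bigD1 i)//=; lia.
have dN m i : m \in M -> (`|(m 0 i - m0 0 i)%R| < N)%N.
  by move=> mM; have := small m i mM; have := small m0 i m0M; rewrite /N; lia.
pose th (w : {ffun 'I_n -> 'I_N}) : 'rV[R]_n := \row_i (2 * pi * (w i)%:R / N%:R).
pose u (w : {ffun 'I_n -> 'I_N}) : C := \prod_(i < n) expi 0 (- (m0 0 i)%:~R * th w 0 i).
have mu w : modulus (u w) = 1.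
  by rewrite modulus_prod big1// => i _; rewrite modulus_expi expR0.
have E : \sum_w pull f (x, th w) * u w = a m0 * ((expR (dotp (of_lattice R m0) x / 2))%:C)%C * (N ^ n)%:R.
  have -> : \sum_w pull f (x, th w) * u w =
      \sum_(m <- M) a m * ((expR (dotp (of_lattice R m) x / 2))%:C)%C *
        \prod_(i < n) \sum_(j < N) expi 0 ((m 0 i - m0 0 i)%:~R * (2 * pi * j%:R / N%:R)).
    rewrite (eq_bigr (fun w : {ffun 'I_n -> 'I_N} => \sum_(m <- M) a m * ((expR (dotp (of_lattice R m) x / 2))%:C)%C *
       \prod_(i < n) expi 0 ((m 0 i - m0 0 i)%:~R * (2 * pi * (w i)%:R / N%:R)))); last first.
      move=> w _; rewrite /pull/= Mf; last exact: torus_torus_point.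
      rewrite mulr_suml; apply: eq_bigr => m _.
      rewrite monomial_torus_point -!mulrA; congr (_ * _).
      have -> : ((expR (dotp (of_lattice R m) x / 2))%:C)%C =
          \prod_(i < n) expi ((m 0 i)%:~R * (x 0 i / 2)) 0.
        rewrite /dotp mulr_suml expR_sum rmorph_prod/=; apply: eq_bigr => i _.
        rewrite mxE mulrA; apply/eqP; rewrite eq_complex /= cos0 sin0 mulr1 mulr0.
        by rewrite !eqxx.
      rewrite -!big_split/=; apply: eq_bigr => i _.
      rewrite -!expiD !addr0 add0r; congr expi.
      by rewrite mxE rmorphB/= mulrBl mulNr.
    rewrite exchange_big/=; apply: eq_bigr => m _.
    by rewrite -mulr_sumr bigA_distr_bigA.
  rewrite (big_rem m0)//= [X in _ + X]big_seq_cond [X in _ + X]big1 ?addr0 => [|m].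
    congr (_ * _); rewrite (eq_bigr (fun=> N%:R)) ?prodr_const ?card_ord ?natrX// => i _.
    by rewrite root_of_unity_sum ?subrr//=.
  rewrite andbT mem_rem_uniq// inE => /andP[mm0 mM].
  have [i mi] : exists i, m 0 i != m0 0 i.
    apply/existsP; apply: contraNT mm0; rewrite negb_exists => /forallP H.
    by apply/eqP/rowP => i; have := H i; rewrite negbK => /eqP.
  rewrite (bigD1 i)//= root_of_unity_sum ?dN//.
  by rewrite subr_eq0 (negPf mi) mul0r mulr0.
have : modulus (\sum_w pull f (x, th w) * u w) <= (N ^ n)%:R * b.
  rewrite (le_trans (modulus_sum _ _ _))//.
  rewrite (le_trans (ler_sum _ (G := fun=> b) _))//.
    by move=> w _; rewrite modulusM mu mulr1.
  by rewrite sumr_const card_ffun !card_ord mulr_natl.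
rewrite E modulusM modulusM modulusC ger0_norm ?expR_ge0//.
have -> : modulus ((N ^ n)%:R : C) = (N ^ n)%:R.
  have -> : ((N ^ n)%:R : C) = (((N ^ n)%:R : R)%:C)%C by rewrite rmorph_nat.
  by rewrite modulusC ger0_norm.
by rewrite [X in _ <= X]mulrC ler_pM2r// ltr0n expn_gt0.
Qed.

End laurent_polynomials.

Section convex_bodies.
Context (R : realType) (n : nat).
Implicit Types (K : set 'rV[R]_n) (x y z u w : 'rV[R]_n).

Lemma dotpDl x y z : dotp (x + y) z = dotp x z + dotp y z.
Proof. by rewrite /dotp -big_split/=; apply: eq_bigr => i _; rewrite mxE mulrDl. Qed.

Lemma dotpZl (a : R) x z : dotp (a *: x) z = a * dotp x z.
Proof. by rewrite /dotp mulr_sumr; apply: eq_bigr => i _; rewrite mxE mulrA. Qed.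

Lemma dotpC x y : dotp x y = dotp y x.
Proof. by apply: eq_bigr => i _; rewrite mulrC. Qed.

Lemma dotpBl x y z : dotp (x - y) z = dotp x z - dotp y z.
Proof. by rewrite dotpDl -scaleN1r dotpZl mulN1r. Qed.

Lemma dotpDr x y z : dotp z (x + y) = dotp z x + dotp z y.
Proof. by rewrite ![dotp z _]dotpC dotpDl. Qed.

Lemma dotpZr (a : R) x z : dotp z (a *: x) = a * dotp z x.
Proof. by rewrite ![dotp z _]dotpC dotpZl. Qed.

Lemma dotpBr x y z : dotp z (x - y) = dotp z x - dotp z y.
Proof. by rewrite ![dotp z _]dotpC dotpBl. Qed.

Lemma dotp_lineB (t : R) x y :
  dotp (t *: x - y) (t *: x - y) = t * (t * dotp x x) - 2 * (t * dotp x y) + dotp y y.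
Proof. by rewrite dotpBl !dotpBr !dotpZl !dotpZr [dotp y x]dotpC; ring. Qed.

Lemma dotp_ge0 x : 0 <= dotp x x.
Proof. by apply: sumr_ge0 => i _; rewrite -expr2 sqr_ge0. Qed.

Lemma dotp_eq0 x : dotp x x = 0 -> x = 0.
Proof.
move=> /eqP; rewrite psumr_eq0 => [/allP H|i _]; last by rewrite -expr2 sqr_ge0.
apply/rowP => i; rewrite mxE; apply/eqP.
by have := H i; rewrite mem_index_enum => /(_ isT); rewrite mulf_eq0 orbb.
Qed.

Lemma convexP K : @convex_set R 'rV[R]_n K -> forall x y (t : R), K x -> K y ->
  0 <= t <= 1 -> K (t *: x + (1 - t) *: y).
Proof.
move=> cK x y t Kx Ky /andP[t0 t1].
by have := cK x y (Itv01 t0 t1); rewrite !inE => /(_ Kx Ky).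
Qed.

Lemma sum_continuous (I : Type) (r : seq I) (f : I -> 'rV[R]_n -> R) (g : 'rV[R]_n -> R) :
  (forall i, continuous (f i)) -> (forall y, g y = \sum_(i <- r) f i y) -> continuous g.
Proof.
move=> cf; elim: r g => [|i r IH] g gE x.
  have -> : g = cst (0 : R) by apply/funext => y; rewrite gE big_nil.
  exact: cst_continuous.
have -> : g = (f i \+ (fun y => g y - f i y)) by apply/funext => y /=; rewrite addrC subrK.
apply: (@continuousD R R^o _ (f i)); first exact: cf.
by apply: IH => y; rewrite gE big_cons addrAC subrr add0r.
Qed.

Lemma dotp_continuous u : continuous (fun x : 'rV[R]_n => dotp u x).
Proof.
apply: (@sum_continuous _ _ (fun i x => u 0 i * x 0 i)) => // i x.
apply: (@continuousM R _ (cst (u 0 i)) (fun y : 'rV[R]_n => y 0 i)); first exact: cst_continuous.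
exact: coord_continuous.
Qed.

Lemma compact_coord_bound K : compact K ->
  exists D : nat, forall y, K y -> forall i, `|y 0 i| <= D%:R.
Proof.
move=> /compact_bounded[M [Mr H]].
exists (Num.bound (`|M| + 1)) => y Ky i.
have := H (`|M| + 1); rewrite (le_lt_trans (ler_norm _))// ?ltrDl// => /(_ isT _ Ky).
move=> yM; rewrite (@le_trans _ _ `|y|)//; last first.
  by rewrite (le_trans yM)// ltW// archi_boundP// addr_ge0.
by rewrite [leRHS]/Num.norm/= mx_normrE; apply: (le_bigmax _ (fun ij => `|y ij.1 ij.2|) (0, i)).
Qed.

Lemma support_fun_ub K x y : compact K -> K y -> dotp y x <= support_fun K x.
Proof.
move=> /compact_coord_bound[D HD] Ky; apply: ub_le_sup; last by exists y.
exists (\sum_i D%:R * `|x 0 i|) => _ [z Kz <-]; apply: ler_sum => i _.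
by rewrite (le_trans (ler_norm _))// normrM ler_wpM2r// HD.
Qed.

Lemma support_fun_le K x b : K !=set0 -> (forall y, K y -> dotp y x <= b) ->
  support_fun K x <= b.
Proof.
by move=> [y Ky] H; apply: ge_sup => [|_ [z /H ? <-]//]; exists (dotp y x); exists y.
Qed.

Lemma strict_separation K w : compact K -> @convex_set R 'rV[R]_n K -> K !=set0 -> ~ K w ->
  exists u, support_fun K u < dotp w u.
Proof.
move=> cK /convexP vK K0 Kw.
have cf : continuous (fun y : 'rV[R]_n => dotp (y - w) (y - w)).
  apply: (@sum_continuous _ _ (fun i y => (y - w) 0 i * (y - w) 0 i)) => // i x.
  have A : continuous (fun y : 'rV[R]_n => (y - w) 0 i).
    have -> : (fun y : 'rV[R]_n => (y - w) 0 i) = (fun y => y 0 i) \+ cst ((- w) 0 i).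
      by apply/funext => y; rewrite mxE.
    move=> z; apply: (@continuousD R R^o _ (fun y : 'rV[R]_n => y 0 i)); first exact: coord_continuous.
    exact: cst_continuous.
  by apply: (@continuousM R _ (fun y : 'rV[R]_n => (y - w) 0 i) (fun y : 'rV[R]_n => (y - w) 0 i)); exact: A.
have [|y0 y0K ymin] := compact_EVT_min K0 cK (f := fun y => dotp (y - w) (y - w)).
  exact: continuous_subspaceT.
rewrite inE in y0K; exists (w - y0).
have u0 : 0 < dotp (w - y0) (w - y0).
  rewrite lt_neqAle dotp_ge0 andbT eq_sym; apply/eqP => /dotp_eq0 /eqP.
  by rewrite subr_eq0 => /eqP E; apply: Kw; rewrite E.
apply: (@le_lt_trans _ _ (dotp y0 (w - y0))); last by rewrite -subr_gt0 -dotpBl.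
apply: support_fun_le => // y Ky; rewrite -subr_le0 -dotpBl leNgt; apply/negP => d0.
(* moving from y0 towards y decreases the distance to w to first order *)
set d := dotp (y - y0) (w - y0) in d0; set e := dotp (y - y0) (y - y0).
have e0 : 0 <= e by exact: dotp_ge0.
pose t := Num.min 1 (d / (e + 1)).
have t0 : 0 < t by rewrite lt_min ltr01 divr_gt0// ltr_wpDl.
have t1 : t <= 1 by rewrite ge_min lexx.
have te : t * (e + 1) <= d by rewrite -ler_pdivlMr ?ltr_wpDl// ge_min lexx orbT.
have := ymin (t *: y + (1 - t) *: y0); rewrite inE => /(_ (vK _ _ _ Ky y0K _)).
rewrite (ltW t0) t1 => /(_ isT).
have -> : t *: y + (1 - t) *: y0 - w = t *: (y - y0) - (w - y0).
  by apply/rowP => i; rewrite !mxE; ring.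
have -> : dotp (y0 - w) (y0 - w) = dotp (w - y0) (w - y0).
  by rewrite -opprB -scaleN1r dotpZl dotpZr mulN1r mulN1r opprK.
rewrite dotp_lineB -/e -/d.
have : t * (t * e) < t * (2 * d).
  by rewrite ltr_pM2l//; rewrite mulrDr mulr1 in te; lra.
lra.
Qed.

End convex_bodies.

Section lattice_box.
Context (R : realType) (n : nat).
Implicit Types (m : 'rV[int]_n).

Definition box (N : nat) : seq 'rV[int]_n :=
  [seq \row_i ((t i : nat)%:Z - N%:Z) | t : {ffun 'I_n -> 'I_(N + N).+1}].

Lemma size_box N : size (box N) = ((N + N).+1 ^ n)%N.
Proof. by rewrite size_map -cardE card_ffun !card_ord. Qed.

Lemma box_uniq N : uniq (box N).
Proof.
rewrite map_inj_uniq ?enum_uniq// => t t' /rowP H; apply/ffunP => i; apply/val_inj.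
by have := H i; rewrite !mxE => /addIr [].
Qed.

Lemma mem_box N m : (forall i, (`|m 0%R i| <= N%:Z)%R) -> m \in box N.
Proof.
move=> H; apply/mapP.
have mN i : (`|(m 0%R i + N%:Z)%R|%N < (N + N).+1)%N by have := H i; lia.
exists [ffun i => Ordinal (mN i)]; first by rewrite mem_enum.
by apply/rowP => i; rewrite mxE ffunE /=; have := H i; lia.
Qed.

End lattice_box.

Record tame (R : realType) (n : nat) (K : set 'rV[R]_n) (phi : 'rV[R]_n -> R)
    (D : nat) (M : R) : Prop := {
  tame_compact : compact K;
  tame_convex : @convex_set R 'rV[R]_n K;
  tame_nonempty : K !=set0;
  tame_box : forall y, K y -> forall i, `|y 0 i| <= D%:R;
  tame_continuous : continuous phi;
  tame_near : forall x, `|phi x - support_fun K x| <= M }.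

Section section_expansion.
Context (R : realType) (n : nat) (K : set 'rV[R]_n) (phi : 'rV[R]_n -> R).
Context (D : nat) (M : R) (tm : tame K phi D M).
Local Notation C := (cplx R).
Let K_compact := tame_compact tm.
Let K_convex := tame_convex tm.
Let K_ne := tame_nonempty tm.
Let K_box := tame_box tm.
Let phi_cts := tame_continuous tm.
Let phi_near := tame_near tm.
Implicit Types (f : 'rV[C]_n -> C) (x y th : 'rV[R]_n) (k L : nat) (m : 'rV[int]_n).

Definition dilate L : set 'rV[R]_n := [set L%:R *: y | y in K].

Definition lat L : seq 'rV[int]_n :=
  [seq m <- box n (D * L) | `[< dilate L (of_lattice R m) >]].

Lemma lat_uniq L : uniq (lat L). Proof. exact/filter_uniq/box_uniq. Qed.

Lemma mem_lat L m : (m \in lat L) = `[< dilate L (of_lattice R m) >].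
Proof.
rewrite mem_filter; apply: andb_idr => /asboolP[y Ky yE]; apply: mem_box => i.
rewrite -(ler_int R) intr_norm.
have -> : (m 0 i)%:~R = of_lattice R m 0 i by rewrite mxE.
by rewrite -[leRHS]/((D * L)%:R) mulnC natrM -yE mxE normrM ger0_norm// ler_wpM2l// K_box.
Qed.

Lemma support_fun_norm x : support_fun K x <= D%:R * \sum_i `|x 0 i|.
Proof.
apply: support_fun_le => // y Ky; rewrite mulr_sumr; apply: ler_sum => i _.
by rewrite (le_trans (ler_norm _))// normrM ler_wpM2r// K_box.
Qed.

Lemma support_fun_osc x x' (r : R) : (forall i, `|x' 0 i - x 0 i| <= r) ->
  support_fun K x' <= support_fun K x + D%:R * (n%:R * r).
Proof.
move=> xx'; apply: support_fun_le => // y Ky.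
have -> : x' = x + (x' - x) by rewrite addrC subrK.
rewrite dotpDr lerD ?support_fun_ub//.
have -> : n%:R * r = \sum_(i < n) r by rewrite sumr_const card_ord mulr_natl.
rewrite mulr_sumr; apply: ler_sum => i _.
rewrite (le_trans (ler_norm _))// normrM ler_pM// ?K_box//.
by have := xx' i; rewrite !mxE.
Qed.

Lemma support_funZ (s : R) x : 0 <= s -> support_fun K (s *: x) <= s * support_fun K x.
Proof.
by move=> s0; apply: support_fun_le => // y Ky; rewrite dotpZr ler_wpM2l// support_fun_ub.
Qed.

Lemma potential_osc x x' : (forall i, `|x' 0 i - x 0 i| <= 4) ->
  phi x' <= support_fun K x + (D%:R * (n%:R * 4) + M).
Proof.
move=> /support_fun_osc H; rewrite addrA; apply: le_trans (lerD H (lexx M)).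
by have := phi_near x'; rewrite ler_norml => /andP[_]; rewrite lerBlDr addrC.
Qed.

Lemma hnorm_sqr k f : hnorm phi k f ^+ 2 = fine (sqnorm phi k f).
Proof. by rewrite sqr_sqrtr// fine_ge0// sqnorm_ge0. Qed.

Lemma hnorm_ge0 k f : 0 <= hnorm phi k f.
Proof. exact: sqrtr_ge0. Qed.

(* the choice of the free scale in the mean value estimate *)
Lemma Hk_bound k : exists2 A : R, 0 < A & forall f, Hk phi k f -> forall x th,
  modulus (pull f (x, th)) <= A * expR (k%:R * support_fun K x / 2) * hnorm phi k f.
Proof.
have [A A0 H] := Hk_pointwise_bound phi_cts potential_osc k.
exists (A * 2); first by rewrite mulr_gt0.
move=> f Hf x th; set E := expR _; have E0 : 0 < E by exact: expR_gt0.
have EE : expR (k%:R * support_fun K x) = E ^+ 2.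
  by rewrite /E expr2 -expRD -splitr.
have := H _ Hf x th; rewrite -hnorm_sqr EE; set h := hnorm _ _ _ => {}H.
have : 0 <= h by exact: hnorm_ge0.
rewrite le_eqVlt => /predU1P[h0|h0].
  rewrite -h0 mulr0; apply/ler_addgt0Pl => e e0; rewrite addr0.
  have := H (e / A); rewrite divr_gt0// -h0 expr0n/= mulr0 mul0r addr0 => /(_ isT).
  by rewrite mulrCA divff ?gt_eqF// mulr1.
have := H (E * h); rewrite mulr_gt0// => /(_ isT) /le_trans; apply.
rewrite le_eqVlt; apply/orP; left; apply/eqP.
by field; rewrite !gt_eqF.
Qed.

Lemma small_exponents_vanish (a A d : R) : 0 <= a -> 0 < d ->
  (forall s, 0 < s -> a * expR (s * d) <= A) -> a = 0.
Proof.
move=> a0 d0 H; apply/eqP; rewrite eq_le a0 andbT leNgt; apply/negP => {}a0.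
have A0 : 0 < A by apply: lt_le_trans (H 1 ltr01); rewrite mulr_gt0// expR_gt0.
pose s := A / (a * d).
have s0 : 0 < s by rewrite divr_gt0// mulr_gt0.
have := H s s0; apply/negP; rewrite -ltNge.
apply: (@lt_le_trans _ _ (a * (1 + s * d))); last by rewrite ler_pM2l// expR_ge1Dx.
have -> : a * (1 + s * d) = a + A by rewrite /s; field; rewrite !gt_eqF.
by rewrite ltrDr.
Qed.

Lemma laurent_exponents k (P : seq 'rV[int]_n) a f (A : R) : (0 < k)%N -> uniq P ->
  laurent_on P a f ->
  (forall x th, modulus (pull f (x, th)) <= A * expR (k%:R * support_fun K x / 2)) ->
  forall m, m \in P -> m \notin lat k -> a m = 0.
Proof.
move=> k0 uP Pf fA m mP; rewrite mem_lat => /asboolPn mk.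
have kR : (0 : R) < k%:R by rewrite ltr0n.
have [|u] := @strict_separation _ _ K (k%:R^-1 *: of_lattice R m) K_compact K_convex K_ne.
  by move=> Km; apply: mk; exists (k%:R^-1 *: of_lattice R m); rewrite // scalerA divff ?scale1r// gt_eqF.
rewrite dotpZl mulrC ltr_pdivlMr// => um.
apply/eqP; rewrite -modulus0_eq; apply/eqP; apply: (@small_exponents_vanish _ A ((dotp (of_lattice R m) u - support_fun K u * k%:R) / 2)).
- exact: modulus_ge0.
- by rewrite divr_gt0// subr_gt0.
move=> s s0; have := coefficient_bound uP Pf (fA (s *: u)) mP.
rewrite dotpZr => H.
have E : expR (s * ((dotp (of_lattice R m) u - support_fun K u * k%:R) / 2)) =
   expR (s * dotp (of_lattice R m) u / 2) * expR (- (s * support_fun K u * k%:R / 2)).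
  by rewrite -expRD; congr expR; ring.
rewrite E mulrA; apply: le_trans (ler_wpM2r (expR_ge0 _) H) _.
rewrite -[leLHS]mulrA -expRD -[leRHS]mulr1; apply: ler_wpM2l.
  by have := le_trans (modulus_ge0 _) (fA 0 0); rewrite pmulr_lge0// expR_gt0.
rewrite -[leRHS]expR0 ler_expR subr_le0 ler_pM2r// mulrC ler_pM2r//.
by apply: support_funZ => //; exact: ltW.
Qed.

Lemma Hk_laurent k f : (0 < k)%N -> Hk phi k f -> exists a, laurent_on (lat k) a f.
Proof.
move=> k0 Hf; have [A A0 /(_ _ Hf) fA] := Hk_bound k.
have [df _ _] := Hf.
set B := A * hnorm phi k f.
have B0 : 0 <= B by rewrite mulr_ge0 ?hnorm_ge0// ltW.
have fB x th : modulus (pull f (x, th)) <= B * expR (k%:R * support_fun K x / 2).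
  by rewrite /B mulrAC.
have [|T [mu [mm [c H]]]] := @separate_laurent _ _ f B (D * k) df.
  move=> x th; apply: le_trans (fB x th) _; rewrite ler_wpM2l// ler_expR.
  rewrite [leRHS]mulrAC ler_pM2r// mulnC natrM -[leRHS]mulrA ler_wpM2l//.
  by have := support_fun_norm x.
have Pf := collect_laurent H; set P := undup _ in Pf.
set b := (fun _ => _) in Pf.
have uP : uniq P by exact: undup_uniq.
have b0 := laurent_exponents k0 uP Pf fB.
exists (fun m => if m \in P then b m else 0) => z tz; rewrite Pf//.
rewrite (bigID (fun m => m \in lat k))/= [X in _ + X]big1_seq ?addr0; last first.
  by move=> m /andP[mk mP]; rewrite b0// mul0r.
rewrite [RHS](bigID (fun m => m \in P))/= [X in _ = _ + X]big1 ?addr0; last first.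
  by move=> m /negbTE ->; rewrite mul0r.
rewrite -big_filter -[RHS]big_filter.
rewrite [RHS](eq_big_seq (fun m => b m * monomial m z)); last first.
  by move=> m; rewrite mem_filter => /andP[-> _].
apply/perm_big/uniq_perm; [exact/filter_uniq|exact/filter_uniq/lat_uniq|move=> m].
by rewrite !mem_filter andbC.
Qed.

End section_expansion.

Section complex_integral.
Context d (T : measurableType d) (R : realType) (mu : {measure set T -> \bar R}).
Local Notation C := (cplx R).
Implicit Types (h : T -> C) (c : C).

Definition cint h : C :=
  ((\int[mu]_p complex.Re (h p)) +i* (\int[mu]_p complex.Im (h p)))%C.

Definition cintegrable h : Prop :=
  mu.-integrable setT (EFin \o (fun p => complex.Re (h p))) /\
  mu.-integrable setT (EFin \o (fun p => complex.Im (h p))).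

Lemma integrableL (f g : T -> R) (a b : R) :
  mu.-integrable setT (EFin \o f) -> mu.-integrable setT (EFin \o g) ->
  mu.-integrable setT (EFin \o (fun p => a * f p + b * g p)).
Proof.
move=> mf mg.
have := integrableD measurableT (integrableZl measurableT a mf) (integrableZl measurableT b mg).
by apply: eq_integrable.
Qed.

Lemma RintegralL (f g : T -> R) (a b : R) :
  mu.-integrable setT (EFin \o f) -> mu.-integrable setT (EFin \o g) ->
  \int[mu]_p (a * f p + b * g p) = a * \int[mu]_p f p + b * \int[mu]_p g p.
Proof.
move=> mf mg; rewrite RintegralD//; first by rewrite !RintegralZl.
- by apply: eq_integrable (integrableZl measurableT a mf).
- by apply: eq_integrable (integrableZl measurableT b mg).
Qed.

Lemma cintD h h' : cintegrable h -> cintegrable h' ->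
  cint (fun p => h p + h' p) = cint h + cint h'.
Proof.
move=> [rh ih] [rh' ih']; apply/eqP; rewrite eq_complex /=; apply/andP; split; apply/eqP.
  rewrite -RintegralD//; congr (fine _); apply: eq_integral => p _.
  by case: (h p) (h' p) => [? ?] [? ?].
rewrite -RintegralD//; congr (fine _); apply: eq_integral => p _.
by case: (h p) (h' p) => [? ?] [? ?].
Qed.

Lemma cintZ c h : cintegrable h -> cint (fun p => c * h p) = c * cint h.
Proof.
case: c => a b [rh ih]; apply/eqP; rewrite eq_complex /=; apply/andP; split; apply/eqP.
  rewrite -mulNr -RintegralL//; congr (fine _); apply: eq_integral => p _.
  by case: (h p) => u w /=; rewrite mulNr.
rewrite -RintegralL//; congr (fine _); apply: eq_integral => p _.
by case: (h p) => u w.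
Qed.

Lemma cint_conj h : cintegrable h ->
  cint (fun p => conjc (h p : R[i])) = conjc (cint h : R[i]).
Proof.
move=> [rh ih]; apply/eqP; rewrite eq_complex /=; apply/andP; split; apply/eqP.
  by congr (fine _); apply: eq_integral => p _; case: (h p).
rewrite -mulN1r -RintegralZl//; congr (fine _); apply: eq_integral => p _.
by case: (h p) => u w /=; rewrite mulN1r.
Qed.

Lemma dominated_cintegrable h (g : T -> R) :
  measurable_fun setT (fun p => complex.Re (h p)) ->
  measurable_fun setT (fun p => complex.Im (h p)) ->
  (forall p, modulus (h p) <= g p) -> mu.-integrable setT (EFin \o g) -> cintegrable h.
Proof.
move=> mr mi hg ig; split; apply: (le_integrable measurableT _ _ ig).
- exact/measurable_EFinP.
- move=> p _ /=; rewrite lee_fin (le_trans (le_Re_modulus _))// (le_trans (hg p))//.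
  exact: ler_norm.
- exact/measurable_EFinP.
- move=> p _ /=; rewrite lee_fin (le_trans (le_Im_modulus _))// (le_trans (hg p))//.
  exact: ler_norm.
Qed.

End complex_integral.

Section hilbert.
Context (R : realType) (n : nat) (K : set 'rV[R]_n) (phi : 'rV[R]_n -> R).
Context (D : nat) (M : R) (tm : tame K phi D M) (k : nat).
Local Notation C := (cplx R).
Let phi_cts := tame_continuous tm.
Implicit Types (f g h : 'rV[C]_n -> C) (a b : C).

Definition herm f g p : C :=
  ((pull f p : R[i]) * (pull g p : R[i])^* * (weight phi k p)%:C)%C.

Lemma innerE f g : inner phi k f g = cint (nu R n) (herm f g).
Proof. by []. Qed.

Lemma measurable_ReIm f : (forall z, torus z -> differentiable f z) ->
  measurable_fun setT (fun p => complex.Re (pull f p)) /\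
  measurable_fun setT (fun p => complex.Im (pull f p)).
Proof.
move=> df; split; apply: continuous_measurable_rows => x th e e0;
  have [d d0 H] := pull_cts (df _ (@torus_torus_point R n x th)) e0;
  exists d => // x' th' /H; apply: le_trans; rewrite -raddfB.
- exact: le_Re_modulus.
- exact: le_Im_modulus.
Qed.

Lemma modulus_conj (z : C) : modulus (conjc (z : R[i])) = modulus z.
Proof.
by apply/eqP; rewrite -(@eqrXn2 _ 2)// ?modulus_ge0// !modulus_sqr; case: z => u w /=; rewrite sqrrN.
Qed.

Lemma integrable_sq f : Hk phi k f ->
  (nu R n).-integrable setT (EFin \o (fun p => modulus (pull f p) ^+ 2 * weight phi k p)).
Proof.
move=> [df _ fin]; apply/integrableP; split; first exact: (measurable_sq phi_cts).
apply: le_lt_trans fin; rewrite le_eqVlt; apply/orP; left; apply/eqP.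
apply: eq_integral => p _ /=; rewrite ger0_norm// mulr_ge0 ?exprn_ge0 ?modulus_ge0//.
exact/ltW/weight_gt0.
Qed.

Lemma integrable_herm f g : Hk phi k f -> Hk phi k g -> cintegrable (nu R n) (herm f g).
Proof.
move=> Hf Hg; have [df _ _] := Hf; have [dg _ _] := Hg.
have [rf if_] := measurable_ReIm df; have [rg ig] := measurable_ReIm dg.
have mw := measurable_weight phi_cts k.
apply: (@dominated_cintegrable _ _ _ _ _ (fun p => 1 * (modulus (pull f p) ^+ 2 * weight phi k p) +
   1 * (modulus (pull g p) ^+ 2 * weight phi k p))).
- rewrite (_ : (fun p => _) = fun p => (complex.Re (pull f p) * complex.Re (pull g p) +
    complex.Im (pull f p) * complex.Im (pull g p)) * weight phi k p).
    by apply: measurable_funM => //; apply: measurable_funD; apply: measurable_funM.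
  by apply/funext => p; rewrite /herm; case: (pull f p) (pull g p) => [u w] [u' w'] /=; ring.
- rewrite (_ : (fun p => _) = fun p => (complex.Im (pull f p) * complex.Re (pull g p) -
    complex.Re (pull f p) * complex.Im (pull g p)) * weight phi k p).
    by apply: measurable_funM => //; apply: measurable_funB; apply: measurable_funM.
  by apply/funext => p; rewrite /herm; case: (pull f p) (pull g p) => [u w] [u' w'] /=; ring.
- move=> p; rewrite /herm !mul1r -mulrDl !modulusM modulus_conj modulusC.
  have w0 := weight_gt0 phi k p; rewrite (gtr0_norm w0) ler_pM2r//.
  have := sqr_ge0 (modulus (pull f p) - modulus (pull g p)).
  have := sqr_ge0 (modulus (pull f p)); have := sqr_ge0 (modulus (pull g p)).
  by rewrite sqrrB; set x := modulus (pull f p); set y := modulus (pull g p); lra.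
- exact: (integrableL 1 1 (integrable_sq Hf) (integrable_sq Hg)).
Qed.

Lemma HkL f g a b : Hk phi k f -> Hk phi k g -> Hk phi k (fun z => a * f z + b * g z).
Proof.
move=> Hf Hg; have [df f0 _] := Hf; have [dg g0 _] := Hg.
have dfg z : torus z -> differentiable (fun z => a * f z + b * g z) z.
  move=> tz; apply: (@differentiableD _ _ _ (fun z => a * f z) (fun z => b * g z)).
    by apply: (@differentiableZ _ _ _ f); exact: df.
  by apply: (@differentiableZ _ _ _ g); exact: dg.
split=> // [z tz|]; first by rewrite f0// g0// !mulr0 addr0.
set u := fun z => _ in dfg *.
pose S f p := modulus (pull f p) ^+ 2 * weight phi k p.
have := integrableL (2 * modulus a ^+ 2) (2 * modulus b ^+ 2) (integrable_sq Hf) (integrable_sq Hg).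
have mu_ : measurable_fun setT (EFin \o S u) by exact: (measurable_sq phi_cts).
move=> /(le_integrable measurableT mu_) H.
have /integrableP[_] : (nu R n).-integrable setT (EFin \o S u).
  apply: H => p _ /=; rewrite lee_fin.
  have w0 := weight_gt0 phi k p.
  have m0 f' : 0 <= modulus (pull f' p) ^+ 2 by rewrite sqr_ge0.
  rewrite ger0_norm; last by rewrite mulr_ge0// ltW.
  rewrite ger0_norm; last by apply: addr_ge0; (apply: mulr_ge0; apply: mulr_ge0; rewrite ?(ltW w0) ?sqr_ge0 ?ler0n).
  have H1 : modulus (pull u p) <= modulus a * modulus (pull f p) + modulus b * modulus (pull g p).
    by rewrite -!modulusM; exact: modulusD.
  set x := modulus a * _ in H1; set y := modulus b * _ in H1.
  rewrite [leRHS](_ : _ = (2 * x ^+ 2 + 2 * y ^+ 2) * weight phi k p); last first.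
    by rewrite /x /y; ring.
  rewrite ler_pM2r//.
  have : modulus (pull u p) ^+ 2 <= (x + y) ^+ 2.
    by rewrite ler_sqr ?nnegrE ?modulus_ge0// addr_ge0// mulr_ge0// modulus_ge0.
  by have := sqr_ge0 (x - y); rewrite sqrrB sqrrD; lra.
apply: le_lt_trans; rewrite le_eqVlt; apply/orP; left; apply/eqP.
apply: eq_integral => p _ /=; rewrite ger0_norm// mulr_ge0 ?exprn_ge0 ?modulus_ge0//.
exact/ltW/weight_gt0.
Qed.

Lemma Hk0 : Hk phi k (fun=> 0).
Proof.
split=> //.
rewrite /sqnorm (eq_integral (cst 0%E)) ?integral0//.
by move=> p _; rewrite modulus0 expr0n/= mul0r.
Qed.

Lemma innerL f g h a b : Hk phi k f -> Hk phi k g -> Hk phi k h ->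
  inner phi k (fun z => a * f z + b * g z) h = a * inner phi k f h + b * inner phi k g h.
Proof.
move=> Hf Hg Hh; rewrite !innerE -!cintZ; try exact: integrable_herm.
have Z c f' : Hk phi k f' -> cintegrable (nu R n) (fun p => c * herm f' h p).
  move=> Hf'; have := integrable_herm (HkL c 0 Hf' Hk0) Hh; congr cintegrable.
  by apply/funext => p; rewrite /herm /pull mulr0 addr0 !mulrA.
rewrite -cintD; [|exact: Z|exact: Z].
by congr cint; apply/funext => p; rewrite /herm /pull !mulrDl !mulrA.
Qed.

Lemma inner_conj f g : Hk phi k f -> Hk phi k g ->
  inner phi k g f = conjc (inner phi k f g : R[i]).
Proof.
move=> Hf Hg; rewrite !innerE -cint_conj; last exact: integrable_herm.
congr cint; apply/funext => p; rewrite /herm.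
by case: (pull f p) (pull g p) => [u w] [u' w']; apply/eqP; rewrite eq_complex /=; apply/andP; split; apply/eqP; ring.
Qed.

Lemma inner_norm f : inner phi k f f = ((hnorm phi k f ^+ 2)%:C)%C.
Proof.
rewrite innerE hnorm_sqr /sqnorm; apply/eqP; rewrite eq_complex /=; apply/andP; split; apply/eqP.
  congr (fine _); apply: eq_integral => p _; congr EFin.
  by rewrite modulus_sqr /herm; case: (pull f p) => u w /=; ring.
rewrite [LHS](_ : _ = fine (\int[nu R n]_p 0)%E); first by rewrite integral0.
congr (fine _); apply: eq_integral => p _; congr EFin.
by rewrite /herm; case: (pull f p) => u w /=; ring.
Qed.

Lemma hnorm_eq0 f : Hk phi k f -> hnorm phi k f = 0 -> f = (fun=> 0).
Proof.
move=> Hf f0; have [A A0 /(_ _ Hf) H] := Hk_bound tm k.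
have [_ fo _] := Hf; apply/funext => z; case: (pselect (torus z)) => tz; last exact: fo.
have [x [th zE]] := torus_polar tz; apply/eqP; rewrite -modulus0_eq eq_le modulus_ge0 andbT.
by have := H x th; rewrite f0 mulr0 zE.
Qed.

End hilbert.

Section monomial_calculus.
Context (K : numFieldType) (n : nat).
Implicit Types (z : 'rV[K]_n) (m : 'rV[int]_n).

(* the power function, extended by zero at the origin *)
Definition zpow (m : int) (w : K) : K := if w == 0 then 0 else w ^ m.

Definition zmonomial m z : K := \prod_(i < n) zpow (m 0 i) (z 0 i).

Lemma zpow_derive (m : int) (w : K) : w != 0 ->
  is_derive w 1 (zpow m : K -> K) (m%:~R * zpow (m - 1) w).
Proof.
move=> w0.
have E : is_derive w 1 ((fun u => u ^ m) : K -> K) (m%:~R * w ^ (m - 1)).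
  have P k : is_derive w 1 ((fun u => u ^+ k) : K -> K) (k%:R * w ^+ k.-1).
    apply: DeriveDef; first exact: exprn_derivable.
    by rewrite exp_derive -[LHS]/(_ * 1) mulr1.
  case: m => k.
    apply: (is_derive_eq (P k)); case: k => [|k]; first by rewrite !mul0r.
    by have -> : k.+1%:Z - 1 = k%:Z by lia.
  have [Pd Pv] := P k.+1; have wk : w ^+ k.+1 != 0 by exact: expf_neq0.
  have -> : (fun u : K => u ^ Negz k) = (fun u => (u ^+ k.+1)^-1) by apply/funext.
  have E : (Negz k)%:~R * w ^ (Negz k - 1) = - (w ^+ k.+1) ^- 2 *: 'D_1 (fun u : K => u ^+ k.+1) w.
    rewrite Pv -[RHS]/(_ * _).
    rewrite NegzE -opprD -PoszD addn1 -exprnN mulrNz mulNr mulNr.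
    congr (- _); rewrite -[_%:~R in LHS]/(k.+1%:R) [RHS]mulrC -mulrA; congr (_ * _).
    by rewrite /= !exprS; field; rewrite w0 expf_neq0.
  rewrite E; apply: (@DeriveDef K K K); first exact: (@derivableV K K (fun u : K => u ^+ k.+1) w 1 wk Pd).
  exact: (@deriveV K K (fun u : K => u ^+ k.+1) w 1 wk Pd).
rewrite /zpow (negbTE w0); apply: near_eq_is_derive E.
near=> u; rewrite ifF//; apply/negbTE.
by near: u; exact: near_neq.
Unshelve. all: by end_near. Qed.

Lemma differentiable_prods (I : Type) (r : seq I) (f : I -> 'rV[K]_n -> K) z :
  (forall i, differentiable (f i) z) -> differentiable (fun y => \prod_(i <- r) f i y) z.
Proof.
move=> df; elim: r => [|i r IH].
  rewrite (_ : (fun y => _) = cst 1); first exact: differentiable_cst.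
  by apply/funext => y; rewrite big_nil.
rewrite (_ : (fun y => _) = f i * (fun y => \prod_(j <- r) f j y)).
  exact: differentiableM.
by apply/funext => y; rewrite big_cons.
Qed.

Lemma zmonomial_differentiable m z : (forall i, z 0 i != 0) -> differentiable (zmonomial m) z.
Proof.
move=> z0; apply: differentiable_prods => i.
apply: (@differentiable_comp _ _ _ _ (fun y : 'rV[K]_n => y 0 i) (zpow (m 0 i))).
  exact: differentiable_coord.
by apply/derivable1_diffP; have [] := zpow_derive (m 0 i) (z0 i).
Qed.

Lemma zmonomial_partial m z i : (forall i, z 0 i != 0) ->
  is_derive z (delta_mx 0 i) (zmonomial m) ((m 0 i)%:~R * zmonomial (m - delta_mx 0 i) z).
Proof.
move=> z0; pose c := \prod_(j < n | j != i) zpow (m 0 j) (z 0 j).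
have line h : zmonomial m (h *: delta_mx 0 i + z) = c * zpow (m 0 i) (h + z 0 i).
  rewrite /zmonomial (bigD1 i)//= mulrC; congr (_ * _).
    apply: eq_bigr => j ji; rewrite !mxE eqxx /= (negbTE ji).
    by rewrite mulr0 add0r.
  by rewrite !mxE !eqxx mulr1.
have [dz dv] := zpow_derive (m 0 i) (z0 i).
have E : (fun h => h^-1 *: ((zmonomial m \o shift z) (h *: delta_mx 0 i) - zmonomial m z)) =
    (fun h => c * (h^-1 *: ((zpow (m 0 i) \o shift (z 0 i)) (h *: 1) - zpow (m 0 i) (z 0 i)))).
  apply/funext => h /=.
  have -> : zmonomial m z = c * zpow (m 0 i) (z 0 i).
    by have := line 0; rewrite scale0r !add0r.
  rewrite line -[h *: 1]/(h * 1) mulr1 -mulrBr -[LHS]/(h^-1 * (c * _)) mulrCA.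
  by [].
have L : h^-1 *: ((zpow (m 0 i) \o shift (z 0 i)) (h *: 1) - zpow (m 0 i) (z 0 i))
    @[h --> (0:K)^'] --> (m 0 i)%:~R * zpow (m 0 i - 1) (z 0 i).
  by rewrite -dv; exact: dz.
have L' : h^-1 *: ((zmonomial m \o shift z) (h *: delta_mx 0 i) - zmonomial m z)
    @[h --> (0:K)^'] --> c * ((m 0 i)%:~R * zpow (m 0 i - 1) (z 0 i)).
  by rewrite E; apply: cvgM => //; exact: cvg_cst.
have -> : (m 0 i)%:~R * zmonomial (m - delta_mx 0 i) z = c * ((m 0 i)%:~R * zpow (m 0 i - 1) (z 0 i)).
  rewrite mulrCA; congr (_ * _); rewrite /zmonomial (bigD1 i)//= mulrC; congr (_ * _).
    by apply: eq_bigr => j ji; rewrite !mxE eqxx /= (negbTE ji) subr0.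
  by rewrite !mxE !eqxx.
by apply: DeriveDef; [apply/cvg_ex; eexists; exact: L'|exact: cvg_lim L'].
Qed.

Lemma is_derive_combination (I : Type) (r : seq I) (a : I -> K) (f : I -> 'rV[K]_n -> K)
    (df : I -> K) z w : (forall i, is_derive z w (f i) (df i)) ->
  is_derive z w (fun y => \sum_(i <- r) a i * f i y) (\sum_(i <- r) a i * df i).
Proof.
move=> H; elim: r => [|i r IH].
  rewrite big_nil (_ : (fun y => _) = cst 0); first exact: is_derive_cst.
  by apply/funext => y; rewrite big_nil.
rewrite big_cons (_ : (fun y => _) = (a i \*: f i) + (fun y => \sum_(j <- r) a j * f j y)).
  exact: is_deriveD.
by apply/funext => y; rewrite big_cons.
Qed.

Lemma near_nonzero z : (forall i, z 0 i != 0) -> \forall y \near z, forall i, (y : 'rV[K]_n) 0 i != 0.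
Proof.
move=> z0; have FF : Filter (nbhs z) by exact: nbhs_filter.
suff H i : nbhs z [set y : 'rV[K]_n | y 0 i != 0].
  exact: (@filter_forall _ 'I_n (fun i (y : 'rV[K]_n) => y 0 i != 0) (nbhs z) FF H).
have c : {for z, continuous (fun y : 'rV[K]_n => y 0 i)} by exact: coord_continuous.
exact: (c _ (near_neq (z0 i))).
Qed.

(* the coefficient produced by differentiating a monomial along s *)
Fixpoint falling (s : seq 'I_n) m : int :=
  if s is i :: s' then falling s' m * (m 0 i - (count_mem i s')%:Z) else 1.

Definition lower (s : seq 'I_n) m : 'rV[int]_n := \row_i (m 0 i - (count_mem i s)%:Z).

Lemma iter_partial_laurent (P : seq 'rV[int]_n) (a : 'rV[int]_n -> K) (f : 'rV[K]_n -> K) :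
  (forall z, (forall i, z 0 i != 0) -> f z = \sum_(m <- P) a m * zmonomial m z) ->
  forall s z, (forall i, z 0 i != 0) ->
  iter_partial s f z = \sum_(m <- P) a m * (falling s m)%:~R * zmonomial (lower s m) z.
Proof.
move=> fE; elim=> [|i s IH] z z0.
  rewrite /= fE//; apply: eq_bigr => m _; rewrite mulr1; congr (_ * zmonomial _ _).
  by apply/rowP => i; rewrite mxE subr0.
rewrite /= /partial.
have := @is_derive_combination _ P (fun m => a m * (falling s m)%:~R)
  (fun m => zmonomial (lower s m)) _ z (delta_mx 0 i)
  (fun m => zmonomial_partial (lower s m) i z0).
move=> /(near_eq_is_derive _) H; have [|_ ->] := H (iter_partial s f).
  near=> y; rewrite IH//; near: y; exact: near_nonzero.
apply: eq_bigr => m _; rewrite intrM !mulrA mxE; congr (_ * zmonomial _ _).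
apply/rowP => j; rewrite !mxE eqxx /= [i == j]eq_sym.
by case: (j == i); rewrite ?mulr1n ?mulr0n /=; lia.
Unshelve. all: by end_near. Qed.

End monomial_calculus.

Section circle_cosine.
Context (R : realType).
Local Notation Rm := (measurableTypeR R).
Local Notation unif := ([the {sigma_finite_measure set (measurableTypeR R) -> \bar R}
  of uniform_prob (@two_pi_gt0 R)]).

Lemma expi_turn (m : int) (y : R) : expi 0 (y + m%:~R * (2 * pi)) = expi 0 y :> cplx R.
Proof.
rewrite -[X in expi X _](addr0 (0 : R)) expiD -[X in _ * expi X _](mulr0 (m%:~R : R)) -expiXz.
have -> : expi 0 (2 * pi) = 1 :> cplx R by have := expi_period (0 : R) 0; rewrite add0r expi0.
by rewrite exp1rz mulr1.
Qed.

Lemma measurable_cosine d (T : measurableType d) (f : T -> R) :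
  measurable_fun setT f -> measurable_fun setT (fun t => (1 + cos (f t))%:E).
Proof.
move=> mf; apply/measurable_EFinP; apply: measurable_funD; first exact: measurable_cst.
by apply: measurableT_comp mf; apply: continuous_measurable_fun; exact: continuous_cos.
Qed.

Lemma cosine_ge0 (x : R) : (0 <= (1 + cos x)%:E)%E.
Proof. by rewrite lee_fin; have := cos_geN1 x; lra. Qed.

Lemma circle_cosine (m : int) (c : R) : m != 0 ->
  (\int[unif]_a (1 + cos (c + m%:~R * (a : R)))%:E = 1)%E.
Proof.
move=> m0; have mR : (m%:~R : R) != 0 by rewrite intr_eq0.
rewrite integral_uniform; last 2 first.
- apply: measurable_cosine; apply: measurable_funD; first exact: measurable_cst.
  by apply: measurable_funM; [exact: measurable_cst|exact: measurable_id].
- by move=> a; exact: cosine_ge0.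
pose F (x : R) : R := x + m%:~R^-1 * sin (c + m%:~R * x).
have dF (x : R) : is_derive x (1 : R) F (1 + cos (c + m%:~R * x)).
  rewrite /F; apply: is_derive_eq.
  by rewrite -![_ *: _]/(_ * _); field.
have cF (x : R) : {for x, continuous F}.
  by apply/differentiable_continuous/derivable1_diffP; have [] := dF x.
rewrite (@continuous_FTC2 _ _ F).
- have -> : F (2 * pi) = 2 * pi + F 0.
    rewrite /F add0r mulr0 addr0; congr (_ + _ * _).
    by have /(congr1 (@complex.Im R)) /= := expi_turn m c; rewrite expR0 !mul1r.
  rewrite subr0 -EFinB addrK -EFinM mulVf//; exact/lt0r_neq0/two_pi_gt0.
- exact: two_pi_gt0.
- apply: continuous_subspaceT => x; apply: (@continuousD R R^o).
    exact: cst_continuous.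
  apply: continuous_comp; last exact: continuous_cos.
  apply: (@continuousD R R^o); first exact: cst_continuous.
  by apply: (@continuousM R); [exact: cst_continuous|exact: cvg_id].
- split=> [x _||]; first by have [] := dF x.
    by apply: cvg_at_right_filter; exact: cF.
  by apply: cvg_at_left_filter; exact: cF.
- by move=> x _; rewrite derive1E; have [_ ->] := dF x.
Qed.

Lemma torus_cosine n (d : 'I_n -> int) (c : R) : (exists i, d i != 0) ->
  (\int[power_measure unif n]_s
     (1 + cos (c + \sum_i (d i)%:~R * (tnth s i : R)))%:E = 1)%E.
Proof.
elim: n d c => [|n IH] d c [i di]; first by case: i di.
rewrite ge0_integral_power; last 2 first.
- apply: measurable_cosine; apply: measurable_funD; first exact: measurable_cst.
  apply: measurable_sum => j; apply: measurable_funM; first exact: measurable_cst.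
  exact: measurable_tnth.
- by move=> s; exact: cosine_ge0.
have E a s : c + \sum_j (d j)%:~R * (tnth (cons_pair (a, s)) j : R) =
    (c + (d ord0)%:~R * (a : R)) + \sum_j (d (lift ord0 j))%:~R * (tnth s j : R).
  rewrite big_ord_recl tnth_cons0 addrA; congr (_ + _).
  by apply: eq_bigr => j _; rewrite tnth_consS.
under eq_integral => a _ do under eq_integral => s _ do rewrite E.
case: (pselect (exists j, d (lift ord0 j) != 0)) => [ex|nex].
  under eq_integral => a _ do rewrite (IH (fun j => d (lift ord0 j)) _ ex).
  by rewrite integral_cst// mul1e; exact: probability_setT.
have d0 j : d (lift ord0 j) = 0.
  by apply/eqP; apply: contrapT => /negP H; apply: nex; exists j.
have d00 : d ord0 != 0.
  by move: di; case: (unliftP ord0 i) => [j ->|->//]; rewrite d0 eqxx.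
rewrite -[RHS](circle_cosine c d00); apply: eq_integral => a _.
under eq_integral => s _.
  rewrite big1; last by move=> j _; rewrite d0 mul0r.
  rewrite addr0.
  over.
exact: unif_mass.
Qed.

End circle_cosine.

Section orthogonality.
Context (R : realType) (n : nat) (K : set 'rV[R]_n) (phi : 'rV[R]_n -> R).
Context (D : nat) (M : R) (tm : tame K phi D M) (k : nat).
Local Notation C := (cplx R).
Local Notation Rm := (measurableTypeR R).
Local Notation unif := ([the {sigma_finite_measure set (measurableTypeR R) -> \bar R}
  of uniform_prob (@two_pi_gt0 R)]).
Local Notation leb := (@lebesgue_measure R).
Implicit Types (m : 'rV[int]_n).
Let phi_cts := tame_continuous tm.

Lemma monomial_zmonomial m (z : 'rV[C]_n) : monomial m z = zmonomial m z.
Proof.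
case: (pselect (torus z)) => tz.
  by rewrite monomialE//; apply: eq_bigr => i _; rewrite /zpow (negbTE (tz i)).
rewrite monomial_out//; have [i zi] : exists i, z 0 i = 0.
  by apply: contrapT => H; apply: tz => i; apply/eqP => zi; apply: H; exists i.
by rewrite /zmonomial (bigD1 i)//= /zpow zi eqxx mul0r.
Qed.

Lemma monomial_differentiable m z : torus z -> differentiable (@monomial R n m) z.
Proof.
move=> tz; rewrite (_ : @monomial R n m = zmonomial m); first exact: zmonomial_differentiable.
by apply/funext => y; exact: monomial_zmonomial.
Qed.

Lemma Hk_monomial m : hnorm phi k (@monomial R n m) != 0 -> Hk phi k (@monomial R n m).
Proof.
move=> h0; split.
- by move=> z tz; exact: monomial_differentiable.
- by move=> z tz; exact: monomial_out.
- rewrite ltNge leye_eq; apply/negP => /eqP E; move/eqP: h0; apply.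
  by rewrite /hnorm E /= sqrtr0.
Qed.

Lemma expi_sum (I : Type) (r : seq I) (f g : I -> R) :
  \prod_(i <- r) expi (f i) (g i) = expi (\sum_(i <- r) f i) (\sum_(i <- r) g i) :> C.
Proof.
elim: r => [|i r IH]; first by rewrite !big_nil expi0.
by rewrite !big_cons IH expiD.
Qed.

Lemma nu_cosine (A : 'rV[R]_n * 'rV[R]_n -> R) (d : 'I_n -> int) (c : R) :
  (forall p, 0 <= A p) -> (forall x th th', A (x, th) = A (x, th')) ->
  measurable_fun setT A -> (nu R n).-integrable setT (EFin \o A) ->
  (exists i, d i != 0) ->
  \int[nu R n]_p (A p * cos (c + \sum_i (d i)%:~R * p.2 0 i)) = 0.
Proof.
move=> A0 Ax mA iA di.
pose cs (p : 'rV[R]_n * 'rV[R]_n) : R := cos (c + \sum_i (d i)%:~R * p.2 0 i).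
rewrite -[LHS]/(\int[nu R n]_p (A p * cs p)).
have mcs : measurable_fun setT (fun p => (1 + cs p)%:E).
  apply/measurable_EFinP; apply: measurable_rows.
  have := @measurable_cosine R _ _ (fun p : n.-tuple Rm * n.-tuple Rm =>
    c + \sum_i (d i)%:~R * (tnth p.2 i : R)).
  rewrite (_ : (fun p => (1 + cs _)%R) = (fun p : n.-tuple Rm * n.-tuple Rm =>
    1 + cos (c + \sum_i (d i)%:~R * (tnth p.2 i : R)))); last first.
    apply/funext => p; rewrite /cs /=; congr (_ + cos (_ + _)).
    by apply: eq_bigr => i _; rewrite mxE.
  move=> H; apply/measurable_EFinP; apply: H.
  apply: measurable_funD; first exact: measurable_cst.
  apply: measurable_sum => i; apply: measurable_funM; first exact: measurable_cst.
  exact: (measurableT_comp (measurable_tnth i) measurable_snd).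
have mAcs : measurable_fun setT (EFin \o (fun p => A p * (1 + cs p))).
  apply/measurable_EFinP; apply: measurable_funM => //; exact/measurable_EFinP.
have cs2 p : 0 <= 1 + cs p <= 2 by rewrite /cs; have := cos_geN1 (c + \sum_i (d i)%:~R * p.2 0 i);
  have := cos_le1 (c + \sum_i (d i)%:~R * p.2 0 i); lra.
have iAcs : (nu R n).-integrable setT (EFin \o (fun p => A p * (1 + cs p))).
  apply: (le_integrable measurableT mAcs _ (integrableZl measurableT 2 iA)) => p _ /=.
  have /andP[c0 c2] := cs2 p.
  rewrite lee_fin ger0_norm ?mulr_ge0// ger0_norm ?mulr_ge0// mulrC ler_wpM2r//.
have E : \int[nu R n]_p (A p * (1 + cs p)) = \int[nu R n]_p A p.
  have p1 p : (0 <= (EFin \o (fun p => (A p * (1 + cs p))%R)) p)%E.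
    by have /andP[c0 _] := cs2 p; rewrite /= lee_fin mulr_ge0.
  have p2 p : (0 <= (EFin \o A) p)%E by rewrite /= lee_fin.
  have mA' : measurable_fun setT (EFin \o A) by exact/measurable_EFinP.
  rewrite /Rintegral; congr (fine _).
  rewrite [LHS](ge0_integral_nu mAcs p1) [RHS](ge0_integral_nu mA' p2).
  apply: eq_integral => t _; pose th0 : 'rV[R]_n := 0.
  rewrite (eq_integral (fun s : n.-tuple Rm => (A (row_of_tuple t, th0))%:E *
     (1 + cos (c + \sum_i (d i)%:~R * (tnth s i : R)))%:E)%E); last first.
    move=> s _; rewrite [LHS]/= EFinM (Ax _ _ th0) /cs; congr (_ * (1 + cos (c + _))%:E)%E.
    by apply: eq_bigr => i _; rewrite mxE.
  rewrite ge0_integralZl//; last 2 first.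
  - apply: measurable_cosine; apply: measurable_funD; first exact: measurable_cst.
    apply: measurable_sum => j; apply: measurable_funM; first exact: measurable_cst.
    exact: measurable_tnth.
  - by rewrite lee_fin.
  rewrite torus_cosine// mule1; apply/esym.
  rewrite (eq_integral (cst (A (row_of_tuple t, th0))%:E)); first exact: unif_mass.
  by move=> s _; rewrite [LHS]/= (Ax _ _ th0).
have -> : \int[nu R n]_p (A p * cs p) = \int[nu R n]_p (A p * (1 + cs p) - A p).
  by congr (fine _); apply: eq_integral => p _; congr EFin; ring.
by rewrite RintegralB// E subrr.
Qed.

Lemma inner_monomial m m' : m != m' -> Hk phi k (@monomial R n m) -> Hk phi k (@monomial R n m') ->
  inner phi k (@monomial R n m) (@monomial R n m') = 0.
Proof.
move=> mm' Hm Hm'.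
pose e (u : 'rV[int]_n) (x : 'rV[R]_n) := \sum_i (u 0 i)%:~R * (x 0 i / 2).
pose a (u : 'rV[int]_n) (th : 'rV[R]_n) := \sum_i (u 0 i)%:~R * th 0 i.
have pm u p : pull (@monomial R n u) p = expi (e u p.1) (a u p.2) by rewrite /pull monomial_torus_point expi_sum.
pose A p := expR (e m p.1 + e m' p.1) * weight phi k p.
pose d i := m 0 i - m' 0 i.
have ad (p : 'rV[R]_n * 'rV[R]_n) : \sum_i (d i)%:~R * p.2 0 i = a m p.2 - a m' p.2.
  by rewrite /a -sumrB; apply: eq_bigr => i _; rewrite /d intrB mulrBl.
have A0 p : 0 <= A p by rewrite mulr_ge0 ?expR_ge0// ltW// weight_gt0.
have AE p : A p = modulus (pull (@monomial R n m) p) * modulus (pull (@monomial R n m') p) * weight phi k p.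
  by rewrite !pm !modulus_expi -expRD.
have mA : measurable_fun setT A.
  rewrite (_ : A = fun p => modulus (pull (@monomial R n m) p) * modulus (pull (@monomial R n m') p) * weight phi k p); last exact/funext.
  apply: measurable_funM; last exact: (measurable_weight phi_cts).
  by apply: measurable_funM; apply: differentiable_pull_measurable => z tz; exact: monomial_differentiable.
have iA : (nu R n).-integrable setT (EFin \o A).
  apply: (le_integrable measurableT _ _ (integrableL 1 1 (integrable_sq tm Hm) (integrable_sq tm Hm'))).
    exact/measurable_EFinP.
  move=> p _ /=; rewrite lee_fin ger0_norm// AE (le_trans _ (ler_norm _))// !mul1r -mulrDl.
  rewrite ler_pM2r ?weight_gt0//.
  have := sqr_ge0 (modulus (pull (@monomial R n m) p) - modulus (pull (@monomial R n m') p)).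
  have := sqr_ge0 (modulus (pull (@monomial R n m) p)); have := sqr_ge0 (modulus (pull (@monomial R n m') p)).
  by rewrite sqrrB; set x := modulus _; set y := modulus (pull (@monomial R n m') p); lra.
have dn : exists i, d i != 0.
  apply: contrapT => H; move/eqP: mm'; apply; apply/rowP => i; apply/eqP.
  by rewrite -subr_eq0; apply: contrapT => /negP H'; apply: H; exists i.
have Ax x th th' : A (x, th) = A (x, th') by [].
have N c := nu_cosine c A0 Ax mA iA dn.
have hE p : herm phi k (@monomial R n m) (@monomial R n m') p =
    ((A p * cos (0 + (a m p.2 - a m' p.2))) +i* (A p * cos (- (pi / 2) + (a m p.2 - a m' p.2))))%C.
  have cs t : cos (- (pi / 2) + t) = sin t by rewrite addrC cosBpihalf.
  rewrite cs add0r cosB sinB /herm !pm /A expRD.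
  by apply/eqP; rewrite eq_complex /=; apply/andP; split; apply/eqP; ring.
rewrite innerE /cint; apply/eqP; rewrite eq_complex /=; apply/andP; split; apply/eqP.
  rewrite -[RHS](N 0); congr (fine _); apply: eq_integral => p _.
  by rewrite hE ad.
rewrite -[RHS](N (- (pi / 2))); congr (fine _); apply: eq_integral => p _.
by rewrite hE ad.
Qed.

End orthogonality.

Section projections.
Context (R : realType) (n : nat) (K : set 'rV[R]_n) (phi : 'rV[R]_n -> R).
Context (D : nat) (M : R) (tm : tame K phi D M) (k : nat) (k0 : (0 < k)%N).
Local Notation C := (cplx R).
Local Notation fn := ('rV[C]_n -> C).
Local Notation cj z := (conjc (z : R[i]) : C).
Local Notation ip := (inner phi k).
Local Notation Hk := (Hk phi k).
Implicit Types (f g h s : fn) (a b : C) (m : 'rV[int]_n).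

Lemma cjM a b : cj (a * b) = cj a * cj b.
Proof. by case: a b => [? ?] [? ?]; apply/eqP; rewrite eq_complex /=; apply/andP; split; apply/eqP; ring. Qed.

Lemma cjD a b : cj (a + b) = cj a + cj b.
Proof. by case: a b => [? ?] [? ?]; apply/eqP; rewrite eq_complex /=; apply/andP; split; apply/eqP; ring. Qed.

Lemma cj_real (r : R) : cj (r%:C)%C = (r%:C)%C.
Proof. by rewrite /= oppr0. Qed.

Lemma mul_cj a : a * cj a = ((modulus a ^+ 2)%:C)%C.
Proof.
by rewrite modulus_sqr; case: a => ? ?; apply/eqP; rewrite eq_complex /=; apply/andP; split; apply/eqP; ring.
Qed.

Lemma HkZ a f : Hk f -> Hk (fun z => a * f z).
Proof.
move=> Hf; have := HkL tm a 0 Hf Hf; congr Hk.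
by apply/funext => z; rewrite mul0r addr0.
Qed.

Lemma innerZ a f h : Hk f -> Hk h -> ip (fun z => a * f z) h = a * ip f h.
Proof.
move=> Hf Hh; have -> : (fun z => a * f z) = (fun z => a * f z + 0 * f z).
  by apply/funext => z; rewrite mul0r addr0.
by rewrite (innerL tm)// mul0r addr0.
Qed.

Lemma innerLr a b f g h : Hk f -> Hk g -> Hk h ->
  ip h (fun z => a * f z + b * g z) = cj a * ip h f + cj b * ip h g.
Proof.
move=> Hf Hg Hh; have HL := HkL tm a b Hf Hg.
by rewrite (inner_conj tm HL Hh) (innerL tm)// cjD !cjM -(inner_conj tm Hf Hh) -(inner_conj tm Hg Hh).
Qed.

Lemma HkB f g : Hk f -> Hk g -> Hk (fun z => f z - g z).
Proof.
move=> Hf Hg; have := HkL tm 1 (-1) Hf Hg; congr Hk.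
by apply/funext => z; rewrite mul1r mulN1r.
Qed.

Lemma innerB f g h : Hk f -> Hk g -> Hk h -> ip (fun z => f z - g z) h = ip f h - ip g h.
Proof.
move=> Hf Hg Hh; have -> : (fun z => f z - g z) = (fun z => 1 * f z + (-1) * g z).
  by apply/funext => z; rewrite mul1r mulN1r.
by rewrite (innerL tm)// mul1r mulN1r.
Qed.

Lemma Hk_sum (I : Type) (r : seq I) (a : I -> C) (f : I -> fn) :
  (forall i, Hk (f i)) -> Hk (fun z => \sum_(i <- r) a i * f i z).
Proof.
move=> Hf; elim: r => [|i r IH].
  by have := Hk0 phi k; congr Hk; apply/funext => z; rewrite big_nil.
have := HkL tm (a i) 1 (Hf i) IH; congr Hk.
by apply/funext => z; rewrite big_cons mul1r.
Qed.

Lemma inner_sum (I : Type) (r : seq I) (a : I -> C) (f : I -> fn) h :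
  (forall i, Hk (f i)) -> Hk h ->
  ip (fun z => \sum_(i <- r) a i * f i z) h = \sum_(i <- r) a i * ip (f i) h.
Proof.
move=> Hf Hh; elim: r => [|i r IH].
  have -> : (fun z => \sum_(i <- [::]) a i * f i z) = (fun z => 0 * h z).
    by apply/funext => z; rewrite big_nil mul0r.
  by rewrite innerZ// big_nil mul0r.
have -> : (fun z => \sum_(j <- i :: r) a j * f j z) =
    (fun z => a i * f i z + 1 * (\sum_(j <- r) a j * f j z)).
  by apply/funext => z; rewrite big_cons mul1r.
by rewrite (innerL tm)//; [rewrite mul1r IH big_cons|exact: Hk_sum].
Qed.

Lemma cauchy_schwarz f g : Hk f -> Hk g -> modulus (ip f g) <= hnorm phi k f * hnorm phi k g.
Proof.
move=> Hf Hg; have := hnorm_ge0 phi k g; rewrite le_eqVlt => /predU1P[g0|g0].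
  rewrite -g0 mulr0 (hnorm_eq0 tm Hg (esym g0)).
  have -> : ip f (fun=> 0) = 0; last by rewrite modulus0.
  have -> : (fun=> 0) = (fun z => 0 * f z + 0 * f z) by apply/funext => z; rewrite mul0r addr0.
  by rewrite innerLr// (_ : cj 0 = 0) ?mul0r ?addr0//; exact: (cj_real 0).
pose F := hnorm phi k f; pose G := hnorm phi k g.
set I := ip f g; pose GC : C := ((G ^+ 2)%:C)%C.
have HL := HkL tm GC (- I) Hf Hg; set w := fun z => _ in HL.
have gw : ip g w = 0.
  rewrite (inner_conj tm HL Hg) /w (innerL tm)// inner_norm mulNr -/G -/GC [I * _]mulrC.
  by rewrite subrr; exact: (cj_real 0).
have ww : ip w w = ((G ^+ 2 * (G ^+ 2 * F ^+ 2 - modulus I ^+ 2))%:C)%C.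
  rewrite {1}/w (innerL tm)// gw mulr0 addr0 (inner_conj tm HL Hf) /w (innerL tm)// inner_norm -/F.
  rewrite mulNr [ip g f](inner_conj tm Hf Hg) -/I mul_cj.
  by apply/eqP; rewrite eq_complex /=; apply/andP; split; apply/eqP; ring.
have : 0 <= G ^+ 2 * (G ^+ 2 * F ^+ 2 - modulus I ^+ 2).
  by have := inner_norm phi k w; rewrite ww => -[->]; exact: sqr_ge0.
rewrite pmulr_rge0 ?exprn_gt0// subr_ge0 -exprMn ler_sqr ?nnegrE ?modulus_ge0//.
  by rewrite mulrC.
by rewrite mulr_ge0 ?hnorm_ge0.
Qed.

Definition subspace_of_Hk (V : set fn) : Prop :=
  [/\ V `<=` Hk, V (fun=> 0) &
      forall a b f g, V f -> V g -> V (fun z => a * f z + b * g z)].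

Definition orthonormal r (e : 'I_r -> fn) : Prop :=
  forall i j, ip (e i) (e j) = (i == j)%:R.

Lemma orthonormal_size r (e : 'I_r -> fn) : (forall i, Hk (e i)) -> orthonormal e ->
  (r <= size (lat K D k))%N.
Proof.
move=> He oe; rewrite leqNgt; apply/negP => lt.
have /choice[c cE] i : exists c, laurent_on (lat K D k) c (e i) by exact: (Hk_laurent tm k0 (He i)).
pose A : 'M[C]_(r, size (lat K D k)) := \matrix_(i, j) c i (nth 0 (lat K D k) j).
have : kermx A != 0.
  rewrite kermx_eq0 /row_free; apply/negP => /eqP E.
  by have := rank_leq_col A; rewrite E leqNgt lt.
move=> /rowV0Pn[u /sub_kermxP uA /eqP u0]; apply: u0; apply/rowP => j; rewrite mxE.
have <- : ip (fun z => \sum_i u 0 i * e i z) (e j) = u 0 j.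
  rewrite inner_sum// (bigD1 j)//= oe eqxx mulr1 big1 ?addr0// => i ij.
  by rewrite oe (negbTE ij) mulr0.
have -> : (fun z => \sum_i u 0 i * e i z) = (fun z => 0 * e j z); last by rewrite innerZ// mul0r.
apply/funext => z; rewrite mul0r; case: (pselect (torus z)) => tz; last first.
  by rewrite big1// => i _; have [_ -> //] := He i; rewrite mulr0.
under eq_bigr => i _ do rewrite cE// mulr_sumr (big_nth 0) big_mkord.
rewrite exchange_big big1//= => l _.
under eq_bigr do rewrite mulrA.
rewrite -mulr_suml; have /rowP/(_ l) := uA; rewrite !mxE => E.
rewrite [X in X * _](_ : _ = 0) ?mul0r// -[RHS]E.
by apply: eq_bigr => i _; rewrite mxE.
Qed.

Lemma projection_exists V f : subspace_of_Hk V -> Hk f ->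
  exists g, V g /\ forall h, V h -> ip (fun z => f z - g z) h = 0.
Proof.
move=> [VH V0 VL] Hf.
pose P r := `[< exists e : 'I_r -> fn, (forall i, V (e i)) /\ orthonormal e >].
have exP : exists r, P r.
  by exists 0; apply/asboolP; exists (fun _ => fun=> 0); split=> -[].
have bP r : P r -> (r <= size (lat K D k))%N.
  by move=> /asboolP[e [Ve oe]]; apply: (orthonormal_size _ oe) => i; exact/VH.
case: (ex_maxnP exP bP) => r /asboolP[e [Ve oe]] rmax.
have He i : Hk (e i) by exact: VH.
have VS (a : 'I_r -> C) : V (fun z => \sum_i a i * e i z).
  elim: (index_enum 'I_r) => [|i s IH].
    by move: V0; congr V; apply/funext => z; rewrite big_nil.
  have := VL (a i) 1 _ _ (Ve i) IH; congr V.
  by apply/funext => z; rewrite big_cons mul1r.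
pose co h i := ip h (e i).
pose pr h : fn := fun z => \sum_i co h i * e i z.
have orth h i : Hk h -> ip (fun z => h z - pr h z) (e i) = 0.
  move=> Hh; rewrite innerB//; last exact/VH/VS.
  rewrite inner_sum// (bigD1 i)//= oe eqxx mulr1 big1 ?addr0 ?subrr// => j ji.
  by rewrite oe (negbTE ji) mulr0.
exists (pr f); split=> [|h Vh]; first exact: VS.
have Hh := VH _ Vh.
have Hpf : Hk (fun z => f z - pr f z) by apply: HkB => //; exact/VH/VS.
suff hE : h = pr h.
  rewrite (inner_conj tm Hh Hpf) hE inner_sum// big1 => [|i _]; first exact: (cj_real 0).
  by rewrite (inner_conj tm Hpf)// orth// (_ : cj 0 = 0) ?mulr0//; exact: (cj_real 0).
pose h' : fn := fun z => h z - pr h z.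
have Vh' : V h'.
  have := VL 1 (-1) _ _ Vh (VS (co h)); congr V.
  by apply/funext => z; rewrite mul1r mulN1r.
have Hh' := VH _ Vh'.
suff h'0 : hnorm phi k h' = 0.
  have := hnorm_eq0 tm Hh' h'0; move=> E; apply/funext => z.
  by have := congr1 (fun F => F z) E; rewrite /h' => /eqP; rewrite subr_eq0 => /eqP.
apply/eqP; apply: contrapT => /negP N0; set N := hnorm _ _ _ in N0.
pose NC : C := (N^-1%:C)%C.
pose e' (i : 'I_r.+1) : fn := if unlift ord0 i is Some j then e j else fun z => NC * h' z.
suff /rmax : P r.+1 by rewrite ltnn.
have he j : ip h' (e j) = 0 by exact: orth.
have eh j : ip (e j) h' = 0.
  by rewrite (inner_conj tm Hh')// he; exact: (cj_real 0).
have HN := HkZ NC Hh'.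
have hN g : Hk g -> ip g (fun z => NC * h' z) = NC * ip g h'.
  move=> Hg; rewrite (inner_conj tm HN Hg) innerZ// cjM -(inner_conj tm Hh' Hg).
  by rewrite (_ : cj NC = NC)//; exact: cj_real.
apply/asboolP; exists e'; split=> [i|i j].
  rewrite /e'; case: (unliftP ord0 i) => [j _|_]; first exact: Ve.
  have := VL NC 0 _ _ Vh' V0; congr V; apply/funext => z; by rewrite mulr0 addr0.
rewrite /e'; case: (unliftP ord0 i) => [i' ->|->]; case: (unliftP ord0 j) => [j' ->|->].
- by rewrite oe (inj_eq (@lift_inj _ _)).
- by rewrite hN// eh mulr0 eq_sym (negbTE (neq_lift _ _)).
- by rewrite innerZ// he mulr0 (negbTE (neq_lift _ _)).
- rewrite hN// innerZ// inner_norm -/N eqxx mulrA.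
  apply/eqP; rewrite eq_complex /=; apply/andP; split; apply/eqP; last by ring.
  by field.
Qed.

Lemma orth_projP V f : subspace_of_Hk V -> Hk f ->
  V (orth_proj phi k V f) /\
  forall h, V h -> ip (fun z => f z - orth_proj phi k V f z) h = 0.
Proof. by move=> sV Hf; have := xgetPex (fun=> 0) (projection_exists sV Hf). Qed.

Lemma spectral_estimate (V : nat -> set fn) N q s :
  (forall j, subspace_of_Hk (V j)) -> (forall i j, (i <= j)%N -> V j `<=` V i) ->
  (1 <= q <= N)%N -> Hk s ->
  hnorm phi k (fun z => s z - orth_proj phi k (V q) s z) <=
  hnorm phi k (fun z => \sum_(1 <= j < N.+1) orth_proj phi k (V j) s z - q%:R * s z).
Proof.
move=> sV nV /andP[q1 qN] Hs.
pose p j := orth_proj phi k (V j) s.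
have Vp j : V j (p j) by have [] := orth_projP (sV j) Hs.
have Hp j : Hk (p j) by have [VH _ _] := sV j; exact/VH/Vp.
have pO j h : V j h -> ip (fun z => s z - p j z) h = 0 by have [_] := orth_projP (sV j) Hs; exact.
set e := fun z => s z - _; set u := fun z => _ - _.
have He : Hk e := HkB Hs (Hp q).
have uE : u = (fun z => 1 * (\sum_(j <- index_iota 1 N.+1) 1 * p j z) + (- q%:R) * s z).
  by apply/funext => z; rewrite /u mul1r mulNr; congr (_ - _); apply: eq_bigr => j _; rewrite mul1r.
have HS : Hk (fun z => \sum_(j <- index_iota 1 N.+1) 1 * p j z) by exact: Hk_sum.
have Hu : Hk u by rewrite uE; exact: (HkL tm _ _ HS Hs).
have nE := inner_norm phi k e; set E := hnorm phi k e in nE *.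
have ep : ip (p q) e = 0.
  by rewrite (inner_conj tm He)// pO//; exact: (cj_real 0).
have se : ip s e = ((E ^+ 2)%:C)%C.
  have H : ip e e = ip s e - ip (p q) e by exact: (innerB Hs (Hp q) He).
  by rewrite -nE H ep subr0.
have pj_big j : (q <= j)%N -> ip (p j) e = 0.
  by move=> qj; rewrite (inner_conj tm He)// pO; [exact: (cj_real 0)|exact/(nV _ _ qj)/Vp].
have ReB (x y : C) : complex.Re (x - y) = complex.Re x - complex.Re y by rewrite raddfB.
have pj_small j : (j <= q)%N -> complex.Re (ip (p j) e) <= E ^+ 2.
  move=> jq; have Hj : Hk (fun z => s z - p j z) by exact: HkB.
  have : ip (fun z => s z - p j z) (fun z => s z - p j z) = ip (fun z => s z - p j z) e.
    have dE : (fun z => s z - p j z) = (fun z => 1 * e z + 1 * (p q z - p j z)).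
      by apply/funext => z; rewrite !mul1r /e addrA subrK.
    have HD := HkB (Hp q) (Hp j).
    rewrite [X in ip _ X]dE (innerLr _ _ He HD Hj) (_ : cj 1 = 1); last exact: (cj_real 1).
    rewrite !mul1r [X in _ + X](_ : _ = 0) ?addr0//; apply: pO.
    have [_ _ VL] := sV j; have := VL 1 (-1) _ _ (nV _ _ jq _ (Vp q)) (Vp j); congr (V j).
    by apply/funext => z; rewrite mul1r mulN1r.
  rewrite inner_norm (innerB Hs (Hp j) He) se => /(congr1 (@complex.Re R)); rewrite ReB => H.
  have H' : hnorm phi k (fun z => s z - p j z) ^+ 2 = E ^+ 2 - complex.Re (ip (p j) e) := H.
  by have := sqr_ge0 (hnorm phi k (fun z => s z - p j z)); rewrite H' subr_ge0.
have ReD (x y : C) : complex.Re (x + y) = complex.Re x + complex.Re y by rewrite raddfD.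
have ue : complex.Re (ip u e) <= - E ^+ 2.
  rewrite uE (innerL tm)// mul1r inner_sum// se.
  have -> : \sum_(i <- index_iota 1 N.+1) 1 * ip (p i) e = \sum_(1 <= i < q) ip (p i) e.
    rewrite -/(\sum_(1 <= i < N.+1) 1 * ip (p i) e) (big_cat_nat q1 (leqW qN))/=.
    rewrite [X in _ + X]big_nat [X in _ + X]big1 ?addr0 => [|i /andP[qi _]]; last by rewrite pj_big// mulr0.
    by apply: eq_bigr => i _; rewrite mul1r.
  have Req (x : R) : complex.Re (- q%:R * (x%:C)%C : C) = - q%:R * x.
    rewrite (_ : (q%:R : C) = (q%:R%:C)%C); last by rewrite rmorph_nat.
    by rewrite /=; ring.
  rewrite ReD Req.
  have -> : complex.Re (\sum_(1 <= i < q) ip (p i) e) = \sum_(1 <= i < q) complex.Re (ip (p i) e).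
    by rewrite raddf_sum.
  have : \sum_(1 <= i < q) complex.Re (ip (p i) e) <= \sum_(1 <= i < q) E ^+ 2.
    by apply: ler_sum_nat => i /andP[_ iq]; exact/pj_small/ltnW.
  rewrite [leRHS]sumr_const_nat -[leRHS]mulr_natl natrB// => H.
  by apply: le_trans (lerD H (lexx _)) _; lra.
have : E ^+ 2 <= hnorm phi k u * E.
  apply: le_trans (cauchy_schwarz Hu He); apply: le_trans (le_Re_modulus _).
  by rewrite -normrN (le_trans _ (ler_norm _))// lerNr.
have := hnorm_ge0 phi k e; rewrite -/E le_eqVlt => /predU1P[<- _|E0]; first exact: hnorm_ge0.
by rewrite expr2 ler_pM2r.
Qed.

End projections.

Section weights.
Context (R : realType) (n : nat) (K : set 'rV[R]_n) (phi : 'rV[R]_n -> R).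
Context (D : nat) (M : R) (tm : tame K phi D M) (k : nat) (k0 : (0 < k)%N).
Local Notation C := (cplx R).
Local Notation fn := ('rV[C]_n -> C).
Local Notation ip := (inner phi k).
Local Notation Hk := (Hk phi k).
Local Notation mono := (@monomial R n).
Local Notation sk := (sk phi k).
Implicit Types (f g h : fn) (a b : C) (m : 'rV[int]_n) (v : 'rV[R]_n).

Lemma sk_eq0 m : hnorm phi k (mono m) = 0 -> sk m = (fun=> 0).
Proof. by move=> h0; apply/funext => z; rewrite /Defs.sk h0 invr0 mul0r. Qed.

Lemma Hk_sk m : Hk (sk m).
Proof.
have [/eqP/sk_eq0 ->|h0] := boolP (hnorm phi k (mono m) == 0); first exact: Hk0.
exact: (HkZ tm _ (Hk_monomial h0)).
Qed.

Lemma inner0l h : Hk h -> ip (fun=> 0) h = 0.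
Proof.
move=> Hh; have -> : (fun=> 0) = (fun z => 0 * h z) by apply/funext => z; rewrite mul0r.
by rewrite (innerZ tm)// mul0r.
Qed.

Lemma inner0r h : Hk h -> ip h (fun=> 0) = 0.
Proof.
by move=> Hh; rewrite (inner_conj tm (Hk0 phi k) Hh) inner0l//; exact: (cj_real 0).
Qed.

Lemma inner_sk m m' : m != m' -> ip (sk m) (sk m') = 0.
Proof.
move=> mm'.
have [/eqP/sk_eq0 ->|h0] := boolP (hnorm phi k (mono m) == 0); first by apply: inner0l; exact: Hk_sk.
have [/eqP/sk_eq0 ->|h0'] := boolP (hnorm phi k (mono m') == 0); first by apply: inner0r; exact: Hk_sk.
have Hm := Hk_monomial h0; have Hm' := Hk_monomial h0'.
rewrite /Defs.sk (innerZ tm _ Hm (HkZ tm _ Hm')) (inner_conj tm (HkZ tm _ Hm') Hm).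
rewrite (innerZ tm _ Hm' Hm) (inner_monomial tm _ Hm' Hm) 1?eq_sym//.
by rewrite mulr0 [X in _ * X](_ : _ = 0) ?mulr0//; exact: (cj_real 0).
Qed.

Lemma hnorm_sk m : hnorm phi k (mono m) != 0 -> hnorm phi k (sk m) = 1.
Proof.
move=> h0; have Hm := Hk_monomial h0; set N := hnorm _ _ _ in h0.
have : ip (sk m) (sk m) = 1.
  rewrite /Defs.sk (innerZ tm _ Hm (HkZ tm _ Hm)) (inner_conj tm (HkZ tm _ Hm) Hm).
  rewrite (innerZ tm _ Hm Hm) inner_norm -/N.
  by apply/eqP; rewrite eq_complex /=; apply/andP; split; apply/eqP; first field; last ring.
rewrite inner_norm => -[/eqP]; rewrite sqrf_eq1 => /orP[/eqP//|/eqP E].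
by have := hnorm_ge0 phi k (sk m); rewrite E; lra.
Qed.

Lemma Sk_lat m : Sk K k m -> m \in lat K D k.
Proof. by move=> /interior_subset; rewrite (mem_lat tm) => H; apply/asboolP. Qed.

Lemma diag_op_sk (w : 'rV[int]_n -> nat) m z : Sk K k m -> hnorm phi k (mono m) != 0 ->
  diag_op K phi k w (sk m) z = (w m)%:R * sk m z.
Proof.
move=> Sm h0.
have off m' : m' != m -> (w m')%:R * ip (sk m) (sk m') * sk m' z = 0.
  by move=> m'm; rewrite inner_sk 1?eq_sym// mulr0 mul0r.
rewrite /diag_op -(@fsbig_widen _ _ _ _ [set m]).
- by rewrite fsbig_set1 inner_norm hnorm_sk// expr1n mulr1.
- by move=> _ ->.
- by move=> m' [_ m'm]; apply: off; apply/eqP => E; exact: m'm.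
Qed.

Lemma iter_partial_Hk f : Hk f -> exists a : 'rV[int]_n -> C,
  laurent_on (lat K D k) a f /\ forall s z, torus z ->
  iter_partial s f z = \sum_(m <- lat K D k) a m * (falling s m)%:~R * zmonomial (lower s m) z.
Proof.
move=> Hf; have [a aE] := Hk_laurent tm k0 Hf; exists a; split=> // s z tz.
apply: iter_partial_laurent => // y y0; rewrite aE//.
by apply: eq_bigr => m _; rewrite monomial_zmonomial.
Qed.

Lemma Fk_subspace z j : torus z -> subspace_of_Hk phi k (Fk phi k z j).
Proof.
move=> tz; split.
- by move=> f [].
- split; first exact: Hk0.
  move=> s _; have -> // : forall y, iter_partial s (fun=> 0 : C) y = 0.
  elim: s => [//|i s IH] y /=; rewrite /partial (_ : iter_partial s _ = cst 0); last exact/funext.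
  by rewrite derive_cst.
- move=> a b f g [Hf of_] [Hg og]; split; first exact: (HkL tm).
  move=> s sj; have [cf [_ fE]] := iter_partial_Hk Hf; have [cg [gE' gE]] := iter_partial_Hk Hg.
  have L y : torus y -> a * f y + b * g y = \sum_(m <- lat K D k) (a * cf m + b * cg m) * zmonomial m y.
    move=> ty; have := fE [::] y ty; have := gE [::] y ty; rewrite /= => -> ->.
    rewrite !mulr_sumr -big_split/=; apply: eq_bigr => m _.
    rewrite !mulr1 (_ : lower [::] m = m); first by ring.
    by apply/rowP => i; rewrite mxE subr0.
  rewrite (iter_partial_laurent L)//.
  have := of_ _ sj; have := og _ sj; rewrite fE// gE// => G F.
  transitivity (a * \sum_(m <- lat K D k) cf m * (falling s m)%:~R * zmonomial (lower s m) z +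
    b * \sum_(m <- lat K D k) cg m * (falling s m)%:~R * zmonomial (lower s m) z).
    by rewrite !mulr_sumr -big_split/=; apply: eq_bigr => m _; ring.
  by rewrite F G !mulr0 addr0.
Qed.

Lemma torus_degeneration v r : torus (degeneration_point v r).
Proof.
move=> i; rewrite mxE; apply/eqP => /(congr1 (@complex.Re R)) /= E.
by have := expR_gt0 (- (r * v 0 i)); rewrite E ltxx.
Qed.

(* products of affine functions of the exponent *)
Definition affine_product (t : seq ('I_n * int)) m : int := \prod_(ic <- t) (m 0 ic.1 - ic.2).

Lemma zmonomial_degeneration v r m :
  zmonomial m (degeneration_point v r) = ((expR (- (r * dotp v (of_lattice R m))))%:C)%C :> C.
Proof.
rewrite /zmonomial /dotp mulr_sumr.
have E (x : R) (l : int) : zpow l ((expR x)%:C)%C = ((expR (x * l%:~R))%:C)%C :> C.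
  have -> : ((expR x)%:C)%C = expi x 0 :> C.
    by apply/eqP; rewrite eq_complex /= cos0 sin0 mulr1 mulr0 !eqxx.
  rewrite /zpow (negbTE (expi_neq0 _ _)) expiXz mulr0.
  by apply/eqP; rewrite eq_complex /= cos0 sin0 mulr1 mulr0 mulrC !eqxx.
rewrite -sumrN expR_sum rmorph_prod; apply: eq_bigr => i _.
by rewrite !mxE E mulNr mulrA.
Qed.

Lemma affine_relations v r (a : 'rV[int]_n -> C) j :
  (forall s : seq 'I_n, (size s < j)%N ->
    \sum_(m <- lat K D k) a m * (falling s m)%:~R * zmonomial (lower s m) (degeneration_point v r) = 0) ->
  forall t, (size t < j)%N ->
    \sum_(m <- lat K D k) a m * zmonomial m (degeneration_point v r) * (affine_product t m)%:~R = 0.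
Proof.
move=> H t tj; pose w (m : 'rV[int]_n) : C := zmonomial m (degeneration_point v r).
suff : forall t s, (size t + size s < j)%N ->
    \sum_(m <- lat K D k) a m * w m * (falling s m)%:~R * (affine_product t m)%:~R = 0.
  move=> /(_ t [::]); rewrite addn0 => /(_ tj) E; rewrite -[RHS]E; apply: eq_bigr => m _.
  by rewrite /= mulr1.
move=> {tj}; elim=> {t} [|[i c] t IH] s ts.
  pose cs : 'rV[int]_n := \row_i - (count_mem i s)%:Z.
  have e0 : w cs != 0.
    rewrite /w zmonomial_degeneration; apply/eqP => /(congr1 (@complex.Re R)) /= E.
    by have := expR_gt0 (- (r * dotp v (of_lattice R cs))); rewrite E ltxx.
  have lw m : zmonomial (lower s m) (degeneration_point v r) = w m * w cs.
    have -> : lower s m = m + cs by apply/rowP => i; rewrite !mxE.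
    rewrite /w !zmonomial_degeneration (_ : of_lattice R (m + cs) = of_lattice R m + of_lattice R cs).
      by rewrite dotpDr mulrDr opprD expRD rmorphM.
    by apply/rowP => i; rewrite !mxE intrD.
  apply: (mulIf e0); rewrite mul0r -[RHS](H s ts) mulr_suml; apply: eq_bigr => m _.
  by rewrite /affine_product big_nil mulr1 lw; ring.
have H1 : (size t + size (i :: s) < j)%N by rewrite /= addnS.
have H2 : (size t + size s < j)%N by apply: leq_ltn_trans ts; rewrite leq_add2r.
have : \sum_(m <- lat K D k) a m * w m * (falling (i :: s) m)%:~R * (affine_product t m)%:~R +
   ((count_mem i s)%:Z - c)%:~R * \sum_(m <- lat K D k) a m * w m * (falling s m)%:~R * (affine_product t m)%:~R = 0.
  by rewrite (IH _ H1) (IH _ H2) mulr0 addr0.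
move=> E; rewrite -[RHS]E mulr_sumr -big_split/=; apply: eq_bigr => m _.
rewrite /affine_product big_cons /= !intrM !intrB -/(affine_product t m).
by ring.
Qed.

Lemma weight_vanishing v (q : nat -> 'rV[int]_n -> nat) m
    (T : seq (C * seq ('I_n * int))) (P := fun m => \sum_(ct <- T) ct.1 * (affine_product ct.2 m)%:~R : C) :
  toric_weights K phi v q -> Sk K k m -> hnorm phi k (mono m) != 0 ->
  (forall ct, ct \in T -> (size ct.2 < q k m)%N) ->
  (forall m', m' \in lat K D k -> dotp v (of_lattice R m') < dotp v (of_lattice R m) -> P m' = 0) ->
  P m = 0.
Proof.
move=> qw Sm h0 Tq Plow; have [q0|q0] := posnP (q k m).
  rewrite /P big1_seq// => ct /andP[_ /Tq]; by rewrite q0.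
have [/(_ _ Sm) qN qlim] := qw _ k0.
have Hs := Hk_sk m; set N := hnorm phi k (mono m) in h0.
have N0 : 0 < N by rewrite lt_neqAle eq_sym h0 hnorm_ge0.
have mlat := Sk_lat Sm.
have [A A0 HA] := Hk_bound tm k.
pose B := A * expR (k%:R * support_fun K 0 / 2).
have B0 : 0 <= B by rewrite mulr_ge0 ?expR_ge0// ltW.
have close (e : R) : 0 < e -> exists (r : R) (a : 'rV[int]_n -> C), 0 <= r /\
    (forall t, (size t < q k m)%N -> \sum_(m' <- lat K D k)
       a m' * zmonomial m' (degeneration_point v r) * (affine_product t m')%:~R = 0) /\
    forall m', m' \in lat K D k -> modulus ((m' == m)%:R * (N^-1%:C)%C - a m') <= B * e.
  move=> e0.
  pose err (r : R) : fn -> fn := fun f z => \sum_(1 <= j < (Nk n k).+1)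
      Pk phi k (degeneration_point v r) j f z - diag_op K phi k (q k) f z.
  have [r [r0 opr]] : exists r : R, 0 <= r /\ (op_norm phi k (err r) < e%:E)%E.
    have : \forall r \near +oo, (op_norm phi k (err r) < e%:E)%E.
      have e0' : (0 < e%:E)%E by rewrite lte_fin.
      exact: (qlim _ (open_nbhs_nbhs (conj (@open_ereal_lt_ereal R e%:E) e0'))).
    move=> [r [_ Hr]]; exists (Num.max r 0 + 1); split.
      by rewrite addr_ge0// le_max lexx orbT.
    by apply: Hr; rewrite ltr_pwDr// le_max lexx.
  set p := degeneration_point v r in opr.
  have tp : torus p by exact: torus_degeneration.
  pose V j := Fk phi k p j.
  have sV j : subspace_of_Hk phi k (V j) by exact: Fk_subspace.
  have nV i j : (i <= j)%N -> V j `<=` V i.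
    by move=> ij f [Hf fo]; split=> // s si; apply: fo; exact: leq_trans ij.
  have qq : (1 <= q k m <= Nk n k)%N by rewrite q0.
  have := spectral_estimate tm k0 sV nV qq Hs.
  set g := orth_proj phi k (V (q k m)) (sk m).
  have [Vg _] := orth_projP tm k0 (sV (q k m)) Hs.
  set u := (X in _ <= hnorm phi k X) => su.
  have ue : hnorm phi k u < e.
    rewrite -lte_fin; apply: le_lt_trans opr; apply: ereal_sup_ubound.
    exists (sk m); first by split=> //; rewrite hnorm_sk.
    congr EFin; congr hnorm; by apply/funext => z; rewrite /err diag_op_sk.
  have ge : hnorm phi k (fun z => sk m z - g z) <= e by exact: le_trans su (ltW ue).
  have [Hg gord] := Vg.
  have [a [aE iE]] := iter_partial_Hk Hg.
  exists r, a; split=> //; split.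
    by apply: affine_relations => s sq; rewrite -iE//; exact: gord.
  move=> m' m'l.
  pose b m' := ((m' == m)%:R * (N^-1%:C)%C - a m') : C.
  have bE : laurent_on (lat K D k) b (fun z => sk m z - g z).
    move=> z tz; transitivity (sk m z - \sum_(m <- lat K D k) a m * monomial m z).
      by congr (_ - _); exact: aE.
    under [in RHS]eq_bigr do rewrite mulrBl.
    rewrite sumrB; congr (_ - _); rewrite (bigD1_seq m)//= ?lat_uniq// eqxx mul1r big1 ?addr0//.
    by move=> i im; rewrite (negbTE im) !mul0r.
  have Hd : Hk (fun z => sk m z - g z) by exact: (HkB tm Hs Hg).
  have := @coefficient_bound _ _ (lat K D k) b _ 0 (B * e) (lat_uniq _ _ _) bE.
  have d0 : dotp (of_lattice R m') 0 = 0 by rewrite -(scale0r (of_lattice R m')) dotpZr mul0r.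
  move=> /(_ _ m' m'l); rewrite d0.
  rewrite mul0r expR0 mulr1; apply => th.
  by apply: le_trans (HA _ Hd 0 th) _; rewrite ler_wpM2l.
apply/eqP; rewrite -modulus0_eq; apply/eqP.
pose S := \sum_(m' <- lat K D k) modulus (P m').
have S0 : 0 <= S by apply: sumr_ge0 => i _; exact: modulus_ge0.
have key (e : R) : 0 < e -> modulus (P m) * N^-1 <= B * e * S.
  move=> /close[r [a [r0 [rel ac]]]].
  set w := fun m' : 'rV[int]_n => zmonomial m' (degeneration_point v r) in rel.
  have relP : \sum_(m' <- lat K D k) a m' * w m' * P m' = 0.
    rewrite /P; under eq_bigr do rewrite mulr_sumr.
    rewrite exchange_big/= big1_seq// => ct /andP[_ ctT].
    under eq_bigr do rewrite mulrCA; rewrite -mulr_sumr.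
    by rewrite (rel _ (Tq _ ctT)) mulr0.
  have wE m' : w m' = ((expR (- (r * dotp v (of_lattice R m'))))%:C)%C by exact: zmonomial_degeneration.
  pose x m' := ((expR (- (r * (dotp v (of_lattice R m') - dotp v (of_lattice R m)))))%:C)%C : C.
  have relx : \sum_(m' <- lat K D k) a m' * x m' * P m' = 0.
    have xE m' : x m' = ((expR (r * dotp v (of_lattice R m)))%:C)%C * w m'.
      by rewrite wE -rmorphM -expRD /x; congr ((expR _)%:C)%C; ring.
    rewrite -[RHS](mulr0 (((expR (r * dotp v (of_lattice R m)))%:C)%C : C)) -[X in _ = _ * X]relP mulr_sumr.
    by apply: eq_bigr => m' _; rewrite xE; ring.
  have small m' : m' \in lat K D k -> m' != m -> modulus (a m' * x m' * P m') <= B * e * modulus (P m').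
    move=> m'l m'm; have [low|high] := ltP (dotp v (of_lattice R m')) (dotp v (of_lattice R m)).
      by rewrite Plow// mulr0 modulus0 mulr0.
    rewrite !modulusM ler_wpM2r ?modulus_ge0//.
    have := ac _ m'l; rewrite (negbTE m'm) mul0r sub0r modulusN => am.
    apply: le_trans am; rewrite ler_piMr ?modulus_ge0// /x modulusC ger0_norm ?expR_ge0//.
    by rewrite -[leRHS]expR0 ler_expR oppr_le0 mulr_ge0// subr_ge0.
  have xm : x m = 1 by rewrite /x subrr mulr0 oppr0 expR0.
  move: relx; rewrite (bigD1_seq m)//= ?lat_uniq// xm mulr1 => /eqP; rewrite addr_eq0 => /eqP aP.
  have -> : modulus (P m) * N^-1 = modulus (((N^-1%:C)%C - a m) * P m + a m * P m).
    rewrite -mulrDl subrK modulusM modulusC gtr0_norm ?invr_gt0//; exact: mulrC.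
  apply: le_trans (modulusD _ _) _; rewrite /S (bigD1_seq m)//= ?lat_uniq// mulrDr; apply: lerD.
    rewrite modulusM ler_wpM2r ?modulus_ge0//.
    by have := ac _ mlat; rewrite eqxx mul1r.
  rewrite aP modulusN; apply: le_trans (modulus_sum _ _ _) _; rewrite mulr_sumr.
  rewrite big_seq_cond [leRHS]big_seq_cond; apply: ler_sum => m' /andP[m'l m'm].
  exact: small.
apply/eqP; rewrite eq_le modulus_ge0 andbT leNgt; apply/negP => P0.
pose e := modulus (P m) * N^-1 / (B * S + 1).
have BS : 0 <= B * S by exact: mulr_ge0.
have PN : 0 < modulus (P m) * N^-1 by rewrite mulr_gt0// invr_gt0.
have e0 : 0 < e by rewrite divr_gt0// ltr_wpDl.
have := key e e0; apply/negP; rewrite -ltNge.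
have -> : B * e * S = modulus (P m) * N^-1 * (B * S / (B * S + 1)) by rewrite /e; field; rewrite !gt_eqF// ltr_wpDl.
by rewrite gtr_pMr// ltr_pdivrMr ?ltr_wpDl// mul1r ltrDl.
Qed.

End weights.

Section maximal_term.
Context (R : realType).

Lemma maximal_term (I : eqType) (S : seq I) (f : I -> R) :
  (forall i, 0 <= f i) -> 0 < \sum_(i <- S) f i ->
  exists2 i, i \in S & 0 < f i /\ forall g : I -> R,
    ln (\sum_(j <- S) f j) - ln (size S)%:R + g i <= ln (\sum_(j <- S) f j * expR (g j)).
Proof.
move=> f0 S0.
have [i iS imax] : exists2 i, i \in S & forall j, j \in S -> f j <= f i.
  have [i0 i0S] : exists i, i \in S by case: S S0 => [|i s]; [rewrite big_nil ltxx|exists i; rewrite mem_head].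
  elim: {S0} S i0 i0S => [//|i s IH] i0 _; case: s IH => [|j s] IH.
    by exists i; rewrite ?mem_head// => l; rewrite inE => /eqP ->.
  have [l ls lmax] := IH j (mem_head _ _).
  have [il|li] := leP (f i) (f l).
    by exists l; [rewrite inE ls orbT|move=> h; rewrite inE => /predU1P[->//|/lmax]].
  exists i; first exact: mem_head.
  by move=> h; rewrite inE => /predU1P[->//|/lmax /le_trans -> //]; exact: ltW.
have sz : \sum_(j <- S) f j <= (size S)%:R * f i.
  have -> : (size S)%:R * f i = \sum_(j <- S) f i.
    by rewrite big_const_seq count_predT iter_addr_0 mulr_natl.
  by rewrite big_seq [leRHS]big_seq; apply: ler_sum => j; exact: imax.
have fi : 0 < f i.
  rewrite lt_neqAle f0 andbT eq_sym; apply/eqP => fi0.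
  by move: (lt_le_trans S0 sz); rewrite fi0 mulr0 ltxx.
have sz0 : (0 : R) < (size S)%:R.
  by rewrite ltr0n; move: iS; case: (S).
exists i => //; split=> // g.
have fg : f i * expR (g i) <= \sum_(j <- S) f j * expR (g j).
  rewrite (big_rem i iS)/= lerDl; apply: sumr_ge0 => j _.
  by rewrite mulr_ge0// expR_ge0.
have fg0 : 0 < f i * expR (g i) by rewrite mulr_gt0// expR_gt0.
have E : ln (f i * expR (g i)) = ln (f i) + g i by rewrite lnM ?posrE ?expR_gt0// expRK.
have A : ln (f i) + g i <= ln (\sum_(j <- S) f j * expR (g j)).
  by rewrite -E ler_ln ?posrE//; exact: lt_le_trans fg.
apply: le_trans A; rewrite lerD2r lerBlDl -lnM ?posrE// ler_ln ?posrE//.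
by rewrite mulr_gt0.
Qed.

End maximal_term.

Section directional.
Context (R : realType) (n : nat).
Implicit Types (f : 'rV[R]_n -> R) (x w : 'rV[R]_n).

Lemma gradient_approx f x w (e : R) : differentiable f x -> 0 < e ->
  exists2 h0 : R, 0 < h0 & forall h, 0 < h -> h < h0 ->
    `|f (x + h *: w) - f x - h * dotp w (gradient f x)| <= e * h.
Proof.
move=> df e0.
have Dw : 'D_w f x = dotp w (gradient f x).
  rewrite deriveE// {1}(row_sum_delta w) linear_sum; apply: eq_bigr => i _.
  by rewrite linearZ mxE /partial deriveE.
have dw : derivable f x w by exact: diff_derivable.
have : h^-1 *: ((f \o shift x) (h *: w) - f x) @[h --> (0:R)^'] --> 'D_w f x by exact: dw.
move=> /cvgrPdist_le /(_ _ e0); rewrite near_withinE => /nbhs_ballP[h0 /= h00 H].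
exists h0 => // h hp hh0.
have := H h; rewrite /ball/= sub0r normrN gtr0_norm// => /(_ hh0 (lt0r_neq0 hp)).
rewrite Dw [h *: w + x]addrC -[_ *: _]/(h^-1 * _) => {}H.
have -> : f (x + h *: w) - f x - h * dotp w (gradient f x) =
   - h * (dotp w (gradient f x) - h^-1 * (f (x + h *: w) - f x)) by field; rewrite lt0r_neq0.
by rewrite normrM normrN (gtr0_norm hp) [leRHS]mulrC ler_pM2l.
Qed.

End directional.

Section slopes.
Context (R : realType) (n : nat) (K : set 'rV[R]_n) (phi : 'rV[R]_n -> R).
Context (D : nat) (M : R) (tm : tame K phi D M).
Context (c : 'rV[R]_n) (q : nat -> 'rV[int]_n -> nat) (kk : nat -> nat)
  (psi : R -> 'rV[R]_n -> R).
Local Notation C := (cplx R).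
Local Notation mono := (@monomial R n).
Hypothesis dphi : forall x, differentiable phi x.
Hypothesis gphi : forall y, interior K y -> exists x, gradient phi x = y.
Hypothesis kk_pos : forall i, (0 < kk i)%N.
Hypothesis kk_oo : kk i @[i --> \oo] --> \oo.
Hypothesis conv : rays_converge K phi q kk psi.
Hypothesis psiE : forall (t : R) (x : 'rV[R]_n), 0 <= t ->
  psi t x = phi (x - t *: c) + n%:R * t.
Implicit Types (k : nat) (x y : 'rV[R]_n) (m : 'rV[int]_n).

Let ell (y : 'rV[R]_n) : R := n%:R - dotp c y.

Definition Sseq k : seq 'rV[int]_n := [seq m <- lat K D k | `[< Sk K k m >]].

Lemma mem_Sseq k m : (m \in Sseq k) <-> Sk K k m.
Proof.
rewrite mem_filter; split=> [/andP[/asboolP//]|Sm].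
by rewrite (Sk_lat tm Sm) andbT; apply/asboolP.
Qed.

Definition term k m (x : 'rV[R]_n) (t : R) : R :=
  (hnorm phi k (mono m))^-1 ^+ 2 * expR (dotp (of_lattice R m) x + t * (q k m)%:R).

Lemma modulus_monomial m x : modulus (mono m (torus_point x 0)) ^+ 2 = expR (dotp (of_lattice R m) x).
Proof.
rewrite monomial_torus_point expi_sum modulus_expi -expRM_natl.
congr expR; rewrite /dotp -mulr_natl mulr_sumr; apply: eq_bigr => i _.
by rewrite !mxE; field.
Qed.

Lemma monomial_rayE k x t :
  monomial_ray K phi k (q k) t (torus_point x 0) = k%:R^-1 * ln (\sum_(m <- Sseq k) term k m x t).
Proof.
have SE : Sk K k = [set` Sseq k] by apply/seteqP; split=> m /=; rewrite -mem_Sseq.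
rewrite /monomial_ray; congr (_ * ln _); rewrite SE.
have uS : uniq (Sseq k) by exact/filter_uniq/lat_uniq.
rewrite -fsbig_seq//.
apply: eq_bigr => m _; rewrite /sk modulusM exprMn modulus_monomial /term expRD mulrA.
by rewrite modulusC real_normK ?num_real.
Qed.

Lemma termD k m x x' t t' :
  term k m x' t' = term k m x t * expR (dotp (of_lattice R m) (x' - x) + (t' - t) * (q k m)%:R).
Proof. by rewrite /term -[RHS]mulrA -expRD dotpBr; congr (_ * expR _); ring. Qed.

Lemma ray_cvg x t (e : R) : 0 <= t -> 0 < e -> \forall i \near \oo,
  `|monomial_ray K phi (kk i) (q (kk i)) t (torus_point x 0) - psi t x| < e.
Proof.
move=> t0 e0; have tz := @torus_torus_point R n x 0.
have [U Uz /(_ _ e0) H] := conv tz t0.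
have xE : log_coord (torus_point x 0) = x.
  by apply/rowP => i; rewrite mxE torus_pointE modulus_expi expRK; field.
by move: H; apply: filterS => i /(_ _ _ (nbhs_singleton Uz) tz t0); rewrite xE.
Qed.

Lemma lattice_count (e : R) : 0 < e -> \forall i \near \oo,
  ln (size (Sseq (kk i)))%:R <= (kk i)%:R * e.
Proof.
move=> e0.
have [N HN] : exists N : nat, forall k, (N <= k)%N -> ln (size (Sseq k))%:R <= k%:R * e.
  pose a := e / (2 * n.+1%:R).
  have a0 : 0 < a by rewrite divr_gt0// mulr_gt0.
  exists (Num.bound (2 * D%:R / a ^+ 2)).+1 => k Nk.
  have [|sz] := posnP (size (Sseq k)).
    by move=> ->; rewrite ln0// mulr_ge0// ltW.
  rewrite -ler_expR lnK ?posrE ?ltr0n//.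
  have kN : 2 * D%:R <= k%:R * a ^+ 2.
    rewrite -ler_pdivrMr ?exprn_gt0// ltW//.
    apply: lt_le_trans (archi_boundP _) _; first by apply: divr_ge0; [exact: mulr_ge0|exact: sqr_ge0].
    by rewrite ler_nat ltnW.
  have -> : k%:R * e = n.+1%:R * (2%:R * (k%:R * a)).
    by rewrite /a; field; rewrite nat1r pnatr_eq0.
  rewrite 2!expRM_natl; set b := expR (k%:R * a) ^+ 2.
  have bk : (D * k + D * k).+1%:R <= b.
    have ka : 0 <= k%:R * a by rewrite mulr_ge0// ltW.
    have H1 : (1 + k%:R * a) ^+ 2 <= b.
      by rewrite ler_sqr ?nnegrE ?expR_ge0 ?addr_ge0// expR_ge1Dx.
    apply: le_trans H1; rewrite -addn1 !natrD !natrM.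
    have : k%:R * (2 * D%:R) <= k%:R * (k%:R * a ^+ 2) :> R by rewrite ler_wpM2l.
    have -> : (k%:R * (k%:R * a ^+ 2)) = (k%:R * a) ^+ 2 :> R by ring.
    by rewrite sqrrD expr1n; lra.
  have b1 : 1 <= b by apply: le_trans bk; rewrite ler1n.
  apply: (@le_trans _ _ (((D * k + D * k).+1 ^ n)%:R)).
    rewrite ler_nat -(@size_box n) (leq_trans (_ : _ <= size (lat K D k))%N)// size_filter count_size//.
  rewrite natrX; apply: (@le_trans _ _ (b ^+ n)).
    by apply: lerXn2r; rewrite ?nnegrE// (le_trans _ b1).
  by rewrite exprS ler_peMl// exprn_ge0// (le_trans _ b1).
move: kk_oo => /cvgnyPge /(_ N); apply: filterS => i; exact: HN.
Qed.

Lemma slope_points y (rho : R) : interior K y -> 0 < rho -> rho <= ell y ->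
  \forall i \near \oo, exists m, [/\ Sk K (kk i) m, hnorm phi (kk i) (mono m) != 0,
    forall j, `|(m 0 j)%:~R / (kk i)%:R - y 0 j| <= rho &
    ell y - rho <= (q (kk i) m)%:R / (kk i)%:R].
Proof.
move=> /gphi[x xy] r0 rl; set X0 := x + c.
pose W (o : option (bool * 'I_n)) : 'rV[R]_n :=
  if o is Some (b, j) then (-1) ^+ b *: delta_mx 0 j else 0.
pose s (o : option (bool * 'I_n)) : R := if o is Some _ then 0 else 1.
have r20 : 0 < rho / 2 by rewrite divr_gt0.
have [h [h0 h1 hW]] : exists h : R, [/\ 0 < h, h < 1 & forall o,
    `|phi (x + h *: (W o + s o *: c)) - phi x - h * dotp (W o + s o *: c) y| <= rho / 2 * h].
  have near_o o : \forall h \near (0 : R)^'+,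
      `|phi (x + h *: (W o + s o *: c)) - phi x - h * dotp (W o + s o *: c) y| <= rho / 2 * h.
    have [hh hh0 H] := gradient_approx (W o + s o *: c) (@dphi x) r20.
    near=> h; rewrite -xy; apply: H => //; near: h; exact: nbhs_right_lt.
  near (0 : R)^'+ => h; exists h; split; first by near: h; exact: nbhs_right_gt.
    by near: h; exact: nbhs_right_lt.
  near: h; apply: filter_forall => o; exact: near_o.
pose e := h * rho / 16.
have e0 : 0 < e by rewrite divr_gt0// mulr_gt0.
pose X o := X0 + h *: W o; pose t o := 1 - h * s o.
have s01 o : 0 <= s o <= 1 by rewrite /s; case: o => [_|]; rewrite ?lexx ler01.
have t0 o : 0 <= t o.
  have /andP[s0 s1] := s01 o; rewrite /t subr_ge0 (le_trans _ (ltW h1))//.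
  by rewrite ler_piMr// ltW.
have psi0 : psi 1 X0 = phi x + n%:R by rewrite psiE// scale1r /X0 addrK mulr1.
have psio o : psi (t o) (X o) = phi (x + h *: (W o + s o *: c)) + n%:R * t o.
  rewrite psiE//; congr (phi _ + _); rewrite /X /X0 /t.
  by apply/rowP => i; rewrite !mxE; ring.
have near_rays : \forall i \near \oo, forall o,
   `|monomial_ray K phi (kk i) (q (kk i)) (t o) (torus_point (X o) 0) - psi (t o) (X o)| < e.
  by apply: filter_forall => o; exact: ray_cvg.
near=> i.
have rays : forall o, `|monomial_ray K phi (kk i) (q (kk i)) (t o) (torus_point (X o) 0) - psi (t o) (X o)| < e.
  by near: i; exact: near_rays.
have ray0 : `|monomial_ray K phi (kk i) (q (kk i)) 1 (torus_point X0 0) - psi 1 X0| < e.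
  by near: i; exact: ray_cvg.
have cnt : ln (size (Sseq (kk i)))%:R <= (kk i)%:R * e.
  by near: i; exact: lattice_count.
set k := kk i in rays ray0 cnt *; have k0 : (0 : R) < k%:R by rewrite ltr0n kk_pos.
rewrite !monomial_rayE in ray0; pose f m := term k m X0 1.
have f0 m : 0 <= f m by rewrite mulr_ge0 ?expR_ge0// sqr_ge0.
pose g o m := dotp (of_lattice R m) (X o - X0) + (t o - 1) * (q k m)%:R.
have rayo o : `|k%:R^-1 * ln (\sum_(m <- Sseq k) f m * expR (g o m)) - psi (t o) (X o)| < e.
  have E : \sum_(m <- Sseq k) term k m (X o) (t o) = \sum_(m <- Sseq k) f m * expR (g o m).
    by apply: eq_bigr => m _; exact: termD.
  by rewrite -E; have := rays o; rewrite monomial_rayE.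
have hWle o : phi (x + h *: (W o + s o *: c)) - phi x <= h * dotp (W o + s o *: c) y + rho / 2 * h.
  by have := hW o; rewrite ler_norml => /andP[_]; lra.
have W0 : W None + s None *: c = c by rewrite /W /s add0r scale1r.
have [S0|S0] := leP (\sum_(m <- Sseq k) f m) 0.
  exfalso; have fz m : m \in Sseq k -> f m = 0.
    move=> mS; apply/eqP; rewrite eq_le f0 andbT (le_trans _ S0)// (big_rem m mS)/= lerDl.
    by apply: sumr_ge0.
  have := rayo None; rewrite big1_seq => [|m /andP[_ /fz ->]]; last by rewrite mul0r.
  move: ray0; rewrite big1_seq => [|m /andP[_]]; last exact: fz.
  rewrite ln0// mulr0 !sub0r !normrN psi0 psio => /ltr_normlP[A1 A2] /ltr_normlP[A3 A4].
  have := hWle None; rewrite W0 /t /s mulr1 in A3 A4 *.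
  have hr : h * rho <= h * ell y by rewrite ler_pM2l.
  rewrite /ell in hr; rewrite /e in A1 A2 A3 A4.
  have := mulr_gt0 h0 r0; lra.
have [m mS [fm mmax]] := maximal_term f0 S0.
have key o : (dotp (of_lattice R m) (W o) - s o * (q k m)%:R) / k%:R <= dotp (W o) y - s o * ell y + rho.
  have := mmax (g o); rewrite -(@ler_pM2l _ k%:R^-1) ?invr_gt0// => H.
  have kn0 : k%:R != 0 :> R by rewrite gt_eqF.
  have cnt' : k%:R^-1 * ln (size (Sseq k))%:R <= e.
    by rewrite mulrC ler_pdivrMr// mulrC.
  have gE : g o m = h * (dotp (of_lattice R m) (W o) - s o * (q k m)%:R).
    rewrite /g /X /t [X0 + _]addrC addrK dotpZr; ring.
  rewrite gE in H; set Q := dotp _ _ - _ in H *.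
  have := rayo o; rewrite psio => /ltr_normlP[A1 A2].
  move: ray0; rewrite psi0 => /ltr_normlP[A3 A4].
  have := hWle o; rewrite dotpDl dotpZl /t in A1 A2 * => A5.
  rewrite mulrDr mulrBr in H.
  rewrite -(ler_pM2l h0).
  have -> : h * (Q / k%:R) = k%:R^-1 * (h * Q) by ring.
  have := mulr_gt0 h0 r0; rewrite /e in cnt' A1 A2 A3 A4.
  rewrite /ell; move: H A1 A2 A3 A4 A5 cnt'.
  set L1 := k%:R^-1 * ln _; set L2 := k%:R^-1 * ln _; set L3 := k%:R^-1 * ln _.
  set Y := k%:R^-1 * _; set ph := phi _; set ph' := phi _; set dW := dotp (W o) y; set dc := dotp c y.
  move=> H A1 A2 A3 A4 A5 cnt' hr.
  have -> : h * (dW - s o * (n%:R - dc) + rho) = h * (dW + s o * dc) - n%:R * (h * s o) + h * rho by ring.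
  rewrite mulrBr mulr1 in A1 A2; lra.
exists m; split.
- exact/mem_Sseq.
- by apply: contraTneq fm => hn; rewrite /f /term hn invr0 expr0n/= mul0r ltxx.
- move=> j; have dj (z : 'rV[R]_n) b : dotp z (W (Some (b, j))) = (-1) ^+ b * z 0 j.
    rewrite /W dotpZr; congr (_ * _); rewrite /dotp (bigD1 j)//= mxE !eqxx mulr1 big1 ?addr0//.
    by move=> l lj; rewrite mxE eqxx (negbTE lj) mulr0.
  have := key (Some (true, j)); have := key (Some (false, j)).
  rewrite [dotp (W _) y]dotpC [dotp (W (Some (true, j))) y]dotpC !dj /s !mul0r !subr0 !mxE.
  rewrite expr0 expr1 !mul1r !mulN1r mulNr => H1 H2.
  by rewrite ler_norml; apply/andP; split; lra.
- have := key None; rewrite /W /s /= !mul1r -(scale0r (0 : 'rV[R]_n)) dotpZr dotpZl !mul0r !sub0r mulNr.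
  lra.
Unshelve. all: by end_near. Qed.

Lemma slope_points_uniform (Y : set 'rV[R]_n) (rho : R) : compact Y ->
  (forall y, Y y -> interior K y /\ 0 < ell y) -> 0 < rho ->
  \forall i \near \oo, forall y, Y y -> exists m, [/\ Sk K (kk i) m,
    hnorm phi (kk i) (mono m) != 0, forall j, `|(m 0 j)%:~R / (kk i)%:R - y 0 j| <= rho &
    ell y - rho <= (q (kk i) m)%:R / (kk i)%:R].
Proof.
move=> /compact_near_coveringP cY Yell r0.
apply: (cY _ \oo (fun i y => exists m, [/\ Sk K (kk i) m,
    hnorm phi (kk i) (mono m) != 0, forall j, `|(m 0 j)%:~R / (kk i)%:R - y 0 j| <= rho &
    ell y - rho <= (q (kk i) m)%:R / (kk i)%:R])) => y Yy.
have [Ky ly] := Yell _ Yy.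
pose r' := Num.min (rho / 2) (ell y).
have r'0 : 0 < r' by rewrite lt_min divr_gt0.
have r'l : r' <= ell y by rewrite ge_min lexx orbT.
have r'r : r' <= rho / 2 by rewrite ge_min lexx.
have H := slope_points Ky r'0 r'l.
have yj : \forall y' \near y, forall j, `|y 0 j - (y' : 'rV[R]_n) 0 j| <= rho / 2.
  have FF : Filter (nbhs y) by exact: nbhs_filter.
  apply: (@filter_forall _ 'I_n (fun j (y' : 'rV[R]_n) => `|y 0 j - y' 0 j| <= rho / 2) (nbhs y) FF) => j.
  have /cvgrPdist_le : {for y, continuous (fun z : 'rV[R]_n => z 0 j)} by exact: coord_continuous.
  by apply; rewrite divr_gt0.
have yl : \forall y' \near y, `|dotp c y - dotp c y'| <= rho / 2.
  have /cvgrPdist_le : {for y, continuous (fun z : 'rV[R]_n => dotp c z)} by exact: dotp_continuous.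
  by apply; rewrite divr_gt0.
exists ([set y' | (forall j, `|y 0 j - (y' : 'rV[R]_n) 0 j| <= rho / 2) /\ `|dotp c y - dotp c y'| <= rho / 2],
  [set i | exists m, [/\ Sk K (kk i) m, hnorm phi (kk i) (mono m) != 0,
    forall j, `|(m 0 j)%:~R / (kk i)%:R - y 0 j| <= r' &
    ell y - r' <= (q (kk i) m)%:R / (kk i)%:R]]).
  by split; [exact: filterI yj yl|exact: H].
move=> [y' i] /= [[yj' yl'] [m [Sm hm mj qm]]]; exists m; split=> //.
- move=> j; rewrite -(subrK (y 0 j) (_ / _)) -addrA (le_trans (ler_normD _ _))//.
  by have := mj j; have := yj' j; lra.
- apply: le_trans qm; rewrite /ell; move: yl'; rewrite ler_norml => /andP[A1 A2].
  by rewrite /ell in r'l; lra.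
Qed.

End slopes.

Section newton.
Context (R : realType) (n : nat).
Local Notation C := (cplx R).
Implicit Types (g b m : 'rV[int]_n).

Definition nodes g s (e : {ffun 'I_n -> 'I_s}) : seq ('I_n * int) :=
  [seq (i, g 0 i + l%:Z) | i <- enum 'I_n, l <- iota 0 (e i)].

Lemma size_nodes g s (e : {ffun 'I_n -> 'I_s}) : (size (nodes g e) <= n * s)%N.
Proof.
rewrite /nodes size_allpairs_dep sumnE big_map.
have -> : (n * s = \sum_(i <- enum 'I_n) s)%N.
  by rewrite big_enum sum_nat_const card_ord.
by apply: leq_sum => i _; rewrite size_iota ltnW.
Qed.

Lemma affine_product_nodes g s (e : {ffun 'I_n -> 'I_s}) m :
  affine_product (nodes g e) m = \prod_(i < n) \prod_(0 <= l < e i) (m 0 i - (g 0 i + l%:Z)).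
Proof.
rewrite /affine_product /nodes big_allpairs_dep big_enum; apply: eq_bigr => i _.
by rewrite /index_iota subn0.
Qed.

Lemma affine_product_shift g b s (e : {ffun 'I_n -> 'I_s}) m :
  affine_product (nodes (g - b) e) m = affine_product (nodes g e) (m + b).
Proof.
rewrite !affine_product_nodes; apply: eq_bigr => i _; apply: eq_bigr => l _.
by rewrite !mxE; ring.
Qed.

Definition grid_point g s (a : {ffun 'I_n -> 'I_s}) : 'rV[int]_n :=
  \row_i (g 0 i + (a i : nat)%:Z).

Lemma newton_zero g s (e a : {ffun 'I_n -> 'I_s}) :
  (exists i, (a i < e i)%N) -> affine_product (nodes g e) (grid_point g a) = 0.
Proof.
move=> [i ai]; rewrite affine_product_nodes (bigD1 i)//= big_mkord (bigD1 (Ordinal ai))//=.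
by rewrite mxE subrr !mul0r.
Qed.

Lemma newton_diag g s (a : {ffun 'I_n -> 'I_s}) :
  affine_product (nodes g a) (grid_point g a) != 0.
Proof.
rewrite affine_product_nodes; apply/prodf_neq0 => i _.
rewrite big_mkord; apply/prodf_neq0 => l _; rewrite mxE; have := ltn_ord l; lia.
Qed.

Lemma newton_independent g s (c : {ffun 'I_n -> 'I_s} -> C) :
  (forall a : {ffun 'I_n -> 'I_s}, \sum_e c e * (affine_product (nodes g e) (grid_point g a))%:~R = 0) ->
  forall e, c e = 0.
Proof.
move=> H e; have [N] := ubnP (\sum_i (e i : nat))%N.
elim: N e => // N IH e; rewrite ltnS => eN.
have := H e; rewrite (bigD1 e)//= big1 => [|e' e'e].
  by move=> /eqP; rewrite addr0 mulf_eq0 intr_eq0 (negbTE (newton_diag g e)) orbF => /eqP.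
case: (pselect (exists i, (e i < e' i)%N)) => [ex|nex]; first by rewrite newton_zero// mulr0.
have le i : (e' i <= e i)%N by rewrite leqNgt; apply/negP => lt; apply: nex; exists i.
rewrite IH ?mul0r//; apply: leq_trans eN.
have [i i_lt] : exists i, (e' i < e i)%N.
  apply: contrapT => H'; move/eqP: e'e; apply; apply/ffunP => i; apply/val_inj/eqP.
  by rewrite eqn_leq le leqNgt; apply/negP => lt; apply: H'; exists i.
rewrite (bigD1 i)//= [X in (_ < X)%N](bigD1 i)//= -addSn leq_add//.
by apply: leq_sum => j _; exact: le.
Qed.

End newton.

Section counting.
Context (R : realType) (n : nat) (K : set 'rV[R]_n) (phi : 'rV[R]_n -> R).
Context (D : nat) (M : R) (tm : tame K phi D M).
Context (v : 'rV[R]_n) (q : nat -> 'rV[int]_n -> nat).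
Hypothesis q_weights : toric_weights K phi v q.
Hypothesis K0 : K 0.
Local Notation C := (cplx R).
Local Notation height m := (dotp v (of_lattice R m)).
Implicit Types (k L : nat) (m : 'rV[int]_n) (beta : R).

Lemma dilateD a b (x y : 'rV[R]_n) : dilate K a x -> dilate K b y -> dilate K (a + b) (x + y).
Proof.
move=> [x' Kx <-] [y' Ky <-].
have [ab0|ab] := posnP (a + b)%N.
  by move/eqP: ab0; rewrite addn_eq0 => /andP[/eqP -> /eqP ->]; exists x'; rewrite // !scale0r addr0.
have abR : (0 : R) < (a + b)%:R by rewrite ltr0n.
pose t : R := a%:R / (a + b)%:R.
have t01 : 0 <= t <= 1.
  by rewrite divr_ge0//= ler_pdivrMr// mul1r ler_nat leq_addr.
exists (t *: x' + (1 - t) *: y'); first exact: (convexP (tame_convex tm)).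
apply/rowP => i; rewrite !mxE /t natrD; field.
by rewrite -natrD gt_eqF.
Qed.

Lemma dilateS a b x : (a <= b)%N -> dilate K a x -> dilate K b x.
Proof.
move=> ab Kx; rewrite -(subnKC ab) -[x]addr0; apply: dilateD => //.
by exists 0; rewrite // scaler0.
Qed.

Definition low_points L beta : seq 'rV[int]_n := [seq m <- lat K D L | height m <= beta].

Lemma low_points_uniq L beta : uniq (low_points L beta).
Proof. exact/filter_uniq/lat_uniq. Qed.

Lemma mem_low_points L beta m :
  reflect (dilate K L (of_lattice R m) /\ height m <= beta) (m \in low_points L beta).
Proof.
rewrite mem_filter (mem_lat tm) andbC; apply: (iffP andP) => [[/asboolP]|[]] //.
by move=> ? ?; split=> //; apply/asboolP.
Qed.

Lemma of_latticeD m m' : of_lattice R (m + m') = of_lattice R m + of_lattice R m'.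
Proof. by apply/rowP => i; rewrite !mxE intrD. Qed.

Lemma count_increment k L L' beta s (g : 'rV[int]_n) : (0 < k)%N -> (k <= L')%N -> (L <= L')%N ->
  (forall m, m \in low_points L beta -> exists m', [/\ Sk K k m',
     hnorm phi k (@monomial R n m') != 0, (n * s < q k m')%N &
     dilate K (L' - k) (of_lattice R (m - m'))]) ->
  (forall a : {ffun 'I_n -> 'I_s}, grid_point g a \in low_points L' beta) ->
  (size (low_points L beta) + s ^ n <= size (low_points L' beta))%N.
Proof.
move=> k0 kL' LL' Hm Hg.
pose rest := [seq m <- low_points L' beta | m \notin low_points L beta].
have ur : uniq rest by exact/filter_uniq/low_points_uniq.
have LL m : m \in low_points L beta -> m \in low_points L' beta.
  by move=> /mem_low_points[mL mb]; apply/mem_low_points; split=> //; exact: dilateS mL.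
have szE : (size (low_points L beta) + size rest <= size (low_points L' beta))%N.
  rewrite -size_cat; apply: uniq_leq_size.
    rewrite cat_uniq low_points_uniq ur andbT /=.
    by apply/hasPn => m; rewrite mem_filter => /andP[].
  by move=> m; rewrite mem_cat => /orP[/LL//|]; rewrite mem_filter => /andP[].
apply: leq_trans szE; rewrite leq_add2l leqNgt; apply/negP => lt.
pose E := {ffun 'I_n -> 'I_s}.
have cE : #|{: E}| = (s ^ n)%N by rewrite card_ffun !card_ord.
pose ap (e : E) m : C := (affine_product (nodes g e) m)%:~R.
pose Mx : 'M[C]_(#|{: E}|, size rest) := \matrix_(i, j) ap (enum_val i) (nth 0 rest j).
have : kermx Mx != 0.
  rewrite kermx_eq0 /row_free; apply/negP => /eqP rE.
  by have := rank_leq_col Mx; rewrite rE cE leqNgt lt.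
move=> /rowV0Pn[u /sub_kermxP uM /eqP u0]; apply: u0.
pose c (e : E) : C := u 0 (enum_rank e).
pose P m : C := \sum_e c e * ap e m.
have Prest m : m \in rest -> P m = 0.
  move=> mr; have := mr; rewrite -index_mem => jr.
  have /rowP/(_ (Ordinal jr)) := uM; rewrite !mxE => E0; rewrite -[RHS]E0.
  rewrite /P (reindex (fun i : 'I_(#|{: E}|) => enum_val i))/=; last by exists enum_rank => x _; [exact: enum_valK|exact: enum_rankK].
  by apply: eq_bigr => i _; rewrite !mxE /c enum_valK /= nth_index.
have Plow : forall m, m \in low_points L beta -> P m = 0.
  move=> m; pose below m := [seq x <- low_points L beta | height x < height m].
  have [N] := ubnP (size (below m)); elim: N m => // N IH m; rewrite ltnS => mN mL.
  have [m' [Sm' h0 qm bK]] := Hm _ mL; set b := m - m' in bK.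
  pose T : seq (C * seq ('I_n * int)) := [seq (c e, nodes (g - b) e) | e <- enum {: E}].
  have TE x : \sum_(ct <- T) ct.1 * (affine_product ct.2 x)%:~R = P (x + b).
    by rewrite big_map big_enum; apply: eq_bigr => e _; rewrite /= affine_product_shift.
  have mE : m = m' + b by rewrite /b addrC subrK.
  have := @weight_vanishing R n K phi D M tm k k0 v q m' T q_weights Sm' h0.
  rewrite TE -mE; apply.
    by move=> ct /mapP[e _ ->] /=; apply: leq_ltn_trans qm; exact: size_nodes.
  move=> x xk; rewrite -(ltrD2r (height b)) -!dotpDr -!of_latticeD -mE => xm; rewrite TE.
  have xL' : x + b \in low_points L' beta.
    apply/mem_low_points; split.
      rewrite of_latticeD -(subnKC kL'); apply: dilateD => //.
      by move: xk; rewrite (mem_lat tm) => /asboolP.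
    by move/mem_low_points: mL => [_ mb]; apply: le_trans mb; exact: ltW.
  case: (boolP (x + b \in low_points L beta)) => xL; last by apply: Prest; rewrite mem_filter xL.
  apply: IH => //; apply: leq_trans mN.
  apply: (@uniq_leq_size _ (x + b :: below (x + b))).
    by rewrite /= mem_filter ltxx filter_uniq// low_points_uniq.
  move=> y; rewrite inE => /predU1P[->|]; first by rewrite mem_filter xm.
  by rewrite !mem_filter => /andP[yx ->]; rewrite (lt_trans yx xm).
have c0 : forall e, c e = 0.
  apply: (@newton_independent R n g s c) => a; rewrite -[LHS]/(P (grid_point g a)).
  case: (boolP (grid_point g a \in low_points L beta)) => [/Plow//|aL].
  by apply: Prest; rewrite mem_filter aL Hg.
by apply/rowP => i; rewrite mxE -[RHS](c0 (enum_val i)) /c enum_valK.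
Qed.

End counting.

Section apex.
Context (R : realType) (n : nat) (K : set 'rV[R]_n) (phi : 'rV[R]_n -> R).
Context (D : nat) (M : R) (tm : tame K phi D M).
Context (v c p : 'rV[R]_n) (q : nat -> 'rV[int]_n -> nat) (kk : nat -> nat)
  (psi : R -> 'rV[R]_n -> R) (r0 : R).
Hypothesis dphi : forall x, differentiable phi x.
Hypothesis gphi : forall y, interior K y -> exists x, gradient phi x = y.
Hypothesis q_weights : toric_weights K phi v q.
Hypothesis kk_pos : forall i, (0 < kk i)%N.
Hypothesis kk_oo : kk i @[i --> \oo] --> \oo.
Hypothesis conv : rays_converge K phi q kk psi.
Hypothesis psiE : forall (t : R) (x : 'rV[R]_n), 0 <= t ->
  psi t x = phi (x - t *: c) + n%:R * t.
Let ell (y : 'rV[R]_n) : R := n%:R - dotp c y.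
Hypothesis r0_gt0 : 0 < r0.
Hypothesis cube : forall z : 'rV[R]_n, (forall i, `|z 0 i| <= r0) -> K z.
Hypothesis ell_ge0 : forall y, K y -> 0 <= ell y.
Hypothesis ell_eq0 : forall y, K y -> ell y = 0 -> y = p.
Local Notation height m := (dotp v (of_lattice R m)).

Let vK := convexP (tame_convex tm).

Lemma origin_in : K 0.
Proof. by apply: cube => i; rewrite mxE normr0 ltW. Qed.

Lemma shrink (t : R) y : 0 <= t <= 1 -> K y -> K (t *: y).
Proof. by move=> t01 Ky; have := vK Ky origin_in t01; rewrite scaler0 addr0. Qed.

(* the interior point 0 makes every proper contraction of K thick *)
Lemma thick (la : R) (y z : 'rV[R]_n) : 0 <= la < 1 -> K y ->
  (forall i, `|z 0 i - la * y 0 i| <= (1 - la) * r0) -> K z.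
Proof.
move=> /andP[l0 l1] Ky zy; have la0 : 0 < 1 - la by rewrite subr_gt0.
have Kw : K ((1 - la)^-1 *: (z - la *: y)).
  apply: cube => i; rewrite !mxE normrM gtr0_norm ?invr_gt0//.
  by rewrite mulrC ler_pdivrMr// [leRHS]mulrC; exact: zy.
have l01 : 0 <= la <= 1 by rewrite l0 ltW.
have := vK Ky Kw l01.
by rewrite scalerA divff ?gt_eqF// scale1r addrC subrK.
Qed.

Lemma thick_interior (la : R) (y : 'rV[R]_n) : 0 <= la < 1 -> K y -> interior K (la *: y).
Proof.
move=> l01 Ky; have /andP[_ l1] := l01.
apply/nbhs_ballP; exists ((1 - la) * r0); first by rewrite /= mulr_gt0// subr_gt0.
move=> z [_ zy]; apply: (thick l01 Ky) => i.
by have := zy 0 i; rewrite /ball/= !mxE distrC => /ltW.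
Qed.

Lemma dotp_coord_bound (x : 'rV[R]_n) (r : R) : (forall i, `|x 0 i| <= r) ->
  dotp v x <= r * \sum_i `|v 0 i|.
Proof.
move=> xr; rewrite mulr_sumr; apply: ler_sum => i _.
by rewrite (le_trans (ler_norm _))// normrM mulrC ler_wpM2r.
Qed.

Lemma nat_half_floor (x : R) : 1 <= x -> exists e : nat, x / 2 <= e%:R <= x.
Proof.
move=> x1; have x0 : 0 <= x by lra.
exists (Num.trunc x); have /andP[A B] := truncn_itv x0; rewrite A andbT.
have e1 : (1 : R) <= (Num.trunc x)%:R.
  by rewrite ler1n lt0n; apply/eqP => E; rewrite E in B; lra.
by move: B; rewrite -natr1; lra.
Qed.

Section gap.
Context (y0 : 'rV[R]_n) (y0K : K y0) (y0_low : dotp v y0 < dotp v p).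
Let d := dotp v p - dotp v y0.
Let d0 : 0 < d. Proof. by rewrite subr_gt0. Qed.
Let alpha := dotp v y0 + d / 2.
Let alpha2 := dotp v y0 + 3 * d / 4.

Lemma ell_lower_bound : exists2 c0 : R, 0 < c0 &
  forall y, K y -> dotp v y <= alpha2 -> c0 <= ell y.
Proof.
have cY : compact (K `&` [set y | dotp v y <= alpha2]).
  apply: compact_closedI; first exact: (tame_compact tm).
  have /continuous_closedP H := @dotp_continuous R n v.
  by have := H _ (@closed_le R alpha2).
have Y0 : (K `&` [set y | dotp v y <= alpha2]) !=set0.
  by exists y0; split=> //=; rewrite /alpha2; move: d0; lra.
have cl : {within K `&` [set y | dotp v y <= alpha2], continuous ell}.
  apply: continuous_subspaceT => x; rewrite /ell.
  apply: (@continuousB R R^o _ (cst n%:R) (dotp c)); first exact: cst_continuous.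
  exact: dotp_continuous.
have [y1 y1Y ymin] := compact_EVT_min Y0 cY cl.
move: y1Y; rewrite inE => -[Ky1 /= vy1].
exists (ell y1); last by move=> y Ky vy; apply: ymin; rewrite inE.
rewrite lt_neqAle ell_ge0// andbT eq_sym; apply/eqP => /(ell_eq0 Ky1) E.
by move: vy1; rewrite E /alpha2; move: d0; rewrite /d; lra.
Qed.

Lemma low_center : exists (y1 : 'rV[R]_n) (r1 : R), 0 < r1 /\
  forall z : 'rV[R]_n, (forall i, `|z 0 i - y1 0 i| <= r1) -> K z /\ dotp v z <= alpha.
Proof.
pose V := \sum_i `|v 0 i|; have V0 : 0 <= V by apply: sumr_ge0.
pose N := `|dotp v y0| + r0 * V + 1.
have N0 : 0 < N by rewrite ltr_wpDl// addr_ge0// mulr_ge0// ltW.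
pose e := Num.min 1 (d / 2 / N).
have e0 : 0 < e by rewrite lt_min ltr01 !divr_gt0.
have e1 : e <= 1 by rewrite ge_min lexx.
have eN : e * N <= d / 2 by rewrite -ler_pdivlMr// ge_min lexx orbT.
exists ((1 - e) *: y0), (e * r0); split; first exact: mulr_gt0.
move=> z zy; split.
  apply: (@thick (1 - e) y0) => //; first by rewrite subr_ge0 e1 ltrBlDr ltrDl.
  by move=> i; have := zy i; rewrite mxE (_ : 1 - (1 - e) = e); last by ring.
have -> : z = (1 - e) *: y0 + (z - (1 - e) *: y0) by rewrite addrC subrK.
rewrite dotpDr dotpZr.
have H : dotp v (z - (1 - e) *: y0) <= e * r0 * V.
  by apply: dotp_coord_bound => i; have := zy i; rewrite !mxE.
apply: le_trans (lerD (lexx _) H) _; rewrite /alpha.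
have : - (e * dotp v y0) <= e * `|dotp v y0|.
  by rewrite -mulrN ler_pM2l// -normrN ler_norm.
by move: eN; rewrite /N; lra.
Qed.

Lemma no_gap : False.
Proof.
have [c0 c0_gt0 ellc] := ell_lower_bound.
have [y1 [r1 [r1_gt0 center]]] := low_center.
pose tau := Num.min 1 (d / 4 / (`|alpha| + 1)).
have al0 : 0 < `|alpha| + 1 by rewrite ltr_wpDl.
have tau0 : 0 < tau by rewrite lt_min ltr01 !divr_gt0.
have tau1 : tau <= 1 by rewrite ge_min lexx.
have taual : tau * `|alpha| <= d / 4.
  apply: (@le_trans _ _ (tau * (`|alpha| + 1))); first by rewrite ler_pM2l// lerDl.
  by rewrite -ler_pdivlMr// ge_min lexx orbT.
pose sigma := Num.min (r1 / 2) (c0 / (2 * n.+1%:R)).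
have sigma0 : 0 < sigma by rewrite lt_min !divr_gt0// mulr_gt0.
have sigr : sigma <= r1 / 2 by rewrite ge_min lexx.
have sigc : n%:R * sigma <= c0 / 2.
  have : sigma * (2 * n.+1%:R) <= c0 by rewrite -ler_pdivlMr ?mulr_gt0// ge_min lexx orbT.
  by rewrite -[n.+1%:R]natr1; move: sigma0; nra.
pose Q : R := ((8 * D%:R + 2) / sigma) ^+ n.
have Q0 : 0 <= Q by rewrite exprn_ge0// divr_ge0 ?ltW// addr_gt0// mulr_ge0.
pose N := (Num.bound Q).+1; have NQ : Q < N%:R.
  by apply: lt_le_trans (archi_boundP Q0) _; rewrite ler_nat.
have N0 : (0 : R) < N%:R by rewrite ltr0n.
pose ka := tau / (2 * N%:R).
have ka0 : 0 < ka by rewrite divr_gt0// mulr_gt0.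
have ka1 : ka <= 1 / 2.
  have N1 : (1 : R) <= N%:R by rewrite ler1n.
  by rewrite /ka ler_pdivrMr ?mulr_gt0//; lra.
pose la := 1 - ka / 2.
have la01 : 0 <= la < 1 by rewrite /la; move: ka0 ka1; lra.
have la0 : 0 < la by rewrite /la; move: ka0 ka1; lra.
pose rho := Num.min (c0 / 4) (ka * (ka / 2 * r0)).
have rho0 : 0 < rho.
  rewrite lt_min; apply/andP; split; first exact: divr_gt0.
  by apply: mulr_gt0 => //; apply: mulr_gt0 => //; exact: divr_gt0.
have rhoc : rho <= c0 / 4 by rewrite ge_min lexx.
have rhok : rho <= ka * (ka / 2 * r0) by rewrite ge_min lexx orbT.
pose Y : set 'rV[R]_n := [set la *: y | y in K] `&` [set y | dotp v y <= alpha2].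
have cY : compact Y.
  apply: compact_closedI.
    apply: continuous_compact; last exact: (tame_compact tm).
    by apply: continuous_subspaceT; exact: scaler_continuous.
  have /continuous_closedP H := @dotp_continuous R n v.
  by have := H _ (@closed_le R alpha2).
have Yint y : Y y -> interior K y /\ 0 < ell y.
  move=> [[y' Ky' <-] /= vy]; split; first exact: thick_interior.
  apply: lt_le_trans c0_gt0 _; apply: ellc => //; apply: shrink => //.
  by have /andP[-> /ltW] := la01.
have near_slopes := slope_points_uniform tm dphi gphi kk_pos kk_oo conv psiE cY Yint rho0.
have large (x : R) : 0 <= x -> exists b : nat, forall k, (b <= k)%N -> x <= k%:R.
  move=> x0; exists (Num.bound x) => k xk.
  by rewrite ltW// (lt_le_trans (archi_boundP x0))// ler_nat.
have Nt0 : 0 <= N%:R / tau by rewrite divr_ge0// ltW.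
have s0' : 0 <= sigma^-1 by rewrite invr_ge0 ltW.
have r10' : 0 <= 2 / r1 by rewrite divr_ge0// ltW.
have [b1 B1] := large _ Nt0; have [b2 B2] := large _ s0'; have [b3 B3] := large _ r10'.
pose k1 := (b1 + b2 + b3)%N.
have near_k : \forall i \near \oo, (k1 <= kk i)%N by move: kk_oo => /cvgnyPge /(_ k1).
have [i [slopes ki]] : exists i, (forall y, Y y -> exists m, [/\ Sk K (kk i) m,
    hnorm phi (kk i) (@monomial R n m) != 0, forall j, `|(m 0 j)%:~R / (kk i)%:R - y 0 j| <= rho &
    ell y - rho <= (q (kk i) m)%:R / (kk i)%:R]) /\ (k1 <= kk i)%N.
  near \oo => i; exists i; split; near: i; [exact: near_slopes|exact: near_k].
set k := kk i in slopes ki; have k0 : (0 < k)%N by exact: kk_pos.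
have kR : (0 : R) < k%:R by rewrite ltr0n.
have kN : N%:R / tau <= k%:R by apply: B1; apply: leq_trans ki; rewrite /k1 -addnA leq_addr.
have ks : sigma^-1 <= k%:R.
  by apply: B2; apply: leq_trans ki; rewrite /k1 addnAC leq_addl.
have kr : 2 / r1 <= k%:R by apply: B3; apply: leq_trans ki; rewrite /k1 leq_addl.
have [e /andP[e1 e2]] : exists e : nat, tau * k%:R / N%:R / 2 <= e%:R <= tau * k%:R / N%:R.
  by apply: nat_half_floor; rewrite ler_pdivlMr// mul1r mulrC -ler_pdivrMr.
have [s /andP[s1 s2]] : exists s : nat, sigma * k%:R / 2 <= s%:R <= sigma * k%:R.
  by apply: nat_half_floor; rewrite mulrC -ler_pdivrMr// div1r.
have eka : ka * k%:R <= e%:R.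
  apply: le_trans e1; rewrite /ka le_eqVlt; apply/orP; left; apply/eqP.
  by field; rewrite gt_eqF.
have eN : N%:R * e%:R <= tau * k%:R by rewrite mulrC -ler_pdivlMr.
pose L j := (k + j * e)%N.
have Lk j : (j <= N)%N -> (k%:R : R) <= (L j)%:R <= k%:R + tau * k%:R.
  move=> jN; rewrite /L natrD natrM lerDl mulr_ge0//= lerD2l (le_trans _ eN)//.
  by rewrite ler_wpM2r// ler_nat.
pose A j := low_points K D v (L j) (alpha * k%:R).
pose g : 'rV[int]_n := \row_j Num.floor (k%:R * y1 0 j).
have grid j (a : {ffun 'I_n -> 'I_s}) : grid_point g a \in A j.
  pose z : 'rV[R]_n := k%:R^-1 *: of_lattice R (grid_point g a).
  have zE : of_lattice R (grid_point g a) = k%:R *: z by rewrite /z scalerA divff ?scale1r// gt_eqF.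
  have [|Kz vz] := center z.
    move=> l; rewrite !mxE.
    have /andP[F1 F2] := floor_itv (k%:R * y1 0 l).
    have as_ : ((a l : nat)%:R : R) <= s%:R by rewrite ler_nat ltnW.
    have a0 : (0 : R) <= (a l : nat)%:R by [].
    have -> : k%:R^-1 * (Num.floor (k%:R * y1 0 l) + (a l : nat)%:Z)%:~R - y1 0 l =
       ((Num.floor (k%:R * y1 0 l))%:~R + (a l : nat)%:R - k%:R * y1 0 l) / k%:R.
      by rewrite intrD; field; rewrite gt_eqF.
    rewrite normrM (gtr0_norm (_ : 0 < k%:R^-1)) ?invr_gt0// ler_pdivrMr//.
    have r1k : 2 <= k%:R * r1 by rewrite -ler_pdivrMr.
    have sk2 : sigma * k%:R <= r1 / 2 * k%:R by rewrite ler_pM2r.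
    move: F2; rewrite intrD => F2.
    by rewrite ler_norml; apply/andP; split; lra.
  apply/(mem_low_points tm); split.
    rewrite zE; apply: (@dilateS R n K phi D M tm origin_in k); first exact: leq_addr.
    by exists z.
  by rewrite zE dotpZr mulrC ler_pM2r.
have step j : (j < N)%N -> (size (A j) + s ^ n <= size (A j.+1))%N.
  move=> jN; have /andP[L1 L2] := Lk _ jN.
  have kL : (k <= L j.+1)%N by exact: leq_addr.
  have LL : (L j <= L j.+1)%N by rewrite leq_add2l leq_mul2r leqnSn orbT.
  have Lk' : ((L j.+1 - k)%N%:R : R) = (L j.+1)%:R - k%:R by rewrite natrB.
  have LL' : (L j.+1)%:R = (L j)%:R + e%:R :> R by rewrite -natrD /L mulSn [(e + _)%N]addnC addnA.
  have L'0 : 0 < (L j.+1)%:R :> R by exact: lt_le_trans L1.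
  have Lka : ka * k%:R <= (L j.+1)%:R - k%:R.
    have : (k%:R : R) <= (L j)%:R by rewrite ler_nat leq_addr.
    by rewrite LL'; move: eka; lra.
  have L'k0 : 0 < (L j.+1)%:R - k%:R :> R by apply: lt_le_trans Lka; exact: mulr_gt0.
  apply: (@count_increment R n K phi D M tm v q q_weights origin_in k _ _ _ _ g) => //; last first.
    by move=> a; exact: (grid j.+1 a).
  move=> m /(mem_low_points tm)[[x Kx xE] mb].
  pose y := (L j.+1)%:R^-1 *: of_lattice R m.
  have mE : of_lattice R m = (L j.+1)%:R *: y by rewrite /y scalerA divff ?scale1r// gt_eqF.
  pose y' := la^-1 *: y; have yE : y = la *: y' by rewrite /y' scalerA divff ?scale1r// gt_eqF.
  have Ky' : K y'.
    rewrite /y' /y -xE !scalerA; apply: shrink => //.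
    have -> : la^-1 * (L j.+1)%:R^-1 * (L j)%:R = (L j)%:R / (la * (L j.+1)%:R).
      by field; rewrite !gt_eqF.
    apply/andP; split; first by apply: divr_ge0 => //; apply: mulr_ge0 => //; exact: ltW.
    rewrite ler_pdivrMr ?mulr_gt0// mul1r /la.
    have kt : tau * k%:R <= k%:R by rewrite ler_piMl.
    have : ka / 2 * (L j.+1)%:R <= ka / 2 * (2 * k%:R).
      by rewrite ler_pM2l ?divr_gt0//; lra.
    by lra.
  have vy : dotp v y <= alpha2.
    rewrite /y dotpZr mulrC ler_pdivrMr//; apply: le_trans mb _.
    have H1 : d / 4 * k%:R <= d / 4 * (L j.+1)%:R by rewrite ler_pM2l ?divr_gt0.
    have H2 : - (`|alpha| * (tau * k%:R)) <= alpha * ((L j.+1)%:R - k%:R).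
      apply: (@le_trans _ _ (- (`|alpha| * ((L j.+1)%:R - k%:R)))).
        by rewrite lerN2 ler_wpM2l//; lra.
      by rewrite -mulNr ler_pM2r// lerNl -normrN ler_norm.
    have H3 : tau * `|alpha| * k%:R <= d / 4 * k%:R by rewrite ler_pM2r.
    have -> : alpha2 = alpha + d / 4 by rewrite /alpha2 /alpha; field.
    lra.
  have Yy : Y y by split=> //; exists y'.
  have Ky : K y by rewrite yE; apply: shrink => //; have /andP[-> /ltW] := la01.
  clearbody y'; clearbody y.
  have [m' [Sm' h0 mj qm]] := slopes _ Yy.
  exists m'; split=> //.
    rewrite -(ltr_nat R) natrM.
    have := ellc _ Ky vy; move: qm; rewrite ler_pdivlMr// => qm ey.
    have G1 : (3 / 4 * c0) * k%:R <= (ell y - rho) * k%:R.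
      by rewrite ler_pM2r//; lra.
    have G2 : n%:R * s%:R <= n%:R * (sigma * k%:R) by rewrite ler_wpM2l.
    have G3 : n%:R * sigma * k%:R <= c0 / 2 * k%:R by rewrite ler_pM2r.
    have G4 := mulr_gt0 c0_gt0 kR; lra.
  exists (((L j.+1)%:R - k%:R)^-1 *: of_lattice R (m - m')); last first.
    by rewrite Lk' scalerA divff ?scale1r// gt_eqF.
  apply: (@thick la y') => // l.
  have yl : la * y' 0 l = y 0 l by rewrite yE mxE.
  have ml : (m 0 l)%:~R = (L j.+1)%:R * y 0 l :> R.
    by have := congr1 (fun u : 'rV[R]_n => u 0 l) mE; rewrite !mxE.
  rewrite yl !mxE intrB ml.
  have -> : ((L j.+1)%:R - k%:R)^-1 * ((L j.+1)%:R * y 0 l - (m' 0 l)%:~R) - y 0 l =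
     - ((m' 0 l)%:~R / k%:R - y 0 l) * (k%:R / ((L j.+1)%:R - k%:R)).
    by field; rewrite !gt_eqF.
  rewrite normrM normrN [X in _ * X]ger0_norm; last by rewrite divr_ge0// ltW.
  rewrite mulrA ler_pdivrMr//; apply: (@le_trans _ _ (rho * k%:R)).
    by rewrite ler_wpM2r.
  apply: (@le_trans _ _ (ka / 2 * r0 * (ka * k%:R))).
    by rewrite mulrCA mulrA ler_pM2r.
  have -> : 1 - la = ka / 2 by rewrite /la; ring.
  by rewrite ler_pM2l//; apply: mulr_gt0 => //; exact: divr_gt0.
have total : forall l, (l <= N)%N -> (l * s ^ n <= size (A l))%N.
  elim=> [|l IH] lN; first by rewrite mul0n.
  rewrite mulSn addnC; apply: leq_trans (step _ lN).
  by rewrite leq_add2r; apply: IH; exact: ltnW.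
have := total N (leqnn N); rewrite -(ler_nat R) natrM natrX => tot.
have /andP[L1 L2] := Lk N (leqnn N).
have szA : (size (A N))%:R <= ((4 * D%:R + 1) * k%:R) ^+ n :> R.
  apply: (@le_trans _ _ (((D * L N + D * L N).+1 ^ n)%:R)).
    rewrite ler_nat -(@size_box n) (leq_trans (_ : _ <= size (lat K D (L N)))%N)// size_filter count_size//.
  rewrite natrX; apply: lerXn2r; rewrite ?nnegrE ?mulr_ge0 ?addr_ge0 ?mulr_ge0//.
  rewrite -addn1 !natrD !natrM.
  have k1' : (1 : R) <= k%:R by rewrite ler1n.
  have kt : tau * k%:R <= k%:R by rewrite ler_piMl.
  have : D%:R * (L N)%:R <= D%:R * (2 * k%:R) :> R by rewrite ler_wpM2l//; lra.
  lra.
have lower : N%:R * (sigma * k%:R / 2) ^+ n <= N%:R * s%:R ^+ n.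
  by rewrite ler_pM2l//; apply: lerXn2r; rewrite ?nnegrE// divr_ge0// mulr_ge0// ltW.
have P0 : 0 < (sigma * k%:R / 2) ^+ n by rewrite exprn_gt0// divr_gt0// mulr_gt0.
have : N%:R * (sigma * k%:R / 2) ^+ n <= Q * (sigma * k%:R / 2) ^+ n.
  apply: le_trans lower (le_trans tot _); apply: le_trans szA _.
  rewrite -exprMn le_eqVlt; apply/orP; left; apply/eqP; congr (_ ^+ _).
  by field; rewrite gt_eqF.
by rewrite ler_pM2r// leNgt NQ.
Unshelve. all: by end_near. Qed.

End gap.

End apex.

Theorem theorem6p1 (R : realType) (n : nat) (K : set 'rV[R]_n)
    (phi : 'rV[R]_n -> R) (v c p : 'rV[R]_n)
    (q : nat -> 'rV[int]_n -> nat) (kk : nat -> nat)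
    (psi : R -> 'rV[R]_n -> R)
    (ell := fun y : 'rV[R]_n => n%:R - dotp c y)
    (B := [set y | K y /\ ell y = n.+1%:R])
    (K_compact : compact K) (K_convex : @convex_set R 'rV[R]_n K)
    (K_full : interior K !=set0)
    (K_barycenter : barycenter K = 0)
    (K_lattice : [set m : 'rV[int]_n | interior K (of_lattice R m)] = [set 0])
    (K_vol : vol K = (n.+1%:R ^+ n / n`!%:R)%:E)
    (phi_BB13 : BB13_potential K phi)
    (v_generic : ~ exceptional_set K phi v)
    (q_weights : toric_weights K phi v q)
    (kk_pos : forall i, (0 < kk i)%N)
    (kk_oo : kk i @[i --> \oo] --> \oo)
    (psi_ray : toric_limit_ray K phi q kk psi)
    (psiE : forall (t : R) (x : 'rV[R]_n), 0 <= t ->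
      psi t x = phi (x - t *: c) + n%:R * t)
    (apex : [set y | K y /\ ell y = 0] = [set p])
    (pyramid : K = hull ([set p] `|` B)) :
  is_minimum [set dotp v y | y in K] (dotp v p).
Proof.
have [Kp lp] : K p /\ ell p = 0 by have : [set p] p by []; rewrite -apex.
split; first by exists p.
move=> _ [y0 y0K <-]; rewrite leNgt; apply/negP => low.
have [smooth _ [[_ _ surj] _ _] _ [M near_h]] := phi_BB13.
have dphi x : differentiable phi x by exact: (smooth [::]).
have gphi y : interior K y -> exists x, gradient phi x = y.
  by move=> /surj[x _ xy]; exists x.
have [D K_box] := compact_coord_bound K_compact.
have tm : tame K phi D M.
  by split=> // [|x]; [exists p|exact: differentiable_continuous].
have K0 : interior K 0.
  have : [set 0 : 'rV[int]_n] 0 by [].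
  rewrite -K_lattice /= (_ : of_lattice R 0 = 0)//.
  by apply/rowP => i; rewrite !mxE.
have [r r0 cube] : exists2 r : R, 0 < r & forall z : 'rV[R]_n, (forall i, `|z 0 i| <= r) -> K z.
  move: K0 => /nbhs_ballP[r /= r0 H]; exists (r / 2); first by rewrite divr_gt0.
  move=> z zr; apply: H; split=> // i j; rewrite (ord1 i) /ball/= mxE sub0r normrN.
  by apply: le_lt_trans (zr j) _; rewrite ltr_pdivrMr// ltr_pMr// ltr1n.
have ell_ge0 : forall y, K y -> 0 <= ell y.
  have sub : hull ([set p] `|` B) `<=` [set y | 0 <= ell y].
    apply: (@smallest_sub _ (@convex_set R 'rV[R]_n)) => [x x' t|z].
      rewrite !inE /= /ell => lx lx'.
      have t0 : 0 <= t%:num by []; have t1 : t%:num <= 1 by [].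
      rewrite -[X in dotp c X]/(t%:num *: x + (1 - t%:num) *: x') dotpDr !dotpZr.
      have A : 0 <= t%:num * (n%:R - dotp c x) by exact: mulr_ge0.
      have A' : 0 <= (1 - t%:num) * (n%:R - dotp c x') by rewrite mulr_ge0// subr_ge0.
      by lra.
    by move=> [->|[_ /= ->]]; rewrite /= ?lp.
  by move=> y; rewrite {1}pyramid; exact: sub.
have ell_eq0 y : K y -> ell y = 0 -> y = p.
  by move=> Ky ly; have : [set y | K y /\ ell y = 0] y by []; rewrite apex.
have [conv _ _ _ _] := psi_ray.
exact: (no_gap tm dphi gphi q_weights kk_pos kk_oo conv psiE r0 cube ell_ge0 ell_eq0 y0K low).
Qed.
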